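(* (Fueter-Sce theorem.) Let $D\subseteq\mathbb{R}^{p+2}$ be an open set invariant under $(\mathbf{x}_p,r)\mapsto(\mathbf{x}_p,-r)$, and let $f(\mathbf{x})=F_1(\mathbf{x}')+\underline{\omega}F_2(\mathbf{x}')$ be a generalized partial-slice regular function on $\Omega_D$. Then, for odd $q\in\mathbb{N}$, the function $\Delta_{\mathbf{x}}^{\frac{q-1}{2}}f$ is monogenic in $\Omega_D$ and $$\Delta_{\mathbf{x}}^{\frac{q-1}{2}}f(\mathbf{x})=(q-1)!!\,\big(A(\mathbf{x}')+\underline{\omega}B(\mathbf{x}')\big),\qquad A(\mathbf{x}')=\Big(\frac1r\partial_r\Big)^{\frac{q-1}{2}}F_1(\mathbf{x}'),\quad B(\mathbf{x}')=\Big(\partial_r\frac1r\Big)^{\frac{q-1}{2}}F_2(\mathbf{x}'),$$ where $\mathbf{x}=\mathbf{x}_p+r\underline{\omega}\in\Omega_D$ and $\mathbf{x}'=(\mathbf{x}_p,r)$, and the values of $A$, $B$ at points with $r=0$ are understood as the limits as $r\to0$ (which exist).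
   Context: Let $\mathbb{A}$ be a real alternative algebra (the associator $[a,b,c]=(ab)c-a(bc)$ is an alternating trilinear function) with unity $1$, of finite real dimension $d>1$, equipped with an anti-involution $a\mapsto a^c$ (real linear, $a^c=a$ for $a\in\mathbb{R}$, $(a^c)^c=a$, $(ab)^c=b^ca^c$). Let $t(x)=x+x^c$, $n(x)=xx^c$, $\mathbb{S}_{\mathbb{A}}=\{x\in\mathbb{A}: t(x)=0,\ n(x)=1\}$ (assumed nonempty) and $Q_{\mathbb{A}}=\mathbb{R}\cup\{x: t(x)\in\mathbb{R},\ n(x)\in\mathbb{R},\ 4n(x)>t(x)^2\}$. Let $M$ be a real subspace with $\mathbb{R}\subsetneq M\subseteq Q_{\mathbb{A}}$ having a basis $(v_0,v_1,\dots,v_m)$, $m\ge1$, $v_0=1$, $v_s\in\mathbb{S}_{\mathbb{A}}$ and $v_sv_t=-v_tv_s$ for distinct $s,t\ge1$; complete it to a real basis of $\mathbb{A}$ and use the associated Euclidean norm $|\cdot|$. Identify $x=\sum_{s=0}^m x_sv_s\in M$ with $(x_0,\dots,x_m)\in\mathbb{R}^{m+1}$; $\mathbb{A}$-valued functions are differentiated componentwise. Fix $p\in\{0,\dots,m-1\}$ and $q=m-p$; write $\mathbf{x}=\mathbf{x}_p+\underline{\mathbf{x}}_q$ with $\mathbf{x}_p=\sum_{s=0}^p x_sv_s$ (identified with $\mathbb{R}^{p+1}$) and $\underline{\mathbf{x}}_q=\sum_{s=p+1}^m x_sv_s$. Let $\mathbb{S}=\{\sum_{s=p+1}^m x_sv_s:\sum_{s=p+1}^m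 x_s^2=1\}$; write $\underline{\mathbf{x}}_q=r\underline{\omega}$ with $r=|\underline{\mathbf{x}}_q|\ge0$, $\underline{\omega}\in\mathbb{S}$, and $\mathbf{x}'=(\mathbf{x}_p,r)\in\mathbb{R}^{p+2}$. Operators (acting on the left): $D_{\mathbf{x}_p}f=\sum_{s=0}^p v_s\partial_{x_s}f$, $\overline{D}_{\mathbf{x}_p}f=\partial_{x_0}f-\sum_{s=1}^p v_s\partial_{x_s}f$, $D_{\mathbf{x}}f=\sum_{s=0}^m v_s\partial_{x_s}f$, $\Delta_{\mathbf{x}}=\sum_{s=0}^m\partial_{x_s}^2$. A $C^1$ function $f$ on an open set of $M$ is monogenic if $D_{\mathbf{x}}f=0$. For an open $D\subseteq\mathbb{R}^{p+2}$ invariant under $(\mathbf{x}_p,r)\mapsto(\mathbf{x}_p,-r)$, its p-symmetric completion is $\Omega_D=\{\mathbf{x}_p+r\underline{\omega}: (\mathbf{x}_p,r)\in D,\ r\ge0,\ \underline{\omega}\in\mathbb{S}\}$. A stem function is $F=(F_1,F_2):D\to\mathbb{A}^2$ with $F_1(\mathbf{x}_p,-r)=F_1(\mathbf{x}_p,r)$, $F_2(\mathbf{x}_p,-r)=-F_2(\mathbf{x}_p,r)$; it induces the generalized partial-slice function $f(\mathbf{x}_p+r\underline{\omega})=F_1(\mathbf{x}_p,r)+\underline{\omega}F_2(\mathbf{x}_p,r)$ on $\Omega_D$. Such $f$ with $F\in C^1$ is generalized partial-slice regular if $D_{\mathbf{x}_p}F_1-\partial_rF_2=0$ and $\overline{D}_{\mathbf{x}_p}F_2+\partial_rF_1=0$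 on $D$. Here $(\partial_r\frac1r)G$ means $\partial_r(G/r)$, and $(q-1)!!$ is the double factorial with $0!!=1$. *)

(* Defs.v *)
From HB Require Import structures.
From mathcomp Require Import all_boot all_order all_algebra.
From mathcomp Require Import all_classical all_reals.
From mathcomp Require Import topology normedtype derive.
Set Implicit Arguments. Unset Strict Implicit. Unset Printing Implicit Defensive.
Import Order.TTheory GRing.Theory Num.Theory.
Import numFieldNormedType.Exports.
Local Open Scope classical_set_scope.
Local Open Scope ring_scope.

(* The algebra A is R^d in a fixed real basis ('rV[R]_d); its product is
   [mul], its unity [one], its anti-involution [cj]. Reals sit in A as k *: one. *)

Definition assoc (R : realType) (d : nat) (mul : 'rV[R]_d -> 'rV[R]_d -> 'rV[R]_d)
  (a b c : 'rV[R]_d) : 'rV[R]_d := mul (mul a b) c - mul a (mul b c).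

Definition alt_algebra (R : realType) (d : nat)
  (mul : 'rV[R]_d -> 'rV[R]_d -> 'rV[R]_d) (one : 'rV[R]_d)
  (cj : 'rV[R]_d -> 'rV[R]_d) : Prop :=
  [/\ (1 < d)%N,
   [/\
      (forall (k : R) a b c, mul (k *: a + b) c = k *: mul a c + mul b c),
      (forall (k : R) a b c, mul a (k *: b + c) = k *: mul a b + mul a c),
      (forall a, mul one a = a /\ mul a one = a) &
      (forall a b, [/\ assoc mul a a b = 0, assoc mul a b a = 0 & assoc mul b a a = 0])],
      (forall (k : R) a b, cj (k *: a + b) = k *: cj a + cj b) &
      [/\ (forall k : R, cj (k *: one) = k *: one),
          (forall a, cj (cj a) = a) &
          (forall a b, cj (mul a b) = mul (cj b) (cj a))]].

Definition trace_A (R : realType) d (cj : 'rV[R]_d -> 'rV[R]_d) (x : 'rV[R]_d) :=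
  x + cj x.
Definition norm_A (R : realType) d (mul : 'rV[R]_d -> 'rV[R]_d -> 'rV[R]_d)
  (cj : 'rV[R]_d -> 'rV[R]_d) (x : 'rV[R]_d) := mul x (cj x).

Definition is_real_A (R : realType) d (one : 'rV[R]_d) (x : 'rV[R]_d) :=
  exists c : R, x = c *: one.

Definition in_S_A (R : realType) d (mul : 'rV[R]_d -> 'rV[R]_d -> 'rV[R]_d)
  (one : 'rV[R]_d) (cj : 'rV[R]_d -> 'rV[R]_d) (x : 'rV[R]_d) :=
  trace_A cj x = 0 /\ norm_A mul cj x = one.

Definition in_Q_A (R : realType) d (mul : 'rV[R]_d -> 'rV[R]_d -> 'rV[R]_d)
  (one : 'rV[R]_d) (cj : 'rV[R]_d -> 'rV[R]_d) (x : 'rV[R]_d) :=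
  is_real_A one x \/
  exists c c' : R, [/\ trace_A cj x = c *: one, norm_A mul cj x = c' *: one
                      & c ^+ 2 < 4 * c'].

Definition pd (R : realType) (n : nat) (V : normedModType R) (s : 'I_n)
  (g : 'rV[R]_n -> V) : 'rV[R]_n -> V :=
  fun x => 'D_(delta_mx 0 s) g x.

Fixpoint Ck (R : realType) (n : nat) (V : normedModType R) (k : nat)
  (U : set 'rV[R]_n) (g : 'rV[R]_n -> V) : Prop :=
  (forall x, U x -> {for x, continuous g}) /\
  match k with
  | 0 => True
  | k'.+1 => forall s : 'I_n,
      (forall x, U x -> derivable g x (delta_mx 0 s)) /\ Ck k' U (pd s g)
  end.

Definition lap (R : realType) (n : nat) (V : normedModType R)
  (g : 'rV[R]_n -> V) : 'rV[R]_n -> V :=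
  fun x => \sum_(s < n) pd s (pd s g) x.

Definition dirac (R : realType) (n d : nat) (mul : 'rV[R]_d -> 'rV[R]_d -> 'rV[R]_d)
  (v : 'I_n -> 'rV[R]_d) (g : 'rV[R]_n -> 'rV[R]_d) : 'rV[R]_n -> 'rV[R]_d :=
  fun x => \sum_(s < n) mul (v s) (pd s g x).

Definition monogenic (R : realType) (n d : nat)
  (mul : 'rV[R]_d -> 'rV[R]_d -> 'rV[R]_d) (v : 'I_n -> 'rV[R]_d)
  (U : set 'rV[R]_n) (g : 'rV[R]_n -> 'rV[R]_d) : Prop :=
  Ck 1 U g /\ forall x, U x -> dirac mul v g x = 0.

Definition mkpt (R : realType) (p : nat) (xp : 'rV[R]_p.+1) (r : R) : 'rV[R]_(p.+1 + 1) :=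
  row_mx xp (const_mx r).
Definition rcoord (R : realType) (p : nat) (x' : 'rV[R]_(p.+1 + 1)) : R :=
  x' 0 (rshift p.+1 (ord0 : 'I_1)).
Definition ridx (p : nat) : 'I_(p.+1 + 1) := rshift p.+1 (ord0 : 'I_1).
Definition xidx (p : nat) (i : 'I_p.+1) : 'I_(p.+1 + 1) := lshift 1 i.

Fixpoint Aop (R : realType) (p d : nat) (k : nat)
  (F : 'rV[R]_(p.+1 + 1) -> 'rV[R]_d) : 'rV[R]_(p.+1 + 1) -> 'rV[R]_d :=
  match k with
  | 0 => F
  | k'.+1 => fun x => (rcoord x)^-1 *: pd (ridx p) (Aop k' F) x
  end.
Fixpoint Bop (R : realType) (p d : nat) (k : nat)
  (F : 'rV[R]_(p.+1 + 1) -> 'rV[R]_d) : 'rV[R]_(p.+1 + 1) -> 'rV[R]_d :=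
  match k with
  | 0 => F
  | k'.+1 => pd (ridx p) (fun z => (rcoord z)^-1 *: Bop k' F z)
  end.

Fixpoint dfact (n : nat) : nat :=
  match n with
  | 0 => 1
  | 1 => 1
  | n'.+2 => (n'.+2 * dfact n')%N
  end.

(* the unit sphere S of span(v_{p+1},...,v_m), in coordinates *)
Definition unit_row (R : realType) (q : nat) (w : 'rV[R]_q) : Prop :=
  \sum_(j < q) w 0 j ^+ 2 = 1.

Definition vec_q (R : realType) (p q d : nat) (v : 'I_(p.+1 + q) -> 'rV[R]_d)
  (w : 'rV[R]_q) : 'rV[R]_d :=
  \sum_(j < q) w 0 j *: v (rshift p.+1 j).

(* p-symmetric completion Omega_D, as a subset of M = R^{m+1}, m = p + q *)
Definition Omega (R : realType) (p q : nat) (D : set 'rV[R]_(p.+1 + 1)) :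
  set 'rV[R]_(p.+1 + q) :=
  [set y | exists (xp : 'rV[R]_p.+1) (r : R) (w : 'rV[R]_q),
     [/\ D (mkpt xp r), 0 <= r, unit_row w & y = row_mx xp (r *: w)]].

(* Main.v *)
Require Import Defs.
From HB Require Import structures.
From mathcomp Require Import all_boot all_order all_algebra.
From mathcomp Require Import all_classical all_reals.
From mathcomp Require Import topology normedtype derive.
From mathcomp Require Import realfun measure lebesgue_measure lebesgue_integral ftc.
From mathcomp Require Import ring lra.
(** Iterated means along the axes turn a C^1 solution (F1, F2) of the first order system into
C^2 solutions, which are harmonic, and a comparison on half cubes bounds the difference
quotients of a harmonic function by its supremum; so F1 and F2 are smooth.
As F1 is even and F2 odd in r, one has F2 = r G and d_r F1 = r (T F1) with G and T F1 smooth
and even, so that f = F1 o rho + x_q (G o rho) is smooth, where rho x = (x_p, |x_q|).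
If D F = a G + r^2 (T G) and Dbar G = - T F, then the Laplacian of F o rho + x_q (G o rho) is
(q - a) (T F o rho + x_q (T G o rho)), the pair (T F, T G) satisfies the same relations with
a + 2 in place of a, and for a = q the function F o rho + x_q (G o rho) is monogenic.
The pair (F1, G) satisfies them with a = 1, and (q-1)/2 steps lead to a = q. *)

Set Implicit Arguments. Unset Strict Implicit. Unset Printing Implicit Defensive.
Import Order.TTheory GRing.Theory Num.Theory.
Import numFieldNormedType.Exports.
Local Open Scope classical_set_scope.
Local Open Scope ring_scope.

(** The hypotheses provide one derivative, while the iterated Laplacian and the Dirac operator
    together take q of them, so regularity has to come from the equations. A mean along the axis s
    gains a derivative because its s-derivative is a difference quotient, and it solves the system
    again because the coefficients are constant. The means converge only uniformly; hence the notion
    of a function uniformly approximated by harmonic ones on a cube, which passes to difference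
    quotients and from them to derivatives. The algebra is only alternative, so products are kept
    nested, as v_s (v_t b). Left alternativity and its linearization give v_s (v_s b) = - b and v_s
    (v_t b) = - v_t (v_s b), which do the work of associativity. The operator T is (1/r) d_r, and
    with k = (q-1)/2 one has A = T^k F1 and B = r (T^k G), which extends both across r = 0. Step i
    of the iteration picks up the factor q - (1 + 2 i), and the product of these over i < k is (q-1)
    (q-3) ... 2 = (q-1)!!. *)

Lemma norm_rV_le (R : realType) n (x : 'rV[R]_n) (e : R) : 0 <= e -> (forall i, `|x 0 i| <= e) -> `|x| <= e.
Proof.
move=> e0 h; rewrite [`|x|]mx_normrE; apply: bigmax_le => // -[i j] _ /=.
by rewrite (ord1 i).
Qed.

Lemma coord_le_norm (R : realType) n (x : 'rV[R]_n) i : `|x 0 i| <= `|x|.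
Proof. by rewrite [`|x|]mx_normrE; apply: (le_bigmax _ _ (0, i)). Qed.

(** * Calculus of partial derivatives *)

Section AxisDerivatives.
Context {R : realType} {n : nat}.
Implicit Types (V : normedModType R) (U : set 'rV[R]_n) (x y : 'rV[R]_n).

Definition axis (s : 'I_n) : 'rV[R]_n := delta_mx 0 s.

Lemma axisE s i : axis s 0 i = (i == s)%:R.
Proof. by rewrite mxE eqxx. Qed.

Lemma norm_axis_le s : `|axis s| <= 1.
Proof.
apply: norm_rV_le => // i; rewrite axisE; case: eqP => _; rewrite ?normr1 ?normr0//.
Qed.

Lemma continuous_atP V (g : 'rV[R]_n -> V) x : {for x, continuous g} <->
  forall e, 0 < e -> \forall y \near nbhs x, `|g x - g y| <= e.
Proof.
rewrite /prop_for /continuous_at /=; split.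
  by move=> c; apply/(@cvgrPdist_le _ _ _ (nbhs x)).
by move=> c; apply/(@cvgrPdist_le _ _ _ (nbhs x)).
Qed.

Lemma continuous_at_local V (x : 'rV[R]_n) (g h : 'rV[R]_n -> V) :
  {near x, g =1 h} -> {for x, continuous g} -> {for x, continuous h}.
Proof.
move=> gh cg.
have e : h x = g x by apply/esym; exact: (nbhs_singleton gh).
apply/continuous_atP => e' e'0; rewrite e.
move/continuous_atP: cg => /(_ _ e'0) cg.
by apply: (@filterS2 _ (nbhs x) _ _ _ _ _ gh cg) => y <-.
Qed.

Lemma near_pd V s (g h : 'rV[R]_n -> V) x :
  {near x, g =1 h} -> {near x, pd s g =1 pd s h}.
Proof.
by move/near_join; apply: (@filterS _ (nbhs x) _) => y gh; exact: near_eq_derive.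
Qed.

(* Ck is a fixpoint, which failing unifications unfold at great cost; the record blocks this. *)
Record Cn V N U (g : 'rV[R]_n -> V) : Prop := Cn_intro { Cn_Ck : Ck N U g }.

Lemma Cn0 V U (g : 'rV[R]_n -> V) : (forall x, U x -> {for x, continuous g}) -> Cn 0 U g.
Proof. by move=> cg; split. Qed.

Lemma CnS V N U (g : 'rV[R]_n -> V) : (forall x, U x -> {for x, continuous g}) ->
  (forall s x, U x -> derivable g x (axis s)) -> (forall s, Cn N U (pd s g)) -> Cn N.+1 U g.
Proof. by move=> cg dg H; split; split => // s; split; [exact: dg|have [] := H s]. Qed.

Lemma Cn_continuous V N U (g : 'rV[R]_n -> V) x :
  Cn N U g -> U x -> {for x, continuous g}.
Proof. by case: N => [|N] [[cg _]]; exact: cg. Qed.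

Lemma Cn_derivable V N U (g : 'rV[R]_n -> V) x s :
  Cn N.+1 U g -> U x -> derivable g x (axis s).
Proof. by move=> [[_ /(_ s)[d _]]] Ux; exact: d. Qed.

Lemma Cn_is_derive V N U (g : 'rV[R]_n -> V) x s :
  Cn N.+1 U g -> U x -> is_derive x (axis s) g (pd s g x).
Proof. by move=> cg Ux; apply: DeriveDef => //; exact: (Cn_derivable cg). Qed.

Lemma Cn_pd V N U (g : 'rV[R]_n -> V) s : Cn N.+1 U g -> Cn N U (pd s g).
Proof. by move=> [[_ /(_ s)[_ d]]]. Qed.

Lemma Cn_local V N U (g h : 'rV[R]_n -> V) :
  (forall x, U x -> {near x, g =1 h}) -> Cn N U g -> Cn N U h.
Proof.
elim: N g h => [|N IH] g h gh cg.
  by apply: Cn0 => x Ux; apply: continuous_at_local (Cn_continuous cg Ux); apply: gh.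
apply: CnS.
- by move=> x Ux; apply: continuous_at_local (Cn_continuous cg Ux); apply: gh.
- by move=> s x Ux; apply: near_eq_derivable (Cn_derivable cg Ux); apply: gh.
- by move=> s; apply: IH (Cn_pd s cg) => x Ux; apply: near_pd; apply: gh.
Qed.

Lemma open_near_eq V U (g h : 'rV[R]_n -> V) x :
  open U -> U x -> (forall y, U y -> g y = h y) -> {near x, g =1 h}.
Proof.
by move=> oU Ux gh; apply: (@filterS _ (nbhs x) _ _ _ gh); exact: open_nbhs_nbhs.
Qed.

Lemma Cn_ext V N U (g h : 'rV[R]_n -> V) : open U ->
  (forall x, U x -> g x = h x) -> Cn N U g -> Cn N U h.
Proof. by move=> oU gh; apply: Cn_local => x Ux; exact: open_near_eq gh. Qed.

Lemma pd_ext V U (g h : 'rV[R]_n -> V) s : open U ->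
  (forall x, U x -> g x = h x) -> forall x, U x -> pd s g x = pd s h x.
Proof. by move=> oU gh x Ux; apply: near_eq_derive; exact: open_near_eq gh. Qed.

Lemma Cn_sub V N U U' (g : 'rV[R]_n -> V) : U' `<=` U -> Cn N U g -> Cn N U' g.
Proof.
move=> sU; elim: N g => [|N IH] g cg.
  by apply: Cn0 => x /sU; apply: Cn_continuous cg.
apply: CnS.
- by move=> x /sU; apply: Cn_continuous cg.
- by move=> s x /sU; apply: Cn_derivable cg.
- by move=> s; apply: IH; exact: Cn_pd.
Qed.

(** Each clause of [Ck] concerns one point at a time, and [pd s g] is a total function that does not
    depend on the set, so regularity on singletons already is the whole statement. *)
Lemma Cn_pointwise V N U (g : 'rV[R]_n -> V) :
  (forall x, U x -> Cn N [set x] g) -> Cn N U g.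
Proof.
elim: N g => [|N IH] g H.
  by apply: Cn0 => x Ux; apply: (Cn_continuous (H x Ux)).
apply: CnS.
- by move=> x Ux; apply: (Cn_continuous (H x Ux)).
- by move=> s x Ux; apply: (Cn_derivable (H x Ux)).
- by move=> s; apply: IH => x Ux; apply: Cn_pd; exact: H.
Qed.

Lemma Cn_cover V N U (g : 'rV[R]_n -> V) :
  (forall x, U x -> exists2 W, W x & Cn N W g) -> Cn N U g.
Proof.
move=> H; apply: Cn_pointwise => x Ux; have [W Wx] := H x Ux.
by apply: Cn_sub => y ->.
Qed.

Lemma CnW V N U (g : 'rV[R]_n -> V) : Cn N.+1 U g -> Cn N U g.
Proof.
elim: N g => [|N IH] g cg; first by apply: Cn0 => x; exact: (Cn_continuous cg).
apply: CnS; [by move=> x; exact: (Cn_continuous cg)|by move=> s x; exact: (Cn_derivable cg)|].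
by move=> s; apply: IH; exact: Cn_pd.
Qed.

Lemma Cn_le V N M U (g : 'rV[R]_n -> V) : (N <= M)%N -> Cn M U g -> Cn N U g.
Proof.
move=> /subnK <-; elim: (M - N)%N => // k IH; rewrite addSn => /CnW; exact: IH.
Qed.

(** The candidates [dg] need to be the derivatives on [U] only: as [U] is open, they may replace
    [pd s g] there. *)
Lemma Cn_succ V N U (g : 'rV[R]_n -> V) (dg : 'I_n -> 'rV[R]_n -> V) : open U ->
  (forall x, U x -> {for x, continuous g}) ->
  (forall s x, U x -> is_derive x (axis s) g (dg s x)) ->
  (forall s, Cn N U (dg s)) -> Cn N.+1 U g.
Proof.
move=> oU cg dgE dgC; apply: CnS => //.
  by move=> s x Ux; have [] := dgE s x Ux.
move=> s; apply: Cn_ext (dgC s) => // x Ux; have [_] := dgE s x Ux.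
by rewrite /pd => ->.
Qed.

Lemma is_derive_pd V s (g : 'rV[R]_n -> V) x l :
  is_derive x (axis s) g l -> pd s g x = l.
Proof. by case. Qed.

Lemma Cn_cst V N U (c : V) : Cn N U (fun _ : 'rV[R]_n => c).
Proof.
elim: N c => [|N IH] c; first by apply: Cn0 => x _; exact: cst_continuous.
apply: CnS; [by move=> x _; exact: cst_continuous|by move=> s x _; exact: derivable_cst|].
move=> s; have -> : pd s (fun _ : 'rV[R]_n => c) = fun=> 0 by apply: funext => x;
  exact: derive_cst.
exact: IH.
Qed.

Lemma CnD V N U (g h : 'rV[R]_n -> V) : open U ->
  Cn N U g -> Cn N U h -> Cn N U (fun x => g x + h x).
Proof.
move=> oU; elim: N g h => [|N IH] g h cg ch.
  apply: Cn0 => x Ux.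
  exact: continuousD (Cn_continuous cg Ux) (Cn_continuous ch Ux).
apply: (@Cn_succ _ _ _ _ (fun s x => pd s g x + pd s h x)) => //.
- by move=> x Ux; exact: continuousD (Cn_continuous cg Ux) (Cn_continuous ch Ux).
- move=> s x Ux; have dg := Cn_is_derive s cg Ux; have dh := Cn_is_derive s ch Ux.
  exact: is_deriveD.
- by move=> s; apply: IH; exact: Cn_pd.
Qed.

Lemma Cn_sum V N U (I : Type) (r : seq I) (P : pred I) (g : I -> 'rV[R]_n -> V) :
  open U -> (forall i, P i -> Cn N U (g i)) ->
  Cn N U (fun x => \sum_(i <- r | P i) g i x).
Proof.
move=> oU H; elim: r => [|i r IH].
  by apply: Cn_ext (Cn_cst N U (0 : V)) => // x _; rewrite big_nil.
have [Pi|Pi] := boolP (P i).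
  apply: Cn_ext (CnD oU (H i Pi) IH) => // x _; by rewrite big_cons Pi.
by apply: Cn_ext IH => // x _; rewrite big_cons (negbTE Pi).
Qed.

Lemma is_derive_scale (V1 V : normedModType R) (a : V1 -> R) (g : V1 -> V) (x v : V1) (da : R) (dg : V) :
  is_derive x v (a : V1 -> R) da -> is_derive x v g dg ->
  is_derive x v (fun z => a z *: g z) (a x *: dg + da *: g x).
Proof.
move=> [ad aE] [gd gE].
(* Derivability in the single direction v gives continuity of [a] along that line, which is all the
   product rule asks for. *)
have ac : (fun h : R => a (h *: v + x)) @ (0 : R)^' --> a x.
  have : {for 0, continuous (fun h : R => (a : V1 -> R) (h *: v + x))}.
    by apply: differentiable_continuous; apply/derivable1_diffP; have /derivable1P := ad.
  by move/continuous_withinNx; rewrite scale0r add0r.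
have ga : h^-1 *: (g (h *: v + x) - g x) @[h --> (0 : R)^'] --> dg.
  by rewrite -gE; exact: gd.
have aa : (h^-1 *: ((a : V1 -> R) (h *: v + x) - a x) : R) @[h --> (0 : R)^'] --> da.
  by rewrite -aE; exact: ad.
have lim : (h^-1 *: (a (h *: v + x) *: g (h *: v + x) - a x *: g x))
    @[h --> (0 : R)^'] --> a x *: dg + da *: g x.
  rewrite (_ : (fun h : R => _) = fun h : R => a (h *: v + x) *: (h^-1 *: (g (h *: v + x) - g x))
     + (h^-1 *: ((a : V1 -> R) (h *: v + x) - a x) : R) *: g x).
    apply: cvgD; first exact: cvgZ.
    by apply: cvgZr_tmp.
  apply: funext => h; set ah := a (h *: v + x).
  rewrite -[(h^-1 *: (ah - a x : R) : R)]/(h^-1 * (ah - a x)).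
  rewrite !scalerBr !scalerA mulrBr scalerBl (mulrC ah) addrA subrK.
  by [].
apply: DeriveDef; first by apply/cvg_ex; exists (a x *: dg + da *: g x).
exact: cvg_lim lim.
Qed.

Lemma Cn_scale V N U (a : 'rV[R]_n -> R) (g : 'rV[R]_n -> V) : open U ->
  Cn N U (a : _ -> R) -> Cn N U g -> Cn N U (fun x => a x *: g x).
Proof.
move=> oU; elim: N a g => [|N IH] a g ca cg.
  apply: Cn0 => x Ux.
  by apply: (@continuousZ R V _ a g x); [exact: (Cn_continuous ca Ux)|exact: (Cn_continuous cg Ux)].
apply: (@Cn_succ _ _ _ _ (fun s x => a x *: pd s g x + pd s (a : _ -> R) x *: g x)) => //.
- move=> x Ux.
  by apply: (@continuousZ R V _ a g x); [exact: (Cn_continuous ca Ux)|exact: (Cn_continuous cg Ux)].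
- move=> s x Ux; apply: is_derive_scale; [exact: (Cn_is_derive s ca Ux)|exact: (Cn_is_derive s cg Ux)].
- move=> s; apply: CnD => //; apply: IH => //; try exact: Cn_pd; exact: CnW.
Qed.

Lemma CnZ V N U (c : R) (g : 'rV[R]_n -> V) : open U ->
  Cn N U g -> Cn N U (fun x => c *: g x).
Proof. by move=> oU; apply: Cn_scale => //; exact: Cn_cst. Qed.

Lemma CnB V N U (g h : 'rV[R]_n -> V) : open U ->
  Cn N U g -> Cn N U h -> Cn N U (fun x => g x - h x).
Proof.
move=> oU cg ch; apply: Cn_ext (CnD oU cg (CnZ (-1) oU ch)) => // x _.
by rewrite scaleN1r.
Qed.

Lemma is_derive_coord s j x : is_derive x (axis s) (fun y => y 0 j : R) ((j == s)%:R).
Proof.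
have e : is_derive x (axis s) (id : 'rV[R]_n -> 'rV[R]_n) (axis s) by exact: is_derive_id.
have [d dE] := e.
apply: DeriveDef; first by have /derivable_mxP := d; apply.
by move: dE; rewrite derive_mx// => /matrixP /(_ 0 j); rewrite !mxE eqxx /= => <-.
Qed.

Lemma Cn_coord N U j : open U -> Cn N U (fun y : 'rV[R]_n => y 0 j : R).
Proof.
move=> oU.
have cc x : {for x, continuous (fun y : 'rV[R]_n => y 0 j : R)} by exact: coord_continuous.
case: N => [|N]; first by apply: Cn0 => x _.
apply: (@Cn_succ R N U (fun y => y 0 j) (fun s _ => (j == s)%:R)) => //.
- by move=> s x _; exact: is_derive_coord.
- by move=> s; exact: Cn_cst.
Qed.

Lemma continuous_rV d (g : 'rV[R]_n -> 'rV[R]_d) x :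
  (forall j, {for x, continuous (fun y => g y 0 j : R)}) -> {for x, continuous g}.
Proof.
move=> H; apply/continuous_atP => e e0.
have : \forall y \near nbhs x, forall j, `|g x 0 j - g y 0 j| <= e.
  by apply: filter_forall => j; have /continuous_atP := H j; exact.
apply: (@filterS _ (nbhs x) _) => y Hy; apply: norm_rV_le; first exact: ltW.
by move=> j; rewrite !mxE.
Qed.

Lemma Cn_mxP d N U (g : 'rV[R]_n -> 'rV[R]_d) : open U ->
  Cn N U g <-> forall j, Cn N U (fun y => g y 0 j : R).
Proof.
move=> oU; split.
  move=> + j; elim: N g => [|N IH] g cg.
    apply: Cn0 => x Ux; have := Cn_continuous cg Ux.
    by move=> c; apply: (@continuous_comp _ _ _ g (fun M : 'rV[R]_d => M 0 j : R)) => //; exact: coord_continuous.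
  apply: (@Cn_succ R N U (fun y => g y 0 j) (fun s x => pd s g x 0 j)) => //.
  - move=> x Ux; have := Cn_continuous cg Ux.
    by move=> c; apply: (@continuous_comp _ _ _ g (fun M : 'rV[R]_d => M 0 j : R)) => //; exact: coord_continuous.
  - move=> s x Ux; have [d1 dE] := Cn_is_derive s cg Ux.
    apply: DeriveDef; first by have /derivable_mxP := d1; apply.
    by rewrite -dE derive_mx// mxE.
  - by move=> s; apply: IH; exact: Cn_pd.
elim: N g => [|N IH] g cg.
  by apply: Cn0 => x Ux; apply: continuous_rV => j; exact: (Cn_continuous (cg j) Ux).
apply: (@Cn_succ _ N U g (fun s x => \row_j pd s (fun y => g y 0 j : R) x)) => //.
- by move=> x Ux; apply: continuous_rV => j; exact: (Cn_continuous (cg j) Ux).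
- move=> s x Ux.
  have d1 : derivable g x (axis s).
    apply/derivable_mxP => i j; rewrite (ord1 i).
    exact: (@Cn_derivable R N U (fun y => g y 0 j) x s (cg j) Ux).
  apply: DeriveDef => //; rewrite derive_mx//; apply/matrixP => i j.
  by rewrite !mxE (ord1 i).
- move=> s; apply: IH => j; apply: Cn_ext (Cn_pd s (cg j)) => // x Ux.
  by rewrite mxE.
Qed.

Lemma pd_mx d N U (g : 'rV[R]_n -> 'rV[R]_d) s j x : Cn N.+1 U g -> U x ->
  pd s (fun y => g y 0 j : R) x = pd s g x 0 j.
Proof.
move=> cg Ux; have [d1 dE] := Cn_is_derive s cg Ux.
by rewrite -dE derive_mx// mxE.
Qed.

End AxisDerivatives.


(** * Derivatives along lines: mean value theorem, symmetry of second derivatives, maxima *)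

Section LineCalculus.
Context {R : realType} {n : nat}.
Implicit Types (V : normedModType R) (U : set 'rV[R]_n) (x : 'rV[R]_n).

(** The inequality is not strict and holds at h = 0 too, so no punctured neighbourhood is left; the
    chain rules below are proved in this form. *)
Lemma is_deriveP (V1 V : normedModType R) (g : V1 -> V) (x v : V1) (l : V) :
  is_derive x v g l <-> forall e : R, 0 < e -> exists2 d : R, 0 < d &
    forall h, `|h| < d -> `|g (h *: v + x) - g x - h *: l| <= e * `|h|.
Proof.
have key : (h^-1 *: (g (h *: v + x) - g x)) @[h --> (0 : R)^'] --> l <->
    forall e : R, 0 < e -> exists2 d : R, 0 < d &
    forall h, `|h| < d -> `|g (h *: v + x) - g x - h *: l| <= e * `|h|.
  have step (h e : R) : h != 0 -> (`|l - h^-1 *: (g (h *: v + x) - g x)| <= e) =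
      (`|g (h *: v + x) - g x - h *: l| <= e * `|h|).
    move=> h0; rewrite -ler_pdivrMr ?normr_gt0//; congr (_ <= _).
    rewrite distrC -[l in LHS](scalerK h0) -scalerBr normrZ normfV mulrC.
    by [].
  split.
    move/cvgrPdist_le => H e e0; have := H e e0.
    rewrite /prop_near1 /= => -[d /= d0 Hd]; exists d => // h hd.
    have [->|h0] := eqVneq h 0; first by rewrite !scale0r add0r subrr subr0 !normr0 mulr0.
    by rewrite -step//; apply: Hd => //; rewrite /ball_ /= sub0r normrN.
  move=> H; apply/cvgrPdist_le => e e0; have [d d0 Hd] := H e e0.
  exists d => // h /=; rewrite sub0r normrN => hd h0.
  by rewrite step//; apply: Hd.
split; first by move=> [gd gE]; apply/key; rewrite -gE; exact: gd.
move=> /key H; apply: DeriveDef; first by apply/cvg_ex; exists l.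
exact: cvg_lim H.
Qed.

Lemma is_derive_line (V1 V : normedModType R) (g : V1 -> V) (x v : V1) (k t : R) (l : V) :
  is_derive ((t * k) *: v + x) v g l ->
  is_derive t (1 : R) (fun t => g ((t * k) *: v + x)) (k *: l).
Proof.
move=> /is_deriveP H; apply/is_deriveP => e e0.
(* The slope k may vanish, hence |k| + 1 instead of |k| as divisor. *)
have k1 : 0 < `|k| + 1 by rewrite ltr_wpDl.
have [d d0 Hd] := H (e / (`|k| + 1)) (divr_gt0 e0 k1).
exists (d / (`|k| + 1)); first exact: divr_gt0.
move=> h; rewrite ltr_pdivlMr// => hd.
have /Hd : `|h * k| < d.
  apply: le_lt_trans hd; rewrite normrM ler_wpM2l// lerDl//.
rewrite scalerA addrA -scalerDl -mulrDl -[h *: (1 : R)]/(h * 1) mulr1.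
move=> /le_trans; apply.
rewrite -mulrA ler_wpM2l//; first exact: ltW.
by rewrite ler_pdivrMl// normrM mulrC ler_wpM2r// lerDl.
Qed.

(** Diagonal affine maps send lines parallel to an axis to lines parallel to it, so their chain rule
    needs one partial derivative and no total differentiability. Translations, reflections and
    scalings of one coordinate are of this kind. *)
Definition affm (a c : 'rV[R]_n) x : 'rV[R]_n := \row_i (a 0 i * x 0 i + c 0 i).

Lemma affm_axis a c (h : R) s x :
  affm a c (h *: axis s + x) = (h * a 0 s) *: axis s + affm a c x.
Proof.
apply/rowP => i; rewrite !mxE eqxx /=.
by case: eqP => [->|_]; rewrite ?mulr0 ?mulr1 ?add0r// mulrDr addrA (mulrC h).
Qed.

Lemma is_derive_affm V (g : 'rV[R]_n -> V) a c s x l :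
  is_derive (affm a c x) (axis s) g l ->
  is_derive x (axis s) (g \o affm a c) (a 0 s *: l).
Proof.
move=> /is_deriveP H; apply/is_deriveP => e e0.
set k := a 0 s.
have k1 : 0 < `|k| + 1 by rewrite ltr_wpDl.
have [d d0 Hd] := H (e / (`|k| + 1)) (divr_gt0 e0 k1).
exists (d / (`|k| + 1)); first exact: divr_gt0.
move=> h; rewrite ltr_pdivlMr// => hd.
have /Hd : `|h * k| < d.
  apply: le_lt_trans hd; rewrite normrM ler_wpM2l// lerDl//.
rewrite scalerA /= affm_axis => /le_trans; apply.
rewrite -mulrA ler_wpM2l//; first exact: ltW.
by rewrite ler_pdivrMl// normrM mulrC ler_wpM2r// lerDl.
Qed.

Lemma continuous_affm a c x : {for x, continuous (affm a c)}.
Proof.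
apply: continuous_rV => j; apply/continuous_atP => e e0.
have k1 : 0 < `|a 0 j| + 1 by rewrite ltr_wpDl.
have /continuous_atP H : {for x, continuous (fun y : 'rV[R]_n => y 0 j : R)}
  by exact: coord_continuous.
apply: (@filterS _ (nbhs x) _ _ _ _ (H (e / (`|a 0 j| + 1)) (divr_gt0 e0 k1))) => y.
rewrite ler_pdivlMr// /affm !mxE opprD addrACA subrr addr0 -mulrBr normrM.
by apply: le_trans; rewrite mulrC ler_wpM2l// lerDl.
Qed.

Lemma Cn_affm V N U U' (g : 'rV[R]_n -> V) a c : open U' ->
  (forall x, U' x -> U (affm a c x)) -> Cn N U g -> Cn N U' (g \o affm a c).
Proof.
move=> oU' UU'.
have cont (f : 'rV[R]_n -> V) M : Cn M U f -> forall x, U' x -> {for x, continuous (f \o affm a c)}.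
  move=> cf x U'x; apply: continuous_comp; first exact: continuous_affm.
  by apply: (Cn_continuous cf); exact: UU'.
elim: N g => [|N IH] g cg; first by apply: Cn0; exact: cont cg.
apply: (@Cn_succ _ _ V N U' _ (fun s x => a 0 s *: pd s g (affm a c x))) => //.
- exact: cont cg.
- by move=> s x U'x; apply: is_derive_affm; apply: (Cn_is_derive s cg); exact: UU'.
- by move=> s; apply: CnZ => //; apply: IH; exact: Cn_pd.
Qed.

Lemma pd_affm V U (g : 'rV[R]_n -> V) a c s x : Cn 1 U g -> U (affm a c x) ->
  pd s (g \o affm a c) x = a 0 s *: pd s g (affm a c x).
Proof.
by move=> cg Ux; apply: is_derive_pd; apply: is_derive_affm; exact: (Cn_is_derive s cg).
Qed.

Lemma MVT_axis (g : 'rV[R]_n -> R) (dg : 'rV[R]_n -> R) s x (h : R) :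
  (forall t : R, 0 <= t <= 1 -> is_derive ((t * h) *: axis s + x) (axis s) g (dg ((t * h) *: axis s + x))) ->
  exists2 t : R, 0 < t < 1 & g (h *: axis s + x) - g x = h * dg ((t * h) *: axis s + x) :> R.
Proof.
move=> H.
pose f t := g ((t * h) *: axis s + x).
have df (t : R) : 0 <= t <= 1 -> is_derive t (1 : R) f (h * dg ((t * h) *: axis s + x)).
  by move=> t01; apply: (is_derive_line (H t t01)).
have df' (t : R) : t \in `]0, 1[%R -> is_derive t (1 : R) f (h * dg ((t * h) *: axis s + x)).
  by rewrite in_itv /= => /andP[a b]; apply: df; rewrite (ltW a) (ltW b).
have cf : {within `[0, 1], continuous f}.
  apply: derivable_within_continuous => t; rewrite in_itv /= => t01.
  by have [] := df t t01.
have [t] := MVT ltr01 df' cf; rewrite in_itv /= subr0 mulr1 /f mul1r mul0r scale0r add0r.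
by move=> t01 E; exists t.
Qed.

Lemma near_rVP x (P : 'rV[R]_n -> Prop) : (\forall y \near nbhs x, P y) <->
  exists2 d : R, 0 < d & forall y, `|y - x| < d -> P y.
Proof.
split.
  move/nbhs_ballP => -[d /= d0 H]; exists d => // y yd; apply: H.
  by rewrite mx_norm_ball /ball_ /= distrC.
move=> [d d0 H]; apply/nbhs_ballP; exists d => //= y.
by rewrite mx_norm_ball /ball_ /= distrC => yd; apply: H.
Qed.

Lemma open_rVP U x : open U -> U x -> exists2 d : R, 0 < d & forall y, `|y - x| < d -> U y.
Proof. by move=> oU Ux; apply/near_rVP; exact: open_nbhs_nbhs. Qed.

Lemma norm_scale_axis (h : R) s : `|h *: axis s : 'rV[R]_n| <= `|h|.
Proof. by rewrite normrZ ler_piMr// norm_axis_le. Qed.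

(** The mean value theorem along axis i, applied to the increment y |-> g (y + h e_j) - g y,
    followed by the one along axis j. Up to reordering, the left side is symmetric in i and j. *)
Lemma second_difference U (g : 'rV[R]_n -> R) i j x (d h : R) : 0 < d ->
  (forall y, `|y - x| < d -> U y) -> Cn 2 U g -> `|h| + `|h| < d ->
  exists2 y, `|y - x| <= `|h| + `|h| &
    g (h *: axis i + (h *: axis j + x)) - g (h *: axis j + x) - (g (h *: axis i + x) - g x) =
    h * (h * (pd j (pd i g) y : R)) :> R.
Proof.
move=> d0 Ud cg hd.
have small (t : R) : 0 <= t <= 1 -> `|t * h| <= `|h|.
  by move=> /andP[t0 t1]; rewrite normrM (ger0_norm t0) ler_piMl.
have sm (a b : R) : `|a| <= `|h| -> `|b| <= `|h| ->
    `|(a *: axis i + (b *: axis j + x)) - x| <= `|h| + `|h|.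
  move=> ah bh; rewrite addrA addrK; apply: le_trans (ler_normD _ _) _.
  by rewrite lerD//; apply: le_trans (norm_scale_axis _ _) _.
pose G y := g (h *: axis j + y) - g y : R.
have h0 : `|0 : R| <= `|h| by rewrite normr0.
have UU (a b : R) : `|a| <= `|h| -> `|b| <= `|h| -> U (a *: axis i + (b *: axis j + x)).
  by move=> ah bh; apply: Ud; apply: le_lt_trans hd; exact: sm.
have shiftE y : h *: axis j + y = affm (const_mx 1) (h *: axis j) y.
  by apply/rowP => k; rewrite !mxE mul1r addrC.
have [t t01 Et] : exists2 t, 0 < t < 1 & G (h *: axis i + x) - G x =
    h * (pd i g (h *: axis j + ((t * h) *: axis i + x)) - pd i g ((t * h) *: axis i + x)).
  apply: (@MVT_axis G (fun y => pd i g (h *: axis j + y) - pd i g y)) => t t01.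
  have a1 : is_derive ((t * h) *: axis i + x) (axis i) g (pd i g ((t * h) *: axis i + x)).
    apply: (Cn_is_derive i cg); have := UU (t * h) 0 (small _ t01) h0.
    by rewrite scale0r add0r.
  have a2 : is_derive ((t * h) *: axis i + x) (axis i) (g \o affm (const_mx 1) (h *: axis j))
      (pd i g (h *: axis j + ((t * h) *: axis i + x))).
    have := @is_derive_affm R g (const_mx 1) (h *: axis j) i ((t * h) *: axis i + x)
      (pd i g (h *: axis j + ((t * h) *: axis i + x))).
    rewrite mxE scale1r; apply; rewrite -shiftE; apply: (Cn_is_derive i cg).
    by rewrite addrCA; apply: UU (small _ t01) _.
  have -> : G = (g \o affm (const_mx 1) (h *: axis j)) - g.
    by apply: funext => y; rewrite /G shiftE.
  exact: is_deriveB.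
have t01' : 0 <= t <= 1 by case/andP: t01 => /ltW-> /ltW->.
have [r r01 Er] : exists2 r, 0 < r < 1 &
    pd i g (h *: axis j + ((t * h) *: axis i + x)) - pd i g ((t * h) *: axis i + x) =
    h * pd j (pd i g) ((r * h) *: axis j + ((t * h) *: axis i + x)).
  apply: (@MVT_axis (pd i g) (pd j (pd i g))) => r r01.
  apply: (Cn_is_derive j (Cn_pd i cg)).
  by rewrite addrCA; apply: UU; apply: small.
have r01' : 0 <= r <= 1 by case/andP: r01 => /ltW-> /ltW->.
exists ((r * h) *: axis j + ((t * h) *: axis i + x)).
  by rewrite addrCA; apply: sm; apply: small.
move: Et; rewrite /G Er => <-.
rewrite [h *: axis j + (h *: axis i + x)]addrCA.
move: (g _) (g _) (g _) (g _) => ga gb gc gd; rewrite !opprB.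
by rewrite addrACA [RHS]addrACA; congr (_ + _); exact: addrC.
Qed.

(** One and the same second difference equals h^2 times either mixed derivative, each taken at some
    point near x; continuity of both then identifies their values at x. *)
Lemma Schwarz U (g : 'rV[R]_n -> R) i j x : open U -> U x -> Cn 2 U g ->
  pd i (pd j g) x = pd j (pd i g) x.
Proof.
move=> oU Ux cg; apply/eqP; rewrite eq_sym -subr_eq0 -normr_le0; apply/ler_addgt0Pl => e e0.
rewrite addr0.
have [d d0 Ud] := open_rVP oU Ux.
have c1 := Cn_continuous (Cn_pd i (Cn_pd j cg)) Ux.
have c2 := Cn_continuous (Cn_pd j (Cn_pd i cg)) Ux.
have e2 : 0 < e / 2 by rewrite divr_gt0.
have /near_rVP[d1 d10 H1] := (continuous_atP _ _).1 c1 _ e2.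
have /near_rVP[d2 d20 H2] := (continuous_atP _ _).1 c2 _ e2.
pose h := Num.min d (Num.min d1 d2) / 4.
have m0 : 0 < Num.min d (Num.min d1 d2) by rewrite !lt_min d0 d10.
have h0 : 0 < h by rewrite divr_gt0.
have hh : `|h| + `|h| < Num.min d (Num.min d1 d2).
  rewrite gtr0_norm// /h; lra.
have hd : `|h| + `|h| < d by apply: lt_le_trans hh _; rewrite ge_min lexx.
have [y yx Ey] := second_difference i j d0 Ud cg hd.
have [z zx Ez] := second_difference j i d0 Ud cg hd.
have Eyz : pd j (pd i g) y = pd i (pd j g) z.
  have cancel (a b : R) : h * (h * a) = h * (h * b) -> a = b.
    have h0' : h != 0 by rewrite gt_eqF.
    by move/(mulfI h0')/(mulfI h0').
  apply: (cancel _ _ (etrans (esym Ey) (etrans _ Ez))).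
  rewrite [h *: axis i + (h *: axis j + x)]addrCA.
  move: (g _) (g _) (g _) (g _) => ga gb gc gd; rewrite !opprB.
  by rewrite addrACA [RHS]addrACA; congr (_ + _); exact: addrC.
have yd : `|y - x| < d2.
  by apply: le_lt_trans yx (lt_le_trans hh _); rewrite !ge_min lexx !orbT.
have zd : `|z - x| < d1.
  by apply: le_lt_trans zx (lt_le_trans hh _); rewrite !ge_min lexx !orbT.
have tri (a b c : R) : `|a - c| <= e / 2 -> `|b - c| <= e / 2 -> `|b - a| <= e.
  move=> A B; rewrite -(subrKA c) (splitr e); apply: le_trans (ler_normD _ _) _.
  by apply: lerD; [exact: B|rewrite distrC; exact: A].
have := H2 _ yd; have := H1 _ zd; rewrite Eyz; exact: tri.
Qed.

(** The first derivative vanishes at the maximum. Were the second one positive, the first would be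
    positive just beyond x, and by the mean value theorem g would exceed its maximum. *)
Lemma second_derivative_max U (g : 'rV[R]_n -> R) s x (d : R) :
  open U -> U x -> Cn 2 U g -> 0 < d ->
  (forall h, `|h| < d -> g (h *: axis s + x) <= g x) -> pd s (pd s g) x <= 0.
Proof.
move=> oU Ux cg d0 gmax.
have /is_deriveP D1 := Cn_is_derive s cg Ux.
have /is_deriveP D2 := Cn_is_derive s (Cn_pd s cg) Ux.
have l0 : pd s g x = 0.
  apply/eqP; rewrite -normr_le0; apply/ler_addgt0Pl => e e0; rewrite addr0.
  have [d1 d10 H] := D1 e e0.
  pose h := Num.min d d1 / 2.
  have m0 : 0 < Num.min d d1 by rewrite lt_min d0.
  have h0 : 0 < h by rewrite divr_gt0.
  have hm : h < Num.min d d1 by rewrite /h; lra.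
  have [hd hd1] : h < d /\ h < d1 by move: hm; rewrite lt_min => /andP[].
  have gh : `|h| = h by rewrite gtr0_norm.
  have A1 := H h; rewrite gh in A1; move/A1: (hd1) => {}A1.
  have A2 := H (- h); rewrite normrN gh in A2; move/A2: (hd1) => {}A2.
  have B1 := gmax h; rewrite gh in B1; move/B1: (hd) => {}B1.
  have B2 := gmax (- h); rewrite normrN gh in B2; move/B2: (hd) => {}B2.
  move: A1 A2; rewrite !ler_norml => /andP[A1 _] /andP[A2 _].
  rewrite -[h *: (_ : R)]/(h * _) in A1; rewrite -[(- h) *: (_ : R)]/(- h * _) in A2.
  have A1' : h * pd s g x <= h * e by lra.
  have A2' : h * - e <= h * pd s g x by lra.
  by rewrite -(ler_pM2l h0) A2' /= -(ler_pM2l h0).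
rewrite leNgt; apply/negP => l2.
have [d1 d10 H] := D2 _ (divr_gt0 l2 (ltr0n _ 2)).
have [d2 d20 Ud] := open_rVP oU Ux.
pose h := Num.min d (Num.min d1 d2) / 2.
have m0 : 0 < Num.min d (Num.min d1 d2) by rewrite !lt_min d0 d10.
have h0 : 0 < h by rewrite divr_gt0.
have hm : h < Num.min d (Num.min d1 d2) by rewrite /h; lra.
move: hm; rewrite !lt_min => /and3P[hd hd1 hd2].
have gh : `|h| = h by rewrite gtr0_norm.
have [t t01 E] : exists2 t, 0 < t < 1 & g (h *: axis s + x) - g x = h * pd s g ((t * h) *: axis s + x).
  apply: MVT_axis => t /andP[t0 t1]; apply: (Cn_is_derive s cg); apply: Ud.
  rewrite addrK; apply: le_lt_trans (norm_scale_axis _ _) _.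
  by rewrite normrM gh (ger0_norm t0); apply: le_lt_trans hd2; rewrite ler_piMl// ltW.
case/andP: t01 => t0 t1.
have th0 : 0 < t * h by rewrite mulr_gt0.
have := H (t * h); rewrite gtr0_norm// => H'.
have /H' : t * h < d1 by apply: le_lt_trans hd1; rewrite ler_piMl// ltW.
rewrite l0 subr0 -[(t * h) *: (_ : R)]/(t * h * _) ler_norml => /andP[A _].
have B : 0 < t * h * pd s (pd s g) x by rewrite mulr_gt0.
have : 0 < pd s g ((t * h) *: axis s + x) by lra.
rewrite -(pmulr_rgt0 _ h0) -E subr_gt0 ltNge => /negP; apply.
by apply: gmax; rewrite gh.
Qed.

End LineCalculus.

Lemma Schwarz_rV (R : realType) n d U (g : 'rV[R]_n -> 'rV[R]_d) i j x :
  open U -> U x -> Cn 2 U g -> pd i (pd j g) x = pd j (pd i g) x.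
Proof.
move=> oU Ux cg; apply/rowP => k.
have cgk := (Cn_mxP 2 g oU).1 cg k.
have E a b : pd a (pd b g) x 0 k = pd a (pd b (fun y => g y 0 k : R)) x.
  rewrite -(pd_mx a k (Cn_pd b cg) Ux); apply: (pd_ext a oU _ Ux) => y Uy.
  by rewrite (pd_mx b k cg Uy).
exact: etrans (E i j) (etrans (Schwarz i j oU Ux cgk) (esym (E j i))).
Qed.

(** * Difference estimate for harmonic functions *)

Section GradientEstimate.
Context {R : realType} {n : nat}.
Implicit Types (U : set 'rV[R]_n) (x y z : 'rV[R]_n) (w u : 'rV[R]_n -> R).

Definition harmonic_on U w := Cn 2 U w /\ forall x, U x -> lap w x = 0.

Lemma pd_sqr_coord s (b : R) y :
  is_derive y (axis s) (fun y => (y 0 s - b) ^+ 2) (2 * (y 0 s - b)).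
Proof.
have D : is_derive y (axis s) (fun y : 'rV[R]_n => y 0 s - b) (1 - 0).
  apply: is_deriveB; have := is_derive_coord s s y; by rewrite eqxx.
have -> : (fun y : 'rV[R]_n => (y 0 s - b) ^+ 2) = fun y => (y 0 s - b) *: (y 0 s - b).
  by apply: funext => z; rewrite expr2.
have := is_derive_scale D D; rewrite subr0.
rewrite -[_ *: 1]/(_ * 1) -[1 *: _]/(1 * _) mulr1 mul1r -mulr2n.
by rewrite mulr_natl.
Qed.

(** Subtracting the quadratic polynomial in the s-th coordinate leaves a function with a maximum at
    x along the axis. *)
Lemma second_derivative_le U w s x (b c d : R) :
  open U -> U x -> Cn 2 U w -> 0 < d ->
  (forall h, `|h| < d -> w (h *: axis s + x) <= w x + b * h + c * h ^+ 2) ->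
  pd s (pd s w) x <= 2 * c.
Proof.
move=> oU Ux cw d0 H.
pose q y := b * (y 0 s - x 0 s) + c * (y 0 s - x 0 s) ^+ 2.
pose dq y := b + c * (2 * (y 0 s - x 0 s)).
have D1 y : is_derive y (axis s) (fun y : 'rV[R]_n => y 0 s - x 0 s) (1 - 0).
  apply: is_deriveB; have := is_derive_coord s s y; by rewrite eqxx.
have Dq y : is_derive y (axis s) q (dq y).
  have A1 := is_deriveZ b (D1 y); have A2 := is_deriveZ c (pd_sqr_coord s (x 0 s) y).
  by have := is_deriveD A1 A2; rewrite subr0 -[b *: 1]/(b * 1) mulr1.
have Ddq y : is_derive y (axis s) dq (2 * c).
  have A1 := is_deriveZ c (is_deriveZ (2 : R) (D1 y)).
  have := is_deriveD (is_derive_cst b y (axis s)) A1; rewrite add0r subr0.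
  by rewrite -[_ *: (_ *: _)]/(c * (2 * 1)) mulr1 mulrC.
have cu : Cn 2 U (fun y : 'rV[R]_n => y 0 s - x 0 s).
  by apply: CnB => //; [exact: Cn_coord|exact: Cn_cst].
have cq : Cn 2 U q.
  by apply: CnD => //; apply: CnZ => //; rewrite /= ; apply: (Cn_scale oU cu cu).
pose g y := w y - q y.
have cg : Cn 2 U g by exact: CnB.
have gs : pd s (pd s g) x = pd s (pd s w) x - 2 * c.
  have E y : U y -> pd s g y = pd s w y - dq y.
    move=> Uy; apply: is_derive_pd.
    by apply: is_deriveB; exact: (Cn_is_derive s cw).
  rewrite (pd_ext s oU E Ux); apply: is_derive_pd.
  by apply: is_deriveB; exact: (Cn_is_derive s (Cn_pd s cw)).
rewrite -subr_le0 -gs; apply: (second_derivative_max oU Ux cg d0) => h hd.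
rewrite /g /q !mxE !eqxx /= mulr1 subrr addrK expr0n /= !mulr0 addr0 subr0.
by move: (H h hd); move: (w _) (w _) => a a'; clear; lra.
Qed.

(** The reflection in the hyperplane y_s = z_s. It preserves the cubes about z and, its diagonal
    entries having square 1, the Laplacian. *)
Definition flip s z : 'rV[R]_n -> 'rV[R]_n :=
  affm (\row_i (if i == s then -1 else 1)) ((2 * z 0 s) *: axis s).

Lemma flipE s z y i : flip s z y 0 i = if i == s then 2 * z 0 s - y 0 s else y 0 i.
Proof.
rewrite !mxE eqxx /=; case: eqP => [->|_]; last by rewrite mul1r mulr0 addr0.
by rewrite mulN1r mulr1 addrC.
Qed.

Lemma flip_ball s z y (r : R) : `|y - z| < r -> `|flip s z y - z| < r.
Proof.
apply: le_lt_trans; apply: norm_rV_le => // i.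
have -> : (flip s z y - z) 0 i = if i == s then - (y - z) 0 i else (y - z) 0 i.
  by rewrite mxE flipE !mxE; case: eqP => [->|//]; ring.
by case: eqP => _; rewrite ?normrN coord_le_norm.
Qed.

Lemma open_cube z (r : R) : open [set y | `|y - z| < r].
Proof.
rewrite openE => y /= yr; apply/near_rVP; exists (r - `|y - z|); first by rewrite subr_gt0.
move=> y' /=; rewrite ltrBrDr; apply: le_lt_trans.
by rewrite -[y' - z](subrKA y) ler_normD.
Qed.

Lemma lap_affm U U' (a c : 'rV[R]_n) w y : open U' ->
  (forall i, a 0 i * a 0 i = 1) -> (forall x, U' x -> U (affm a c x)) -> U' y ->
  Cn 2 U w -> lap (w \o affm a c) y = lap w (affm a c y).
Proof.
move=> oU' a1 sU Uy cw; apply: eq_bigr => i _.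
have E x : U' x -> pd i (w \o affm a c) x = a 0 i *: (pd i w \o affm a c) x.
  by move=> Ux; rewrite (@pd_affm _ _ _ U)//; [exact: CnW|exact: sU].
have c1 : Cn 1 U' (pd i w \o affm a c) by apply: (Cn_affm oU' sU); exact: Cn_pd.
rewrite (pd_ext i oU' E Uy); apply: is_derive_pd.
rewrite [X in is_derive _ _ _ X](_ : _ = a 0 i *: (a 0 i *: pd i (pd i w) (affm a c y))).
  apply: is_deriveZ; rewrite -(@pd_affm _ _ _ U)//; first exact: (Cn_is_derive i c1).
  - exact: Cn_pd.
  - exact: sU.
by rewrite scalerA a1 scale1r.
Qed.

(* Comparison of the odd part of w in the s-th variable with the barrier
   2K/d^2 (|y-z|_2^2 + (n+1) (y_s-z_s) (d-(y_s-z_s))) on the upper half of a cube: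
   the barrier is strictly superharmonic and dominates the odd part on the boundary. *)
Lemma harmonic_odd_part_le w s z (d r K t : R) :
  0 < d -> d < r -> 0 < K -> harmonic_on [set y | `|y - z| < r] w ->
  (forall y, `|y - z| < r -> `|w y| <= K) -> 0 <= t <= d ->
  w (t *: axis s + z) - w (- t *: axis s + z) <= 2 * n.+1%:R * K * t / d.
Proof.
move=> d0 dr K0 [cw lw] wK /andP[t0 td].
set U := [set y | `|y - z| < r] in cw lw *.
have oU : open U by exact: open_cube.
have sU x : U x -> U (flip s z x) by exact: flip_ball.
pose phi y := w y - w (flip s z y).
have cphi : Cn 2 U phi by apply: CnB => //; apply: (Cn_affm oU sU).
pose S y := \sum_i (y 0 i - z 0 i) ^+ 2.
pose C := 2 * K / d ^+ 2.
have C0 : 0 < C by rewrite divr_gt0 ?mulr_gt0 ?exprn_gt0.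
pose psi y := C * (S y + n.+1%:R * ((y 0 s - z 0 s) * (d - (y 0 s - z 0 s)))).
(* [A] is the closed half cube y_s >= z_s of radius d about z; on its face y_s = z_s the odd part
   vanishes. *)
pose lo i := if i == s then z 0 i else z 0 i - d.
pose A := [set y : 'rV[R]_n | forall i, `[lo i, z 0 i + d]%classic (y 0 i)].
have AE y : A y -> forall i, `|y 0 i - z 0 i| <= d.
  move=> Ay i; have := Ay i; rewrite /= in_itv /= /lo ler_distl => /andP[].
  by case: eqP => _ l h; apply/andP; split => //; lra.
have As y : A y -> 0 <= y 0 s - z 0 s <= d.
  by move=> Ay; have := Ay s; rewrite /= in_itv /= /lo eqxx => /andP[]; lra.
have AU y : A y -> U y.
  move=> /AE Ay; apply: le_lt_trans dr; apply: norm_rV_le; first exact: ltW.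
  by move=> i; rewrite !mxE.
have cA : compact A.
  by apply: (@rV_compact _ n (fun i => `[lo i, z 0 i + d]%classic)) => i; exact: segment_compact.
have cont_psi : Cn 0 U psi.
  have c1 i : Cn 0 U (fun y : 'rV[R]_n => y 0 i - z 0 i).
    by apply: CnB => //; [exact: Cn_coord|exact: Cn_cst].
  apply: CnZ => //; apply: CnD => //.
    by apply: Cn_sum => // i _; exact: (Cn_scale oU (c1 i) (c1 i)).
  apply: CnZ => //; apply: (Cn_scale oU (c1 s)).
  by apply: CnB => //; exact: Cn_cst.
have At : A (t *: axis s + z).
  move=> i; rewrite /= in_itv /= /lo !mxE eqxx /=; case: eqP => [->|_].
    by rewrite mulr1 lerDr t0 addrC lerD2l.
  by rewrite mulr0 add0r; apply/andP; split; lra.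
have [m mA mmax] : exists2 m, m \in A & forall y, y \in A -> phi y - psi y <= phi m - psi m.
  apply: (@EVT_max_rV R n (fun y => phi y - psi y)) => //; first by exists (t *: axis s + z).
  apply: continuous_in_subspaceT => y; rewrite inE => /AU Uy.
  exact: continuousB (Cn_continuous cphi Uy) (Cn_continuous cont_psi Uy).
rewrite inE in mA.
have S0 y : 0 <= S y by apply: sumr_ge0 => i _; exact: sqr_ge0.
have psi_lb y : A y -> C * S y <= psi y.
  move=> /As /andP[y0 yd]; rewrite ler_pM2l// lerDl; apply: mulr_ge0 => //.
  by apply: mulr_ge0 => //; rewrite subr_ge0.
have phi_ub y : U y -> phi y <= 2 * K.
  move=> Uy; have := wK _ Uy; have := wK _ (sU _ Uy).
  rewrite !ler_norml /phi => /andP[a1 a2] /andP[b1 b2]; lra.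
(* On an outer face the barrier is at least C d^2 = 2 K, which bounds the odd part; on the face y_s
   = z_s the odd part is 0; an interior maximum is excluded by comparing Laplacians. *)
have m_le0 : phi m - psi m <= 0.
  rewrite subr_le0; have [/forallP interior|] := boolP [forall i, `|m 0 i - z 0 i| < d]; last first.
    rewrite negb_forall => /existsP[i]; rewrite -leNgt => mi.
    apply: le_trans (phi_ub _ (AU _ mA)) (le_trans _ (psi_lb _ mA)).
    have -> : 2 * K = C * d ^+ 2 by rewrite /C mulfVK// gt_eqF// exprn_gt0.
    rewrite ler_pM2l// /S (bigD1 i)//= -[X in X <= _]addr0 lerD//.
      rewrite -[(m 0 i - _) ^+ 2]real_normK ?num_real//.
      by apply: lerXn2r; rewrite ?nnegrE ?normr_ge0 ?(ltW d0).
    by apply: sumr_ge0 => j _; exact: sqr_ge0.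
  have [ms|ms] := leP (m 0 s) (z 0 s).
    have mz : flip s z m = m.
      apply/rowP => i; rewrite flipE; case: eqP => [->|//].
      have /andP[h _] := As _ mA; lra.
    rewrite /phi mz subrr; apply: le_trans (psi_lb _ mA).
    by apply: mulr_ge0 => //; exact: ltW.
  exfalso.
  (* The second derivative of the barrier along axis i is 2 c_i. These add up to 2 C (n - (n+1)) = -
     2 C < 0, whereas the odd part has Laplacian 0. *)
  pose c i := C * (1 - (i == s)%:R * n.+1%:R).
  have lapm : \sum_i pd i (pd i phi) m <= \sum_i 2 * c i.
    apply: ler_sum => i _.
    (* Steps shorter than e along axis i stay in the half cube; the second term matters for i = s.
       The number b that follows is the slope of the barrier at m along axis i. *)
    pose e := Num.min (d - `|m 0 i - z 0 i|) (m 0 s - z 0 s).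
    have e0 : 0 < e by rewrite lt_min !subr_gt0 interior.
    pose b := C * (2 * (m 0 i - z 0 i) + (i == s)%:R * n.+1%:R * (d - 2 * (m 0 s - z 0 s))).
    apply: (@second_derivative_le U phi i m b (c i) e) => //; first exact: AU.
    move=> h; rewrite lt_min => /andP[h1 h2].
    have hA : A (h *: axis i + m).
      move=> j; have := mA j; rewrite /= !in_itv /= !mxE eqxx /=.
      case: (altP (j =P i)) => [->|_]; last by rewrite mulr0 add0r.
      rewrite mulr1 => _.
      have H1 : `|h| + `|m 0 i - z 0 i| < d by rewrite -ltrBrDr.
      have a1 := ler_norm h; have a2 := ler_norm (- h); rewrite normrN in a2.
      have a3 := ler_norm (m 0 i - z 0 i); have a4 := ler_norm (- (m 0 i - z 0 i)); rewrite normrN in a4.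
      apply/andP; split; last by lra.
      rewrite /lo; case: eqP => [is_|_]; last by lra.
      by rewrite is_; lra.
    have := mmax (h *: axis i + m); rewrite inE => /(_ hA).
    have -> : psi (h *: axis i + m) = psi m + b * h + c i * h ^+ 2.
      have -> : psi (h *: axis i + m) = C * (S m + (2 * (m 0 i - z 0 i) * h + h ^+ 2) +
          n.+1%:R * ((m 0 s + (i == s)%:R * h - z 0 s) * (d - (m 0 s + (i == s)%:R * h - z 0 s)))).
        congr (C * (_ + _ * _)); last first.
          by rewrite !mxE eqxx /= (eq_sym s i); case: (i == s) => /=; ring.
        rewrite /S (bigD1 i)//= [in RHS](bigD1 i)//= !mxE !eqxx /= mulr1.
        rewrite (eq_bigr (fun j => (m 0 j - z 0 j) ^+ 2)); last first.
          by move=> j ji; rewrite !mxE (negbTE ji) mulr0 add0r.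
        by ring.
      rewrite /psi /b /c; case: (altP (i =P s)) => [->|_] /=; ring.
    lra.
  have : \sum_i pd i (pd i phi) m = 0.
    have Um := AU _ mA.
    suff -> : \sum_i pd i (pd i phi) m = lap w m - lap (w \o flip s z) m.
      rewrite (lap_affm oU _ sU Um cw) ?(lw _ Um) ?(lw _ (sU _ Um)) ?subrr// => j.
      by rewrite mxE; case: eqP => _; rewrite ?mulrNN mulr1.
    rewrite /lap -sumrB; apply: eq_bigr => i _.
    have cw' : Cn 2 U (w \o flip s z) by exact: (Cn_affm oU sU).
    have E y : U y -> pd i phi y = pd i w y - pd i (w \o flip s z) y.
      move=> Uy; apply: is_derive_pd.
      by apply: is_deriveB; [exact: (Cn_is_derive i cw)|exact: (Cn_is_derive i cw')].
    rewrite (pd_ext i oU E Um); apply: is_derive_pd; apply: is_deriveB.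
      exact: (Cn_is_derive i (Cn_pd i cw)).
    exact: (Cn_is_derive i (Cn_pd i cw')).
  move=> E0; move: lapm; rewrite E0 -mulr_sumr -mulr_sumr sumrB.
  have -> : \sum_(i < n) (i == s)%:R * n.+1%:R = n.+1%:R :> R.
    rewrite (bigD1 s)//= eqxx mul1r big1 ?addr0// => j /negbTE ->.
    by rewrite mul0r.
  rewrite sumr_const card_ord.
  have -> : n%:R - n.+1%:R = -1 :> R by rewrite -[n.+1]addn1 natrD opprD addrA subrr sub0r.
  by lra.
have := mmax (t *: axis s + z); rewrite inE => /(_ At) /le_trans /(_ m_le0).
rewrite subr_le0 /phi.
have -> : flip s z (t *: axis s + z) = - t *: axis s + z.
  apply/rowP => i; rewrite flipE !mxE !eqxx /=; case: eqP => [->|_] /=; ring.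
move=> /le_trans; apply.
have -> : psi (t *: axis s + z) = C * (t ^+ 2 + n.+1%:R * (t * (d - t))).
  congr (C * (_ + _ * _)); last by rewrite !mxE !eqxx /= mulr1 addrK.
  rewrite /S (bigD1 s)//= big1 ?addr0 ?mxE ?eqxx /= ?mulr1 ?addrK//.
  by move=> j js; rewrite !mxE (negbTE js) mulr0 add0r subrr expr0n.
have -> : 2 * n.+1%:R * K * t / d = C * (n.+1%:R * (t * d)).
  by rewrite /C; field; rewrite gt_eqF.
rewrite ler_pM2l//.
have : t ^+ 2 * 1 <= t ^+ 2 * n.+1%:R by rewrite ler_wpM2l ?sqr_ge0// ler1n.
nra.
Qed.

End GradientEstimate.

Lemma dist_trans2 (R : realDomainType) (a b a' b' : R) :
  `|a - b| <= `|a - a'| + `|a' - b'| + `|b - b'|.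
Proof.
have -> : a - b = (a - a') + (a' - b') - (b - b') by ring.
by apply: le_trans (ler_normB _ _) _; rewrite lerD2r ler_normD.
Qed.

Lemma dist_sub_le (R : realDomainType) (a b a' b' : R) :
  `|a - b - (a' - b')| <= `|a - a'| + `|b - b'|.
Proof.
have -> : a - b - (a' - b') = (a - a') - (b - b') by ring.
exact: ler_normB.
Qed.

(** * Local uniform limits of harmonic functions *)

Section ApproximatelyHarmonic.
Context {R : realType} {n : nat}.
Implicit Types (U : set 'rV[R]_n) (x y z : 'rV[R]_n) (w u : 'rV[R]_n -> R).

Definition cube z (r : R) : set 'rV[R]_n := [set y | `|y - z| < r].

Lemma harmonicB U w u : open U -> harmonic_on U w -> harmonic_on U u ->
  harmonic_on U (fun y => w y - u y).
Proof.
move=> oU [cw lw] [cu lu]; split; first exact: CnB.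
move=> x Ux; rewrite -[RHS](subrr (0 : R)) -{1}(lw x Ux) -(lu x Ux) -sumrB.
apply: eq_bigr => i _.
have E y : U y -> pd i (fun y => w y - u y) y = pd i w y - pd i u y.
  by move=> Uy; apply: is_derive_pd; apply: is_deriveB; apply: Cn_is_derive; eassumption.
rewrite (pd_ext i oU E Ux); apply: is_derive_pd; apply: is_deriveB.
  exact: (Cn_is_derive i (Cn_pd i cw)).
exact: (Cn_is_derive i (Cn_pd i cu)).
Qed.

Lemma harmonicZ U w (k : R) : open U -> harmonic_on U w ->
  harmonic_on U (fun y => k * w y).
Proof.
move=> oU [cw lw]; split; first exact: CnZ.
move=> x Ux; rewrite -[RHS](mulr0 k) -(lw x Ux) mulr_sumr; apply: eq_bigr => i _.
have E y : U y -> pd i (fun y => k * w y) y = k *: pd i w y.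
  by move=> Uy; apply: is_derive_pd; apply: is_deriveZ; apply: Cn_is_derive; eassumption.
rewrite (pd_ext i oU E Ux); apply: is_derive_pd; apply: is_deriveZ.
exact: (Cn_is_derive i (Cn_pd i cw)).
Qed.

Lemma harmonic_shift U U' w (c : 'rV[R]_n) : open U' ->
  (forall x, U' x -> U (c + x)) -> harmonic_on U w -> harmonic_on U' (fun y => w (c + y)).
Proof.
move=> oU' sU [cw lw].
have E : (fun y => w (c + y)) = w \o affm (const_mx 1) c.
  by apply: funext => y; congr w; apply/rowP => i; rewrite !mxE mul1r addrC.
have sU' x : U' x -> U (affm (const_mx 1) c x).
  move=> /sU; congr U; apply/rowP => i; by rewrite !mxE mul1r addrC.
rewrite E; split; first exact: (Cn_affm oU' sU').
have a1 i : (const_mx 1 : 'rV[R]_n) 0 i * (const_mx 1 : 'rV[R]_n) 0 i = 1 by rewrite mxE mulr1.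
by move=> x Ux; rewrite (lap_affm oU' a1 sU' Ux cw) lw//; exact: sU'.
Qed.

Lemma cube_sub z (r r' : R) : r' <= r -> cube z r' `<=` cube z r.
Proof. by move=> rr y /lt_le_trans; apply. Qed.

Lemma cubeW z y (r r' : R) : cube z r' y -> r' <= r -> cube z r y.
Proof. by move=> zy /cube_sub; apply. Qed.

Lemma cube_shift z y (r r' : R) s h : `|h| + r' <= r -> cube z r' y -> cube z r (h *: axis s + y).
Proof.
move=> hr yr; rewrite /cube /= -addrA; apply: lt_le_trans hr.
apply: le_lt_trans (ler_normD _ _) _.
by rewrite ler_ltD//; exact: norm_scale_axis.
Qed.

(** A uniform limit of harmonic functions on the cube. Nothing is asked of u itself, and the
    property is stable under uniform limits, so it can be handed from difference quotients to the
    derivative. *)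
Definition almost_harmonic z (r : R) u := forall e : R, 0 < e ->
  exists2 w, harmonic_on (cube z r) w & forall y, cube z r y -> `|u y - w y| <= e.

(** The two points are mirror images about their midpoint m, so the difference is an odd part there.
    The comparison on the cube of radius r/2 about m, with d = r/4 and t = h/2, produces the
    constant; the lower bound comes from - w. *)
Lemma harmonic_difference_le w s z (r K h : R) y : 0 < r -> 0 < K ->
  harmonic_on (cube z r) w -> (forall y, cube z r y -> `|w y| <= K) ->
  cube z (r / 2) y -> cube z (r / 2) (h *: axis s + y) -> 0 <= h <= r / 2 ->
  `|w (h *: axis s + y) - w y| <= 4 * n.+1%:R * K / r * h.
Proof.
move=> r0 K0 hw wK zy zhy /andP[h0 hr].
pose m := (h / 2) *: axis s + y.
have mz : `|m - z| < r / 2.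
  have -> : m - z = 2^-1 *: ((h *: axis s + y - z) + (y - z)).
    by apply/rowP => i; rewrite !mxE; field.
  rewrite normrZ gtr0_norm ?invr_gt0//.
  have := ler_normD (h *: axis s + y - z) (y - z).
  by move: zy zhy; rewrite /cube /=; lra.
have sub : cube m (r / 2) `<=` cube z r.
  move=> x; rewrite /cube /= => xm; rewrite -(subrKA m).
  apply: le_lt_trans (ler_normD _ _) _; lra.
have key v : harmonic_on (cube z r) v -> (forall y, cube z r y -> `|v y| <= K) ->
    v (h *: axis s + y) - v y <= 4 * n.+1%:R * K / r * h.
  move=> [cv lv] vK.
  have hv : harmonic_on (cube m (r / 2)) v.
    by split; [exact: Cn_sub cv|move=> x /sub; exact: lv].
  have H1 : 0 < r / 4 by lra.
  have H2 : r / 4 < r / 2 by lra.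
  have H3 : 0 <= h / 2 <= r / 4 by apply/andP; split; lra.
  have := harmonic_odd_part_le s H1 H2 K0 hv (fun y yr => vK y (sub _ yr)) H3.
  have -> : (h / 2) *: axis s + m = h *: axis s + y.
    by rewrite /m addrA -scalerDl -splitr.
  have -> : - (h / 2) *: axis s + m = y by rewrite /m addrA scaleNr addNr add0r.
  move=> /le_trans; apply; rewrite le_eqVlt; apply/orP; left; apply/eqP; field.
  by rewrite gt_eqF.
rewrite ler_norml key// andbT.
have hN : harmonic_on (cube z r) (fun y => -1 * w y).
  by apply: harmonicZ => //; exact: open_cube.
have := key _ hN; rewrite !mulN1r opprK => H; rewrite lerNl opprB addrC; apply: H.
by move=> y' ?; rewrite mulN1r normrN wK.
Qed.

Lemma almost_harmonicW z (r r' : R) u : r' <= r -> almost_harmonic z r u -> almost_harmonic z r' u.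
Proof.
move=> rr H e e0; have [w [cw lw] wu] := H e e0; have sub := @cube_sub z _ _ rr.
exists w; last by move=> y /sub; exact: wu.
by split; [exact: Cn_sub cw|move=> x /sub; exact: lw].
Qed.

(** A harmonic function within e' of u obeys the bound with K + e' in place of K, and passing back
    to u costs another 2 e'; the choice of e' makes the total excess e. *)
Lemma almost_harmonic_difference_le u s z (r K h : R) y : 0 < r -> 0 < K ->
  almost_harmonic z r u -> (forall y, cube z r y -> `|u y| <= K) ->
  cube z (r / 2) y -> cube z (r / 2) (h *: axis s + y) -> `|h| <= r / 2 ->
  `|u (h *: axis s + y) - u y| <= 4 * n.+1%:R * K / r * `|h|.
Proof.
move=> r0 K0 au uK.
wlog h0 : h y / 0 <= h.
  move=> H zy zhy hr; have [h0|h0] := leP 0 h; first exact: H.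
  rewrite distrC -(normrN h); have := H (- h) (h *: axis s + y).
  by rewrite addrA scaleNr addNr add0r normrN; apply => //; rewrite oppr_ge0 ltW.
rewrite ger0_norm// => zy zhy hr; apply/ler_addgt0Pl => e e0.
set C := 4 * n.+1%:R / r * h.
have C0 : 0 <= C by rewrite /C mulr_ge0// divr_ge0 ?mulr_ge0// ltW.
pose e' := e / (2 + C).
have e'0 : 0 < e' by rewrite divr_gt0// ltr_wpDr.
have eE : 2 * e' + C * e' = e by rewrite -mulrDl /e' mulrC divfK// gt_eqF// ltr_wpDr.
have [w hw uw] := au e' e'0.
have sub : cube z (r / 2) `<=` cube z r by apply: cube_sub; lra.
have h01 : 0 <= h <= r / 2 by rewrite h0.
have wK y' : cube z r y' -> `|w y'| <= K + e'.
  move=> zy'; rewrite -[w y'](subrK (u y')) addrC; apply: le_trans (ler_normD _ _) _.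
  by rewrite lerD ?uK// distrC uw.
have := harmonic_difference_le r0 (addr_gt0 K0 e'0) hw wK zy zhy h01.
have -> : 4 * n.+1%:R * (K + e') / r * h = 4 * n.+1%:R * K / r * h + C * e'.
  by rewrite /C; ring.
have := uw _ (sub _ zy); have := uw _ (sub _ zhy); move: eE => /[swap] H1 /[swap] H2 eE H3.
apply: le_trans (dist_trans2 _ _ (w (h *: axis s + y)) (w y)) _; lra.
Qed.

Definition quot (h : R) s u y := h^-1 * (u (h *: axis s + y) - u y).

Lemma almost_harmonic_quot z (r h : R) s u : h != 0 -> `|h| <= r / 2 ->
  almost_harmonic z r u -> almost_harmonic z (r / 2) (quot h s u).
Proof.
move=> h0 hr H e e0.
have h0' : 0 < `|h| by rewrite normr_gt0.
have r0 : 0 < r by lra.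
(* An error of e |h| / 2 at both ends of the step becomes e after division by |h|. *)
have [w hw uw] := H (e * `|h| / 2) (divr_gt0 (mulr_gt0 e0 h0') (ltr0Sn R 1)).
have sub : cube z (r / 2) `<=` cube z r by apply: cube_sub; lra.
have sub' y : cube z (r / 2) y -> cube z r (h *: axis s + y) by apply: cube_shift; lra.
have oU := @open_cube R n z (r / 2).
exists (quot h s w).
  apply: harmonicZ => //; apply: harmonicB => //; first exact: harmonic_shift hw.
  by case: hw => cw lw; split; [exact: Cn_sub cw|move=> x /sub; exact: lw].
move=> y zy; rewrite /quot -mulrBr normrM normfV ler_pdivrMl// mulrC.
have H1 := uw _ (sub _ zy); have H2 := uw _ (sub' _ zy).
apply: le_trans (dist_sub_le _ _ _ _) _; lra.
Qed.

Lemma almost_harmonicB z (r : R) u w : almost_harmonic z r u -> harmonic_on (cube z r) w ->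
  almost_harmonic z r (fun y => u y - w y).
Proof.
move=> H hw e e0; have [v hv uv] := H e e0; exists (fun y => v y - w y).
  by apply: harmonicB => //; exact: open_cube.
by move=> y zy; rewrite opprB addrA subrK; exact: uv.
Qed.

Lemma quot_le z (r K h : R) s u y : 0 < K -> almost_harmonic z r u ->
  (forall y, cube z r y -> `|u y| <= K) -> h != 0 -> `|h| <= r / 4 -> cube z (r / 4) y ->
  `|quot h s u y| <= 4 * n.+1%:R * K / r.
Proof.
move=> K0 au uK h0 hr zy; have h0' : 0 < `|h| by rewrite normr_gt0.
rewrite /quot normrM normfV ler_pdivrMl// mulrC.
apply: (@almost_harmonic_difference_le u s z) => //; try lra.
  by apply: (cubeW zy); lra.
by apply: cube_shift zy; lra.
Qed.

Lemma quot_cvg u s y (l : R) e : derivable u y (axis s) -> pd s u y = l -> 0 < e ->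
  exists2 d : R, 0 < d & forall h, h != 0 -> `|h| < d -> `|quot h s u y - l| <= e.
Proof.
move=> du ul e0.
have /is_deriveP /(_ e e0)[d d0 H] : is_derive y (axis s) u l by apply: DeriveDef.
exists d => // h h0 hd; have h0' : 0 < `|h| by rewrite normr_gt0.
have -> : quot h s u y - l = h^-1 * (u (h *: axis s + y) - u y - h * l).
  by rewrite /quot [in RHS]mulrBr mulKf.
by rewrite normrM normfV ler_pdivrMl// [leRHS]mulrC; exact: H.
Qed.

(** The quotients of u split into those of a harmonic w, which converge, and those of u - w. The
    latter is itself almost harmonic and tiny, so the difference estimate keeps its quotients below
    e/4 for all steps up to r/4, and the quotients of u satisfy the Cauchy criterion. *)
Lemma almost_harmonic_derivable z (r : R) s u y : 0 < r -> almost_harmonic z r u ->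
  cube z (r / 4) y -> derivable u y (axis s).
Proof.
move=> r0 au zy; apply: cauchy_cvg; apply: cauchy_exP => e e0 /=.
pose C := 4 * n.+1%:R / r.
have C0 : 0 < C by rewrite divr_gt0// mulr_gt0.
have e2 : 0 < e / 2 by lra.
pose e' := e / 4 / C.
have e4 : 0 < e / 4 by lra.
have e'0 : 0 < e' by exact: divr_gt0.
have [w hw uw] := au e' e'0.
have [cw _] := hw.
have zy' : cube z r y by apply: (cubeW zy); lra.
have [d d0 Hd] := quot_cvg (@Cn_derivable _ _ _ _ _ _ _ s cw zy') erefl e4.
exists (pd s w y) => /=.
exists (Num.min d (r / 4)) => /=; first by rewrite lt_min d0; lra.
move=> h /=; rewrite sub0r normrN lt_min => /andP[hd hr] h0.
have h0' : 0 < `|h| by rewrite normr_gt0.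
have A := Hd h h0 hd.
have B : `|quot h s (fun y => u y - w y) y| <= e / 4.
  have := quot_le s e'0 (almost_harmonicB au hw) uw h0 (ltW hr) zy.
  have -> : 4 * n.+1%:R * e' / r = C * e' by rewrite /C; ring.
  by rewrite /e' mulrC divfK// gt_eqF.
rewrite -ball_normE /ball_ /=.
have -> : h^-1 *: (u (h *: axis s + y) - u y) =
   quot h s w y + quot h s (fun y => u y - w y) y.
  by rewrite /quot -[_ *: _]/(h^-1 * _); ring.
rewrite opprD addrA; apply: le_lt_trans (ler_normB _ _) _; rewrite distrC; lra.
Qed.

(** The difference estimate used twice: a quotient [quot h s u] is almost harmonic and bounded by 4
    (n+1) K / r on the cube of radius r/4, so it satisfies the estimate in turn; then h tends to
    0. *)
Lemma almost_harmonic_pd_difference_le z (r K t : R) s u y : 0 < r -> 0 < K ->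
  almost_harmonic z r u -> (forall y, cube z r y -> `|u y| <= K) ->
  cube z (r / 8) y -> cube z (r / 8) (t *: axis s + y) -> `|t| <= r / 8 ->
  `|pd s u (t *: axis s + y) - pd s u y| <= 4 * n.+1%:R * (4 * n.+1%:R * K / r) / (r / 4) * `|t|.
Proof.
move=> r0 K0 au uK zy zty tr; apply/ler_addgt0Pl => e e0.
set B := 4 * n.+1%:R * K / r; set C := 4 * _ * _ / _.
have B0 : 0 < B by rewrite divr_gt0// !mulr_gt0.
have e2 : 0 < e / 2 by lra.
have sub : cube z (r / 8) `<=` cube z (r / 4) by apply: cube_sub; lra.
have [d1 d10 H1] := quot_cvg (almost_harmonic_derivable (s:=s) r0 au (sub _ zy)) erefl e2.
have [d2 d20 H2] := quot_cvg (almost_harmonic_derivable (s:=s) r0 au (sub _ zty)) erefl e2.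
pose h := Num.min (Num.min d1 d2) (r / 4) / 2.
have m0 : 0 < Num.min (Num.min d1 d2) (r / 4) by rewrite !lt_min d10 d20; lra.
have h0 : 0 < h by rewrite divr_gt0.
have hh : h < Num.min (Num.min d1 d2) (r / 4) by rewrite /h; lra.
have hn0 : h != 0 by rewrite gt_eqF.
move: hh; rewrite !lt_min -{1 2 3}(gtr0_norm h0) => /andP[/andP[hd1 hd2] hr].
have hr2 : `|h| <= r / 2 by lra.
have aq : almost_harmonic z (r / 4) (quot h s u).
  by apply: almost_harmonicW (almost_harmonic_quot s hn0 hr2 au); lra.
have qK y' : cube z (r / 4) y' -> `|quot h s u y'| <= B.
  by move=> zy'; exact: quot_le K0 au uK hn0 (ltW hr) zy'.
have r40 : 0 < r / 4 by lra.
have e8 : r / 4 / 2 = r / 8 by field.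
have := @almost_harmonic_difference_le (quot h s u) s z (r / 4) B t y r40 B0 aq qK.
rewrite e8 => /(_ zy zty tr) H3.
have := H1 h hn0 hd1; have := H2 h hn0 hd2; move: H3; rewrite -/C => A1 A2 A3.
apply: le_trans (dist_trans2 _ _ (quot h s u (t *: axis s + y)) (quot h s u y)) _.
rewrite (distrC (pd s u y)) (distrC (pd s u (_ + y))); lra.
Qed.

(** By the mean value theorem a quotient is the derivative at a nearby point, so the preceding
    Lipschitz bound makes the quotients converge to [pd s u] uniformly, with error at most C |t|.
    They are almost harmonic and bounded, and both properties pass to the limit. *)
Lemma almost_harmonic_pd z (r K : R) s u : 0 < r -> 0 < K ->
  almost_harmonic z r u -> (forall y, cube z r y -> `|u y| <= K) ->
  almost_harmonic z (r / 16) (pd s u) /\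
  exists2 K', 0 < K' & forall y, cube z (r / 16) y -> `|pd s u y| <= K'.
Proof.
move=> r0 K0 au uK.
have B0 : 0 < 4 * n.+1%:R * K / r by rewrite divr_gt0// !mulr_gt0.
set C := 4 * n.+1%:R * (4 * n.+1%:R * K / r) / (r / 4).
have C0 : 0 < C by apply: divr_gt0; [apply: mulr_gt0 => //; exact: mulr_gt0|lra].
have near_quot t y : t != 0 -> `|t| <= r / 16 -> cube z (r / 16) y ->
    `|pd s u y - quot t s u y| <= C * `|t|.
  move=> t0 tr zy.
  have zty a : 0 <= a <= 1 -> cube z (r / 8) ((a * t) *: axis s + y).
    move=> /andP[a0 a1]; apply: cube_shift zy; rewrite normrM (ger0_norm a0).
    have : a * `|t| <= `|t| by rewrite ler_piMl.
    lra.
  have [a /andP[a0 a1] E] : exists2 a : R, 0 < a < 1 &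
      u (t *: axis s + y) - u y = t * pd s u ((a * t) *: axis s + y).
    apply: MVT_axis => a a01; apply: DeriveDef => //.
    apply: (almost_harmonic_derivable (s:=s) r0 au); apply: (cubeW (zty _ a01)); lra.
  have a01 : 0 <= a <= 1 by rewrite (ltW a0) (ltW a1).
  have at_le : `|a * t| <= `|t| by rewrite normrM gtr0_norm// ler_piMl// ltW.
  rewrite /quot E mulKf// distrC.
  apply: le_trans (almost_harmonic_pd_difference_le r0 K0 au uK _ (zty _ a01) _) _.
  - by apply: (cubeW zy); lra.
  - lra.
  - by rewrite ler_pM2l.
split; last first.
  have t0 : 0 < r / 16 by lra.
  exists (C * `|r / 16| + 4 * n.+1%:R * K / r).
    by rewrite addr_gt0// mulr_gt0// normr_gt0 gt_eqF.
  move=> y zy; have tn0 : r / 16 != 0 by rewrite gt_eqF.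
  have tle : `|r / 16| <= r / 16 by rewrite gtr0_norm.
  rewrite -[pd s u y](subrK (quot (r / 16) s u y)).
  apply: le_trans (ler_normD _ _) (lerD (near_quot _ _ tn0 tle zy) _).
  have r164 : `|r / 16| <= r / 4 by lra.
  have r16 : r / 16 <= r / 4 by lra.
  exact: quot_le K0 au uK tn0 r164 (cubeW zy r16).
move=> e e0.
pose t := Num.min (r / 16) (e / 2 / C).
have t0 : 0 < t by rewrite lt_min; apply/andP; split; [lra|apply: divr_gt0 => //; lra].
have tn0 : t != 0 by rewrite gt_eqF.
have tr : `|t| <= r / 16 by rewrite gtr0_norm// ge_min lexx.
have tr2 : `|t| <= r / 2 by lra.
have Ct : C * `|t| <= e / 2.
  by rewrite gtr0_norm// mulrC -ler_pdivlMr// ge_min lexx orbT.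
have e2 : 0 < e / 2 by lra.
have r16 : r / 16 <= r / 2 by lra.
have [w hw uw] := almost_harmonicW r16 (almost_harmonic_quot s tn0 tr2 au) e2.
exists w => // y zy; rewrite -(subrKA (quot t s u y)) (splitr e).
apply: le_trans (ler_normD _ _) (lerD _ (uw _ zy)).
by apply: le_trans Ct; exact: near_quot.
Qed.

(** Bounded almost harmonic functions are continuous, and their partial derivatives are of the same
    kind on a cube sixteen times smaller. Radius and bound may depend on the point, so the induction
    can change them at each order. *)
Theorem almost_harmonic_Cn N U u :
  (forall x, U x -> exists r K : R, [/\ 0 < r, 0 < K, almost_harmonic x r u &
     forall y, cube x r y -> `|u y| <= K]) -> Cn N U u.
Proof.
have center (x : 'rV[R]_n) (r : R) : 0 < r -> cube x r x by rewrite /cube /= subrr normr0.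
have cont v x : (exists r K : R, [/\ 0 < r, 0 < K, almost_harmonic x r v &
     forall y, cube x r y -> `|v y| <= K]) -> {for x, continuous v}.
  move=> [r [K [r0 K0 au uK]]]; apply/continuous_atP => e e0.
  have e3 : 0 < e / 3 by lra.
  have [w [cw _] uw] := au _ e3.
  have /near_rVP[d d0 Hd] := (continuous_atP _ _).1 (Cn_continuous cw (center _ _ r0)) _ e3.
  apply/near_rVP; exists (Num.min d r); first by rewrite lt_min d0.
  move=> y; rewrite lt_min => /andP[yd yr].
  have A1 := Hd _ yd; have A2 := uw _ yr; have A3 := uw _ (center x r r0).
  apply: le_trans (dist_trans2 _ _ (w x) (w y)) _; lra.
elim: N u => [|N IH] u H; first by apply: Cn0 => x /H; exact: cont.
apply: CnS => [x /H|s x /H|s]; first exact: cont.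
  move=> [r [K [r0 K0 au uK]]]; apply: (almost_harmonic_derivable (s:=s) r0 au).
  by apply: center; lra.
apply: IH => x /H [r [K [r0 K0 au uK]]].
have [a [K' K'0 K'E]] := almost_harmonic_pd s r0 K0 au uK.
by exists (r / 16), K'; split => //; lra.
Qed.

End ApproximatelyHarmonic.

(** * Averages *)

Section MeanValue.
Context {R : realType}.
Implicit Types (h g : R -> R).

Local Notation mu := (@lebesgue_measure R).
Local Notation I01 := (`[0, 1]%classic : set R).

Definition mean01 h : R := \int[mu]_(t in I01) h t.
Definition cont01 h := {within I01, continuous h}.

Let integrable01 h : cont01 h -> mu.-integrable I01 (EFin \o h).
Proof. by move=> ch; apply: continuous_compact_integrable => //; exact: segment_compact. Qed.

Let m01 : measurable I01. Proof. exact: measurable_itv. Qed.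

Lemma eq_mean01 h g : (forall t, 0 <= t <= 1 -> h t = g t) -> mean01 h = mean01 g.
Proof. by move=> hg; apply: eq_Rintegral => t; rewrite inE /= in_itv; exact: hg. Qed.

Lemma mean01_cst (c : R) : mean01 (fun=> c) = c.
Proof.
rewrite /mean01 Rintegral_cst//= lebesgue_measure_itv /= lte_fin ltr01.
by rewrite -EFinB /= subr0 mulr1.
Qed.

Lemma mean01D h g : cont01 h -> cont01 g -> mean01 (fun t => h t + g t) = mean01 h + mean01 g.
Proof. by move=> ch cg; apply: RintegralD => //; exact: integrable01. Qed.

Lemma mean01B h g : cont01 h -> cont01 g -> mean01 (fun t => h t - g t) = mean01 h - mean01 g.
Proof. by move=> ch cg; apply: RintegralB => //; exact: integrable01. Qed.

Lemma mean01Z (c : R) h : cont01 h -> mean01 (fun t => c * h t) = c * mean01 h.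
Proof. by move=> ch; apply: RintegralZl => //; exact: integrable01. Qed.

Lemma mean01_le h (K : R) : cont01 h -> (forall t, 0 <= t <= 1 -> `|h t| <= K) ->
  `|mean01 h| <= K.
Proof.
move=> ch hK; rewrite ler_norml; apply/andP; split.
  rewrite -[X in X <= _](mean01_cst (- K)); apply: le_Rintegral => //.
  - by apply: integrable01; apply: continuous_subspaceT => ?; exact: cst_continuous.
  - exact: integrable01.
  - by move=> t; rewrite /= in_itv /= => /hK; rewrite ler_norml => /andP[].
rewrite -[X in _ <= X](mean01_cst K); apply: le_Rintegral => //.
- exact: integrable01.
- by apply: integrable01; apply: continuous_subspaceT => ?; exact: cst_continuous.
- by move=> t; rewrite /= in_itv /= => /hK; rewrite ler_norml => /andP[].
Qed.

Lemma mean01_derive (F f : R -> R) : cont01 f ->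
  (forall t : R, 0 <= t <= 1 -> is_derive t (1 : R) F (f t)) -> mean01 f = F 1 - F 0.
Proof.
move=> cf dF.
have cF t : 0 <= t <= 1 -> {for t, continuous F}.
  move=> t01; apply: differentiable_continuous; apply/derivable1_diffP.
  by have [] := dF t t01.
have sub t : t \in `]0, 1[ -> 0 <= t <= 1 by rewrite in_itv /= => /andP[/ltW-> /ltW->].
rewrite /mean01 /Rintegral (@continuous_FTC2 R f F 0 1 ltr01 cf)//.
  split.
  - by move=> t /sub t01; have [] := dF t t01.
  - by apply: cvg_at_right_filter; apply: cF; rewrite lexx ler01.
  - by apply: cvg_at_left_filter; apply: cF; rewrite lexx ler01.
by move=> t /sub t01; rewrite derive1E; have [_] := dF t t01.
Qed.

Lemma cont01P h : (forall t, 0 <= t <= 1 -> {for t, continuous h}) -> cont01 h.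
Proof.
by move=> ch; apply: continuous_in_subspaceT => t; rewrite inE /= in_itv /=; exact: ch.
Qed.

Lemma cont01D h g : cont01 h -> cont01 g -> cont01 (fun t => h t + g t).
Proof. by move=> ch cg t; apply: cvgD; [exact: ch|exact: cg]. Qed.

Lemma cont01Z (c : R) h : cont01 h -> cont01 (fun t => c * h t).
Proof. by move=> ch t; apply: cvgM; [exact: cvg_cst|exact: ch]. Qed.

Lemma cont01_sum (I : Type) (r : seq I) (h : I -> R -> R) :
  (forall i, cont01 (h i)) -> cont01 (fun t => \sum_(i <- r) h i t).
Proof.
move=> H; elim: r => [|i r IH].
  by under eq_fun do rewrite big_nil; apply: continuous_subspaceT => ?; exact: cst_continuous.
by under eq_fun do rewrite big_cons; exact: cont01D.
Qed.

Lemma mean01_sum (I : Type) (r : seq I) (h : I -> R -> R) : (forall i, cont01 (h i)) ->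
  mean01 (fun t => \sum_(i <- r) h i t) = \sum_(i <- r) mean01 (h i).
Proof.
move=> H; elim: r => [|i r IH].
  by rewrite big_nil -[RHS](mean01_cst 0); apply: eq_mean01 => t _; rewrite big_nil.
rewrite big_cons -IH -mean01D//; last exact: cont01_sum.
by apply: eq_mean01 => t _; rewrite big_cons.
Qed.

End MeanValue.

(** * Averages over affine families of maps, and differentiation under the integral *)

Section AffineAverage.
Context {R : realType} {n : nat}.
Variables a b c : 'rV[R]_n.
Implicit Types (U : set 'rV[R]_n) (x y : 'rV[R]_n) (u : 'rV[R]_n -> R) (th : R -> R).

(** Two families are meant: translations by t e along an axis, which give the means that smooth a
    solution, and the scaling of the single coordinate r by t, which gives the quotient of an odd
    function by r. *)
Definition apath (t : R) : 'rV[R]_n -> 'rV[R]_n := affm (a + t *: b) (t *: c).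
Definition average th u x := mean01 (fun t => th t * u (apath t x)).

(** A class of weights that contains 1 and is closed under multiplication by [rate s], the factor
    that a derivative along axis s produces. *)
Definition weight th := continuous th /\ exists2 K : R, 0 < K & forall t, 0 <= t <= 1 -> `|th t| <= K.
Definition rate s (t : R) : R := a 0 s + t * b 0 s.

Lemma apathE t x i : apath t x 0 i = (a 0 i + t * b 0 i) * x 0 i + t * c 0 i.
Proof. by rewrite !mxE. Qed.

Lemma apath_axis t (h : R) s x : apath t (h *: axis s + x) = (h * rate s t) *: axis s + apath t x.
Proof. by rewrite /apath affm_axis !mxE. Qed.

Lemma weight_rate th s : weight th -> weight (fun t => th t * rate s t).
Proof.
move=> [cth [K K0 thK]]; split.
  move=> t; apply: cvgM; first exact: cth.
  apply: cvgD; first exact: cvg_cst.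
  by apply: cvgM; [exact: cvg_id|exact: cvg_cst].
exists (K * (`|a 0 s| + `|b 0 s| + 1)).
  by rewrite mulr_gt0// ltr_wpDl// addr_ge0.
move=> t t01; rewrite normrM ler_pM ?thK//.
apply: le_trans (ler_normD _ _) _; rewrite -addrA lerD2l normrM.
case/andP: t01 => t0 t1; rewrite ger0_norm// -[X in X <= _]addr0 lerD//.
by rewrite ler_piMl.
Qed.

Lemma apath_cvg (t : R) x :
  (fun z : R * 'rV[R]_n => apath z.1 z.2) @ filter_prod (nbhs t) (nbhs x) --> apath t x.
Proof.
apply/cvgrPdist_le => e e0.
have : \forall z \near filter_prod (nbhs t) (nbhs x),
    forall j, `|apath t x 0 j - apath z.1 z.2 0 j| <= e.
  apply: filter_forall => j.
  have c1 : (fun z : R * 'rV[R]_n => z.1) @ filter_prod (nbhs t) (nbhs x) --> t by exact: cvg_fst.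
  have c2 : (fun z : R * 'rV[R]_n => z.2 0 j) @ filter_prod (nbhs t) (nbhs x) --> x 0 j.
    apply: (@cvg_comp _ _ _ snd (fun y : 'rV[R]_n => y 0 j) _ (nbhs x)); first exact: cvg_snd.
    exact: coord_continuous.
  have : (fun z : R * 'rV[R]_n => apath z.1 z.2 0 j) @ filter_prod (nbhs t) (nbhs x) --> apath t x 0 j.
    under eq_fun do rewrite apathE; rewrite apathE.
    apply: cvgD; last by apply: cvgM => //; exact: cvg_cst.
    apply: cvgM => //; apply: cvgD; first exact: cvg_cst.
    by apply: cvgM => //; exact: cvg_cst.
  by move/cvgrPdist_le => /(_ e e0).
apply: filterS => z H; apply: norm_rV_le; first exact: ltW.
by move=> i; have := H i; rewrite !mxE.
Qed.


(* The near-covering form of the compactness of [0, 1] gives uniformity in t. *)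
Lemma uniformly_near_path U u x : Cn 0 U u -> (forall t, 0 <= t <= 1 -> U (apath t x)) ->
  forall e, 0 < e -> exists2 d : R, 0 < d & forall y, `|y - x| < d ->
    forall t, 0 <= t <= 1 -> `|u (apath t y) - u (apath t x)| <= e.
Proof.
move=> cu Ux e e0.
have /compact_near_coveringP cov := @segment_compact R 0 1.
pose P (y : 'rV[R]_n) (t : R) := `|u (apath t y) - u (apath t x)| <= e.
suff /near_rVP[d d0 H] : \forall y \near nbhs x, `[0, 1]%classic `<=` P y.
  by exists d => // y yd t t01; apply: H => //=; rewrite in_itv.
apply: cov => t; rewrite /= in_itv /= => t01.
have e2 : 0 < e / 2 by lra.
have /near_rVP[r r0 Hr] := (continuous_atP _ _).1 (Cn_continuous cu (Ux t t01)) _ e2.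
have near_path : \forall z \near filter_prod (nbhs t) (nbhs x), `|apath t x - apath z.1 z.2| < r.
  exact: (cvgrPdist_lt _ _).1 (@apath_cvg t x) r r0.
have [[/= A B] [At Bx] AB] := near_path.
exists (A, B) => //= -[t' y] [/= At' By].
have /= H1 := AB (t', y) (conj At' By).
have /= H2 := AB (t', x) (conj At' (nbhs_singleton Bx)).
rewrite distrC in H1; rewrite distrC in H2.
have K1 := Hr _ H1; have K2 := Hr _ H2; rewrite /P.
rewrite -(subrKA (u (apath t x))) (splitr e).
by apply: le_trans (ler_normD _ _) _; rewrite lerD// distrC.
Qed.

Lemma cont01_path U th u x : weight th -> Cn 0 U u -> (forall t, 0 <= t <= 1 -> U (apath t x)) ->
  cont01 (fun t => th t * u (apath t x)).
Proof.
move=> [cth _] cu Ux; apply: cont01P => t t01; apply: continuousM; first exact: cth.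
apply: (@continuous_comp _ _ _ (apath ^~ x) u); last exact: (Cn_continuous cu (Ux t t01)).
have path_t : (fun t' : R => (t', x)) @ nbhs t --> filter_prod (nbhs t) (nbhs x).
  move=> P [[A B] /= [At Bx] AB]; apply: filterS At => t' At'.
  by apply: AB; split => //; exact: nbhs_singleton.
exact: cvg_comp path_t (@apath_cvg t x).
Qed.

(** The mean value theorem turns the increment of each integrand into [pd s u] at a point of a
    nearby path; closeness uniform in t then bounds the integrated error by e |h|. *)
Lemma is_derive_average U U' th u s x : open U' -> U' x -> weight th ->
  (forall t y, 0 <= t <= 1 -> U' y -> U (apath t y)) -> Cn 1 U u ->
  is_derive x (axis s) (average th u) (average (fun t => th t * rate s t) (pd s u) x).
Proof.
move=> oU' U'x wth sub cu; apply/is_deriveP => e e0.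
have wr := weight_rate s wth.
have [_ [K K0 thK]] := wr.
have subx t : 0 <= t <= 1 -> U (apath t x) by move=> t01; exact: sub.
have eK : 0 < e / K by rewrite divr_gt0.
have [d1 d10 H1] := uniformly_near_path (Cn_pd s cu) subx eK.
have [d2 d20 H2] := open_rVP oU' U'x.
exists (Num.min d1 d2); first by rewrite lt_min d10.
move=> h; rewrite lt_min => /andP[hd1 hd2].
have near_h (r : R) : 0 <= r <= 1 -> `|(r * h) *: axis s + x - x| <= `|h|.
  move=> /andP[r0 r1]; rewrite addrK; apply: le_trans (norm_scale_axis _ _) _.
  by rewrite normrM (ger0_norm r0) ler_piMl.
have U'h (r : R) : 0 <= r <= 1 -> U' ((r * h) *: axis s + x).
  by move=> r01; apply: H2; apply: le_lt_trans hd2; exact: near_h.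
have one01 : 0 <= (1 : R) <= 1 by rewrite lexx ler01.
have U'h1 : U' (h *: axis s + x) by have := U'h 1 one01; rewrite mul1r.
have cu0 := CnW cu.
have c1 : cont01 (fun t => th t * u (apath t (h *: axis s + x))).
  by apply: (@cont01_path U) => // t t01; exact: sub.
have c2 : cont01 (fun t => th t * u (apath t x)) by exact: (@cont01_path U).
have c3 : cont01 (fun t => th t * rate s t * pd s u (apath t x)).
  by apply: (@cont01_path U _ (pd s u)) => //; exact: Cn_pd.
rewrite /average -[X in `|_ - X|]/(h * _) -mean01Z// -mean01B// -mean01B//; last exact: cont01Z.
  apply: mean01_le => [|t t01].
    apply: (@cont01D _ _ (fun t => - (h * (th t * rate s t * pd s u (apath t x))))).
      apply: (@cont01D _ _ (fun t => - (th t * u (apath t x)))) => //.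
      by under eq_fun do rewrite -mulN1r; exact: cont01Z.
    by under eq_fun do rewrite -mulN1r; apply: cont01Z; exact: cont01Z.
  rewrite apath_axis.
  have [r /andP[r0 r1] E] : exists2 r : R, 0 < r < 1 &
     u ((h * rate s t) *: axis s + apath t x) - u (apath t x) =
     h * rate s t * pd s u ((r * (h * rate s t)) *: axis s + apath t x).
    apply: MVT_axis => r r01; apply: (Cn_is_derive s cu).
    by rewrite mulrA -apath_axis; apply: sub => //; exact: U'h.
  have r01 : 0 <= r <= 1 by rewrite (ltW r0) (ltW r1).
  have -> : th t * u ((h * rate s t) *: axis s + apath t x) - th t * u (apath t x) -
      h * (th t * rate s t * pd s u (apath t x)) =
      h * ((th t * rate s t) * (pd s u (apath t ((r * h) *: axis s + x)) - pd s u (apath t x))).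
    have -> : apath t ((r * h) *: axis s + x) = (r * (h * rate s t)) *: axis s + apath t x.
      by rewrite apath_axis mulrA.
    by rewrite -mulrBr E; ring.
  rewrite normrM mulrC ler_wpM2r// normrM.
  have -> : e = K * (e / K) by rewrite mulrC divfK// gt_eqF.
  apply: ler_pM => //; first exact: thK.
  by apply: H1 => //; apply: le_lt_trans hd1; exact: near_h.
apply: (@cont01D _ _ (fun t => - (th t * u (apath t x)))) => //.
by under eq_fun do rewrite -mulN1r; exact: cont01Z.
Qed.

Lemma continuous_average U U' th u x : open U' -> U' x -> weight th ->
  (forall t y, 0 <= t <= 1 -> U' y -> U (apath t y)) -> Cn 0 U u ->
  {for x, continuous (average th u)}.
Proof.
move=> oU' U'x wth sub cu; apply/continuous_atP => e e0.
have [_ [K K0 thK]] := wth.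
have subx t : 0 <= t <= 1 -> U (apath t x) by move=> t01; exact: sub.
have eK : 0 < e / K by rewrite divr_gt0.
have [d1 d10 H1] := uniformly_near_path cu subx eK.
have [d2 d20 H2] := open_rVP oU' U'x.
apply/near_rVP; exists (Num.min d1 d2); first by rewrite lt_min d10.
move=> y; rewrite lt_min => /andP[yd1 yd2].
have c1 : cont01 (fun t => th t * u (apath t y)).
  by apply: (@cont01_path U) => // t t01; apply: sub => //; exact: H2.
have c2 : cont01 (fun t => th t * u (apath t x)) by exact: (@cont01_path U).
rewrite distrC /average -mean01B//; apply: mean01_le => [|t t01].
  apply: (@cont01D _ _ (fun t => - (th t * u (apath t x)))) => //.
  by under eq_fun do rewrite -mulN1r; exact: cont01Z.
rewrite -mulrBr normrM.
have -> : e = K * (e / K) by rewrite mulrC divfK// gt_eqF.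
by apply: ler_pM => //; [exact: thK|exact: H1].
Qed.

(** The weight is generalized in the induction, since each derivative along s multiplies it by
    [rate s]. *)
Lemma Cn_average N U U' th u : open U' -> weight th ->
  (forall t y, 0 <= t <= 1 -> U' y -> U (apath t y)) -> Cn N U u ->
  Cn N U' (average th u).
Proof.
move=> oU' + sub; elim: N th u => [|N IH] th u wth cu.
  by apply: Cn0 => x U'x; apply: continuous_average sub cu.
apply: (Cn_succ oU') => [x U'x|s x U'x|s].
- by apply: continuous_average sub (Cn_le _ cu).
- by apply: is_derive_average sub (Cn_le _ cu).
- by apply: IH; [exact: weight_rate|exact: Cn_pd].
Qed.

End AffineAverage.

(** * Elliptic regularity *)

Section EllipticRegularity.
Context {R : realType} {n : nat}.
Implicit Types (U : set 'rV[R]_n) (x y z : 'rV[R]_n) (u v : 'rV[R]_n -> R).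

Lemma cube_convex z (q k t : R) s y : 0 <= t <= 1 -> cube z q y ->
  cube z q (k *: axis s + y) -> cube z q ((t * k) *: axis s + y).
Proof.
rewrite /cube /= => /andP[t0 t1] zy zky.
have -> : (t * k) *: axis s + y - z = t *: (k *: axis s + y - z) + (1 - t) *: (y - z).
  by apply/rowP => i; rewrite !mxE; ring.
apply: le_lt_trans (ler_normD _ _) _; rewrite !normrZ ger0_norm// ger0_norm ?subr_ge0//.
have [->|t_lt1] := eqVneq t 1; first by rewrite mul1r subrr mul0r addr0.
have : (1 - t) * `|y - z| < (1 - t) * q by rewrite ltr_pM2l// subr_gt0 lt_neqAle t_lt1.
have : t * `|k *: axis s + y - z| <= t * q by rewrite ler_wpM2l// ltW.
lra.
Qed.

(** The mean of u over the segment from x to x + e e_s. Each transfer of a property from u to its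
    mean shortens the radius of the cube by e. *)
Definition moll s (e : R) u := average (const_mx 1) 0 (e *: axis s) (fun=> 1) u.

Lemma moll_path s (e t : R) x :
  apath (const_mx 1) 0 (e *: axis s) t x = (t * e) *: axis s + x.
Proof.
apply/rowP => i; rewrite apathE !mxE mulr0 addr0 mul1r addrC mulrA.
by [].
Qed.

Lemma weight1 : weight (fun=> 1 : R).
Proof.
split; first by move=> ?; exact: cst_continuous.
by exists 1 => // t _; rewrite normr1.
Qed.

Lemma mollE s e u x : moll s e u x = mean01 (fun t => u ((t * e) *: axis s + x)).
Proof. by apply: eq_mean01 => t _; rewrite mul1r moll_path. Qed.

Lemma cube_moll z (r e : R) s (t : R) y : 0 < e -> 0 <= t <= 1 -> cube z r y ->
  cube z (r + e) (apath (const_mx 1) 0 (e *: axis s) t y).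
Proof.
move=> e0 /andP[t0 t1]; rewrite moll_path; apply: cube_shift.
by rewrite addrC lerD2l normrM ger0_norm// gtr0_norm// ler_piMl// ltW.
Qed.

Lemma Cn_moll N z (r e : R) s u : 0 < e -> Cn N (cube z (r + e)) u -> Cn N (cube z r) (moll s e u).
Proof.
move=> e0 cu; apply: (Cn_average (@open_cube R n z r) weight1 _ cu).
by move=> t y; exact: cube_moll.
Qed.

Lemma pd_moll z (r e : R) s s' u x : 0 < e -> Cn 1 (cube z (r + e)) u -> cube z r x ->
  pd s' (moll s e u) x = moll s e (pd s' u) x.
Proof.
move=> e0 cu zx; rewrite (is_derive_pd (is_derive_average s' (@open_cube R n z r) zx weight1 _ cu)).
  by apply: eq_mean01 => t _; rewrite /rate !mxE mulr0 addr0 mulr1.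
by move=> t y; exact: cube_moll.
Qed.

Lemma cont01_moll z (r e : R) s u x : 0 < e -> Cn 0 (cube z (r + e)) u -> cube z r x ->
  cont01 (fun t => u ((t * e) *: axis s + x)).
Proof.
move=> e0 cu zx; under eq_fun do rewrite -moll_path -[u _]mul1r.
by apply: (cont01_path weight1 cu) => t t01; exact: cube_moll.
Qed.

(** This is the gain of a derivative: by the fundamental theorem of calculus the right side involves
    u alone and is as regular as u. *)
Lemma pd_moll_same z (r e : R) s u x : 0 < e -> Cn 1 (cube z (r + e)) u -> cube z r x ->
  pd s (moll s e u) x = e^-1 * (u (e *: axis s + x) - u x).
Proof.
move=> e0 cu zx; rewrite (pd_moll s s e0 cu zx) mollE.
have dF (t : R) : 0 <= t <= 1 -> is_derive t (1 : R)
    (fun t => e^-1 * u ((t * e) *: axis s + x)) (pd s u ((t * e) *: axis s + x)).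
  move=> t01; rewrite -[pd s u _](mulKf (lt0r_neq0 e0)).
  apply: is_deriveZ; apply: is_derive_line; apply: (Cn_is_derive s cu).
  by rewrite -moll_path; exact: cube_moll.
rewrite (mean01_derive (cont01_moll (s:=s) e0 (Cn_pd s cu) zx) dF).
by rewrite mul1r mul0r scale0r add0r mulrBr.
Qed.

Definition molls (e : R) (l : seq 'I_n) u := foldr (fun s v => moll s e v) u l.

(** Along the outermost axis the derivative of the mean is a difference quotient; along another axis
    of [l] it commutes with the outer mean, and the induction applies. With all axes in [l] the
    result is C^2. *)
Lemma Cn_molls z (r e : R) l u : 0 < e -> Cn 1 (cube z (r + (size l)%:R * e)) u ->
  Cn 1 (cube z r) (molls e l u) /\ forall s, s \in l -> Cn 1 (cube z r) (pd s (molls e l u)).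
Proof.
move=> e0; elim: l r => [|s0 l IH] r; first by rewrite mul0r addr0.
rewrite -[size _]/((size l).+1) -natr1 mulrDl mul1r [_ * _ + _]addrC addrA => /IH [c1 c2].
split; first exact: Cn_moll.
have oU := @open_cube R n z r.
move=> s; rewrite inE => /orP[/eqP ->|sl].
  pose g y := e^-1 * (molls e l u (e *: axis s0 + y) - molls e l u y).
  apply: (@Cn_ext _ _ _ _ _ g) => //.
    by move=> x zx; rewrite (pd_moll_same s0 e0 c1 zx).
  apply: (CnZ _ oU); apply: CnB => //; last first.
    by apply: Cn_sub c1; apply: cube_sub; rewrite lerDl ltW.
  have E y : e *: axis s0 + y = affm (const_mx 1) (e *: axis s0) y.
    by apply/rowP => i; rewrite !mxE mul1r addrC.
  apply: (@Cn_ext _ _ _ _ _ (molls e l u \o affm (const_mx 1) (e *: axis s0))) => //.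
    by move=> y _; rewrite /= -E.
  apply: (Cn_affm oU _ c1) => y zy.
  by rewrite -E; apply: cube_shift zy; rewrite addrC gtr0_norm.
apply: (@Cn_ext _ _ _ _ _ (moll s0 e (pd s (molls e l u)))) => //.
  by move=> x zx; rewrite (pd_moll s0 s e0 c1 zx).
by apply: Cn_moll => //; exact: c2.
Qed.

Lemma molls_near z (r e W : R) l u x : 0 < e -> Cn 1 (cube z (r + (size l)%:R * e)) u ->
  (forall s t y, 0 <= t <= 1 -> cube z (r + (size l)%:R * e) y ->
     cube z (r + (size l)%:R * e) ((t * e) *: axis s + y) -> `|u ((t * e) *: axis s + y) - u y| <= W) ->
  cube z r x -> `|molls e l u x - u x| <= (size l)%:R * W.
Proof.
move=> e0; elim: l r x => [|s0 l IH] r x; first by move=> *; rewrite /= subrr normr0 mul0r.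
rewrite -[size _]/((size l).+1).
have -> : r + (size l).+1%:R * e = r + e + (size l)%:R * e.
  by rewrite -natr1; ring.
move=> cu uW zx.
have sz0 : 0 <= (size l)%:R * e by rewrite mulr_ge0// ltW.
have sub : cube z r `<=` cube z (r + e + (size l)%:R * e) by apply: cube_sub; lra.
have sub' : cube z (r + e) `<=` cube z (r + e + (size l)%:R * e) by apply: cube_sub; lra.
have [c1 _] := Cn_molls e0 cu.
have cm := cont01_moll (s:=s0) e0 (CnW c1) zx.
rewrite [molls e (s0 :: l) u x](mollE s0 e (molls e l u) x) -(mean01_cst (u x)) -mean01B//; last first.
  by apply: continuous_subspaceT => ?; exact: cst_continuous.
apply: mean01_le => [|t t01].
  apply: (@cont01D _ _ (fun=> - u x)) => //.
  by apply: continuous_subspaceT => ?; exact: cst_continuous.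
have zt : cube z (r + e) ((t * e) *: axis s0 + x) by rewrite -moll_path; exact: cube_moll.
rewrite -(subrKA (u ((t * e) *: axis s0 + x))) -natr1 mulrDl mul1r.
apply: le_trans (ler_normD _ _) (lerD (IH _ _ cu uW zt) _).
by apply: uW => //; [exact: sub|exact: sub'].
Qed.

Variables (I : finType) (J : Type) (coef : J -> I -> 'I_n -> R).
(** A homogeneous first order system with constant coefficients: equations indexed by [J], unknowns
    by [I]. Constant coefficients let it commute with the means. *)
Definition solves U (u : I -> 'rV[R]_n -> R) := forall j x, U x ->
  \sum_i \sum_s coef j i s * pd s (u i) x = 0.

Lemma solves_molls z (r e : R) l (u : I -> 'rV[R]_n -> R) : 0 < e ->
  (forall i, Cn 1 (cube z (r + (size l)%:R * e)) (u i)) ->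
  solves (cube z (r + (size l)%:R * e)) u -> solves (cube z r) (fun i => molls e l (u i)).
Proof.
move=> e0; elim: l r => [|s0 l IH] r; first by rewrite /= mul0r addr0.
rewrite -[size _]/((size l).+1).
have -> : r + (size l).+1%:R * e = r + e + (size l)%:R * e.
  by rewrite -natr1; ring.
move=> cu /(IH _ cu) su j x zx.
have c1 i : Cn 1 (cube z (r + e)) (molls e l (u i)) by have [] := Cn_molls e0 (cu i).
have ct i s := cont01_moll (s:=s0) e0 (Cn_pd s (c1 i)) zx.
transitivity (mean01 (fun t => \sum_i \sum_s coef j i s * pd s (molls e l (u i)) ((t * e) *: axis s0 + x))).
  rewrite mean01_sum => [|i]; last by apply: cont01_sum => s; exact: cont01Z.
  apply: eq_bigr => i _; rewrite mean01_sum => [|s]; last exact: cont01Z.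
  by apply: eq_bigr => s _; rewrite (pd_moll s0 s e0 (c1 i) zx) mollE mean01Z.
rewrite -[RHS](mean01_cst 0); apply: eq_mean01 => t t01; apply: su.
by rewrite -moll_path; exact: cube_moll.
Qed.

(** The first hypothesis says that C^2 solutions are harmonic. Applied to the means along all axes,
    it makes u_i a uniform limit of harmonic functions near every point, as these means differ from
    u_i by at most n h times a bound for its partial derivatives. *)
Theorem elliptic_regularity U (u : I -> 'rV[R]_n -> R) :
  (forall U' (v : I -> 'rV[R]_n -> R), open U' -> (forall i, Cn 2 U' (v i)) -> solves U' v ->
     forall i x, U' x -> lap (v i) x = 0) ->
  open U -> (forall i, Cn 1 U (u i)) -> solves U u -> forall N i, Cn N U (u i).
Proof.
move=> ell oU cu su N i; apply: almost_harmonic_Cn => x Ux.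
have near1 (v : 'rV[R]_n -> R) : Cn 0 U v -> \forall y \near nbhs x, `|v x - v y| <= 1.
  by move=> cv; have /continuous_atP := Cn_continuous cv Ux; exact.
have near_all : \forall y \near nbhs x, forall s, `|pd s (u i) x - pd s (u i) y| <= 1.
  by apply: filter_forall => s; apply: near1; exact: Cn_pd.
have /near_rVP[r1 r10 H1] := near_all.
have /near_rVP[r2 r20 H2] := near1 _ (CnW (cu i)).
have [r3 r30 H3] := open_rVP oU Ux.
pose r := Num.min r1 (Num.min r2 r3).
have r0 : 0 < r by rewrite !lt_min r10 r20.
have sub1 y : cube x r y -> `|y - x| < r1 by move/lt_le_trans; apply; rewrite ge_min lexx.
have sub2 y : cube x r y -> `|y - x| < r2.
  by move/lt_le_trans; apply; rewrite !ge_min lexx orbT.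
have subU : cube x r `<=` U.
  by move=> y yr; apply: H3; apply: lt_le_trans yr _; rewrite !ge_min lexx !orbT.
exists (r / 2), (`|u i x| + 1); split.
- by rewrite divr_gt0.
- by rewrite ltr_wpDl.
- move=> e e0.
  pose B := \sum_s `|pd s (u i) x| + 1.
  have Bs s y : cube x r y -> `|pd s (u i) y| <= B.
    move=> /sub1 /H1 /(_ s); rewrite distrC => Hs.
    rewrite -[pd s (u i) y](subrK (pd s (u i) x)) addrC.
    apply: le_trans (ler_normD _ _) (lerD _ Hs).
    by rewrite (bigD1 s)//= lerDl sumr_ge0.
  have B0 : 0 < B by rewrite ltr_wpDl// sumr_ge0.
  have n0 : (0 : R) < n.+1%:R by rewrite ltr0n.
  (* The bound of n h by r/2 keeps all n segments inside the cube of radius r, the bound by e/B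
     makes the distance n h B at most e, and the divisor n+1 is nonzero also for n = 0. *)
  pose h := Num.min (r / 2) (e / B) / n.+1%:R.
  have m0 : 0 < Num.min (r / 2) (e / B) by rewrite lt_min !divr_gt0.
  have h0 : 0 < h by rewrite divr_gt0.
  have nh : n%:R * h <= Num.min (r / 2) (e / B).
    rewrite /h mulrCA -[X in _ <= X]mulr1 ler_pM2l// ler_pdivrMr// mul1r ler_nat.
    exact: leqnSn.
  move: nh; rewrite le_min => /andP[nh1 nh2].
  pose l := enum 'I_n.
  have sl : (size l)%:R = n%:R :> R by rewrite size_enum_ord.
  have subl : cube x (r / 2 + (size l)%:R * h) `<=` cube x r by apply: cube_sub; rewrite sl; lra.
  have cul j : Cn 1 (cube x (r / 2 + (size l)%:R * h)) (u j).
    by apply: Cn_sub (cu j) => y /subl /subU.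
  have sul : solves (cube x (r / 2 + (size l)%:R * h)) u by move=> j y /subl /subU; exact: su.
  exists (molls h l (u i)).
    have c2 j : Cn 2 (cube x (r / 2)) (molls h l (u j)).
      have [c1 c1'] := Cn_molls h0 (cul j); apply: CnS.
      - by move=> y; exact: (Cn_continuous c1).
      - by move=> s y; exact: (Cn_derivable c1).
      - by move=> s; apply: c1'; rewrite mem_enum.
    split; first exact: c2.
    move=> y xy; apply: (ell _ (fun j => molls h l (u j)) (@open_cube R n x (r / 2))) => //.
    exact: solves_molls.
  move=> y xy; rewrite distrC.
  apply: le_trans (@molls_near x (r / 2) h (h * B) l (u i) y h0 (cul i) _ xy) _.
    move=> s t y' /andP[t0 t1] zy zty.
    have [a /andP[a0 a1] E] : exists2 a : R, 0 < a < 1 &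
        u i ((t * h) *: axis s + y') - u i y' =
        t * h * pd s (u i) ((a * (t * h)) *: axis s + y').
      apply: MVT_axis => a a01; apply: (Cn_is_derive s (cu i)).
      by apply/subU/subl; exact: cube_convex.
    rewrite E normrM; apply: ler_pM => //.
      by rewrite normrM ger0_norm// gtr0_norm// ler_piMl// ltW.
    apply: Bs; apply: subl; apply: cube_convex => //.
    by rewrite (ltW a0) (ltW a1).
  by rewrite sl mulrA -ler_pdivlMr.
- move=> y xy; have xy' : cube x r y by apply: (cubeW xy); lra.
  have := H2 _ (sub2 _ xy'); rewrite distrC => Hy.
  rewrite -[u i y](subrK (u i x)) addrC; apply: le_trans (ler_normD _ _) _.
  by rewrite lerD2l.
Qed.

End EllipticRegularity.

(** * Linear maps, given as bare functions like the left and right multiplications, and their effect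
    on derivatives *)

Section LinearMaps.
Context {R : realType} {d d' : nat} (L : 'rV[R]_d -> 'rV[R]_d').
Hypothesis linL : forall (k : R) a b, L (k *: a + b) = k *: L a + L b.

Lemma lin0 : L 0 = 0.
Proof.
have := linL 1 0 0; rewrite scaler0 addr0 scale1r => /eqP.
by rewrite -subr_eq0 opprD addNKr oppr_eq0 => /eqP.
Qed.

Lemma linD a b : L (a + b) = L a + L b.
Proof. by have := linL 1 a b; rewrite !scale1r. Qed.

Lemma linZ k a : L (k *: a) = k *: L a.
Proof. by have := linL k a 0; rewrite !addr0 lin0 addr0. Qed.

Lemma linB a b : L (a - b) = L a - L b.
Proof. by rewrite -scaleN1r linD linZ scaleN1r. Qed.

Lemma lin_sum (I : Type) (r : seq I) (P : pred I) (g : I -> 'rV[R]_d) :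
  L (\sum_(i <- r | P i) g i) = \sum_(i <- r | P i) L (g i).
Proof.
elim: r => [|i r IH]; first by rewrite !big_nil lin0.
by rewrite !big_cons; case: (P i) => //; rewrite linD IH.
Qed.

Lemma lin_bounded : exists2 K : R, 0 < K & forall a, `|L a| <= K * `|a|.
Proof.
exists (\sum_j `|L (axis j)| + 1); first by rewrite ltr_wpDl// sumr_ge0.
move=> a; rewrite [in X in X <= _](row_sum_delta a) lin_sum mulrDl mul1r -[X in X <= _]addr0.
apply: lerD => //; apply: le_trans (ler_norm_sum _ _ _) _.
rewrite mulr_suml; apply: ler_sum => j _; rewrite linZ normrZ mulrC.
by rewrite ler_wpM2l// coord_le_norm.
Qed.

Context {n : nat}.
Implicit Types (g : 'rV[R]_n -> 'rV[R]_d) (U : set 'rV[R]_n).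

Lemma is_derive_lin g x s dg :
  is_derive x (axis s) g dg -> is_derive x (axis s) (fun y => L (g y)) (L dg).
Proof.
move=> /is_deriveP H; have [K K0 LK] := lin_bounded.
apply/is_deriveP => e e0; have [r r0 Hr] := H _ (divr_gt0 e0 K0).
exists r => // h hr; rewrite -linZ -!linB; apply: le_trans (LK _) _.
by rewrite mulrC -ler_pdivlMr// mulrAC; exact: Hr.
Qed.

Lemma continuous_lin g x : {for x, continuous g} -> {for x, continuous (fun y => L (g y))}.
Proof.
move=> /continuous_atP H; have [K K0 LK] := lin_bounded.
apply/continuous_atP => e e0; apply: (@filterS _ (nbhs x) _ _ _ _ (H _ (divr_gt0 e0 K0))) => y gy.
by rewrite -linB; apply: le_trans (LK _) _; rewrite mulrC -ler_pdivlMr.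
Qed.

Lemma pd_lin N U g s x : Cn N.+1 U g -> U x -> pd s (fun y => L (g y)) x = L (pd s g x).
Proof. by move=> cg Ux; apply: is_derive_pd; apply: is_derive_lin; exact: (Cn_is_derive s cg). Qed.

Lemma Cn_lin N U g : open U -> Cn N U g -> Cn N U (fun y => L (g y)).
Proof.
move=> oU; elim: N g => [|N IH] g cg.
  by apply: Cn0 => x Ux; apply: continuous_lin; exact: (Cn_continuous cg).
apply: (@Cn_succ _ _ _ _ _ _ (fun s y => L (pd s g y))) => //.
- by move=> x Ux; apply: continuous_lin; exact: (Cn_continuous cg).
- by move=> s x Ux; apply: is_derive_lin; exact: (Cn_is_derive s cg).
- by move=> s; apply: IH; exact: Cn_pd.
Qed.

End LinearMaps.

(** * Rules of computation for partial derivatives and the Laplacian *)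

Section PartialRules.
Context {R : realType} {n : nat}.
Implicit Types (V : normedModType R) (U : set 'rV[R]_n).

Lemma pdD V N U (g h : 'rV[R]_n -> V) s x : Cn N.+1 U g -> Cn N.+1 U h -> U x ->
  pd s (fun y => g y + h y) x = pd s g x + pd s h x.
Proof.
move=> cg ch Ux; apply: is_derive_pd.
exact: is_deriveD (Cn_is_derive s cg Ux) (Cn_is_derive s ch Ux).
Qed.

Lemma pdZ V N U (k : R) (g : 'rV[R]_n -> V) s x : Cn N.+1 U g -> U x ->
  pd s (fun y => k *: g y) x = k *: pd s g x.
Proof.
by move=> cg Ux; apply: is_derive_pd; apply: is_deriveZ; exact: (Cn_is_derive s cg).
Qed.

Lemma pd_scale V N U (a : 'rV[R]_n -> R) (g : 'rV[R]_n -> V) s x : Cn N.+1 U a -> Cn N.+1 U g ->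
  U x -> pd s (fun y => a y *: g y) x = a x *: pd s g x + pd s a x *: g x.
Proof.
move=> ca cg Ux; apply: is_derive_pd.
exact: is_derive_scale (Cn_is_derive s ca Ux) (Cn_is_derive s cg Ux).
Qed.

Lemma pd_cst V (c : V) s (x : 'rV[R]_n) : pd s (fun _ : 'rV[R]_n => c) x = 0.
Proof. exact: derive_cst. Qed.

Lemma pd_coord j s (x : 'rV[R]_n) : pd s (fun y : 'rV[R]_n => y 0 j) x = (j == s)%:R.
Proof. apply: is_derive_pd; exact: is_derive_coord. Qed.

Lemma pd_sum V N U (I : Type) (r : seq I) (P : pred I) (g : I -> 'rV[R]_n -> V) s x :
  open U -> (forall i, P i -> Cn N.+1 U (g i)) -> U x ->
  pd s (fun y => \sum_(i <- r | P i) g i y) x = \sum_(i <- r | P i) pd s (g i) x.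
Proof.
move=> oU cg Ux; elim: r => [|i r IH].
  rewrite big_nil -[RHS](pd_cst 0 s x); apply: (pd_ext s oU _ Ux) => y _; by rewrite big_nil.
rewrite big_cons -IH; have [Pi|Pi] := boolP (P i).
  rewrite -(pdD s (cg i Pi) (Cn_sum _ oU cg) Ux).
  by apply: (pd_ext s oU _ Ux) => y _; rewrite big_cons Pi.
by apply: (pd_ext s oU _ Ux) => y _; rewrite big_cons (negbTE Pi).
Qed.

Lemma lap_ext V U (g h : 'rV[R]_n -> V) x : open U -> (forall y, U y -> g y = h y) -> U x ->
  lap g x = lap h x.
Proof.
move=> oU gh Ux; apply: eq_bigr => s _.
by apply: (pd_ext s oU _ Ux) => y Uy; exact: pd_ext s oU gh _ Uy.
Qed.

Lemma lapD V U (g h : 'rV[R]_n -> V) x : open U -> Cn 2 U g -> Cn 2 U h -> U x ->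
  lap (fun y => g y + h y) x = lap g x + lap h x.
Proof.
move=> oU cg ch Ux; rewrite /lap -big_split; apply: eq_bigr => s _ /=.
rewrite -(pdD s (Cn_pd s cg) (Cn_pd s ch) Ux).
by apply: (pd_ext s oU _ Ux) => y Uy; rewrite (pdD s cg ch Uy).
Qed.

Lemma lapZ V U (k : R) (g : 'rV[R]_n -> V) x : open U -> Cn 2 U g -> U x ->
  lap (fun y => k *: g y) x = k *: lap g x.
Proof.
move=> oU cg Ux; rewrite /lap scaler_sumr; apply: eq_bigr => s _.
rewrite -(pdZ k s (Cn_pd s cg) Ux).
by apply: (pd_ext s oU _ Ux) => y Uy; rewrite (pdZ k s cg Uy).
Qed.

Lemma lap_sum V U (I : Type) (r : seq I) (g : I -> 'rV[R]_n -> V) x :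
  open U -> (forall i, Cn 2 U (g i)) -> U x ->
  lap (fun y => \sum_(i <- r) g i y) x = \sum_(i <- r) lap (g i) x.
Proof.
move=> oU cg Ux; rewrite /lap exchange_big; apply: eq_bigr => s _.
rewrite -(pd_sum r s oU (fun i _ => Cn_pd s (cg i)) Ux).
by apply: (pd_ext s oU _ Ux) => y Uy; rewrite (pd_sum r s oU (fun i _ => cg i) Uy).
Qed.

Lemma Cn_coordV N U j : open U -> (forall x, U x -> x 0 j != 0) ->
  Cn N U (fun x => (x 0 j)^-1).
Proof.
move=> oU U0.
have cont x : U x -> {for x, continuous (fun x : 'rV[R]_n => (x 0 j)^-1)}.
  by move=> Ux; apply: continuousV; [exact: U0|exact: coord_continuous].
elim: N => [|N IH]; first exact: Cn0.
apply: (@Cn_succ _ _ _ _ _ _ (fun s x => - ((x 0 j)^-1 *: ((x 0 j)^-1 *: (j == s)%:R)) : R)) => //.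
- move=> s x Ux; have x0 := U0 x Ux.
  have [dc cE] := is_derive_coord s j x.
  have dv : derivable (fun x : 'rV[R]_n => (x 0 j)^-1) x (axis s) by exact: derivableV.
  apply: DeriveDef => //; rewrite (deriveV x0 dc) cE.
  by rewrite -[LHS]/(- (x 0 j) ^- 2 * _) mulNr expr2 invfM -mulrA.
- move=> s; apply: (@Cn_ext _ _ _ _ _ (fun x => - 1 *: ((x 0 j)^-1 *: ((x 0 j)^-1 *: ((j == s)%:R : R))))) => //.
    by move=> x _; rewrite scaleN1r.
  by apply: CnZ => //; apply: Cn_scale => //; apply: Cn_scale => //; exact: Cn_cst.
Qed.

End PartialRules.

(** * Division by r of odd functions *)

Section DivisionByRadius.
Context {R : realType} {p : nat}.
Implicit Types (V : normedModType R) (x y : 'rV[R]_(p.+1 + 1)).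
Local Notation rr := (ridx p).

Definition reflr x := flip rr 0 x.

Lemma reflrE x i : reflr x 0 i = if i == rr then - x 0 i else x 0 i.
Proof. by rewrite flipE mxE mulr0 sub0r; case: eqP => [->|]. Qed.

Lemma xidx_neq (i : 'I_p.+1) : (xidx i == rr) = false.
Proof. by apply/negbTE; rewrite -val_eqE /= addn0 ltn_eqF. Qed.

Lemma idx_split (s : 'I_(p.+1 + 1)) : s = rr \/ exists i, s = xidx i.
Proof.
case: (splitP s) => j sj; first by right; exists j; apply: val_inj.
by left; apply: val_inj; rewrite /= sj (ord1 j).
Qed.

Lemma mkpt_eta x : x = mkpt (lsubmx x) (rcoord x).
Proof.
rewrite -[LHS]hsubmxK /mkpt; congr row_mx; apply/rowP => i.
by rewrite !mxE (ord1 i).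
Qed.

Lemma rcoord_mkpt (xp : 'rV[R]_p.+1) (r : R) : rcoord (mkpt xp r) = r.
Proof. by rewrite /rcoord /mkpt row_mxEr mxE. Qed.

Lemma reflr_mkpt (xp : 'rV[R]_p.+1) (r : R) : reflr (mkpt xp r) = mkpt xp (- r).
Proof.
apply/rowP => s; rewrite reflrE; case: (idx_split s) => [->|[i ->]].
  by rewrite eqxx /mkpt !row_mxEr !mxE.
by rewrite xidx_neq /mkpt !row_mxEl.
Qed.

Lemma reflr_fixed x : rcoord x = 0 -> reflr x = x.
Proof. by move=> x0; rewrite [x]mkpt_eta reflr_mkpt x0 oppr0. Qed.

(* The smooth extension of u / r when u is smooth and odd in r. *)
Definition qdiv V (u : 'rV[R]_(p.+1 + 1) -> V) x : V :=
  if rcoord x == 0 then pd rr u x else (rcoord x)^-1 *: u x.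

Variable D : set 'rV[R]_(p.+1 + 1).
Hypotheses (oD : open D) (symD : forall x, D x -> D (reflr x)).

Definition smooth V (u : 'rV[R]_(p.+1 + 1) -> V) := forall N, Cn N D u.
Definition evenr V (u : 'rV[R]_(p.+1 + 1) -> V) := forall x, D x -> u (reflr x) = u x.
Definition oddr V (u : 'rV[R]_(p.+1 + 1) -> V) := forall x, D x -> u (reflr x) = - u x.

Lemma oddr0 V (u : 'rV[R]_(p.+1 + 1) -> V) x : oddr u -> D x -> rcoord x = 0 -> u x = 0.
Proof.
move=> ou Dx x0; have := ou x Dx; rewrite (reflr_fixed x0) => /eqP.
by rewrite -addr_eq0 -mulr2n -scaler_nat scaler_eq0 pnatr_eq0 /= => /eqP.
Qed.

Lemma pd_reflr V (u : 'rV[R]_(p.+1 + 1) -> V) s x : smooth u -> D x ->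
  pd s (u \o reflr) x = (if s == rr then -1 else 1) *: pd s u (reflr x).
Proof.
by move=> su Dx; rewrite (pd_affm s (su 1%N) (symD Dx)) mxE.
Qed.

Lemma evenr_pd_xidx V (u : 'rV[R]_(p.+1 + 1) -> V) i : smooth u -> evenr u -> evenr (pd (xidx i) u).
Proof.
move=> su eu x Dx; rewrite -(pd_ext (xidx i) oD eu Dx).
by rewrite (pd_reflr _ su Dx) xidx_neq scale1r.
Qed.

Lemma oddr_pd_rr V (u : 'rV[R]_(p.+1 + 1) -> V) : smooth u -> evenr u -> oddr (pd rr u).
Proof.
move=> su eu x Dx; rewrite -(pd_ext rr oD eu Dx).
by rewrite (pd_reflr _ su Dx) eqxx scaleN1r opprK.
Qed.

Lemma qdivK V (u : 'rV[R]_(p.+1 + 1) -> V) x : oddr u -> D x -> u x = rcoord x *: qdiv u x.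
Proof.
move=> ou Dx; rewrite /qdiv; case: eqP => [x0|/eqP x0].
  by rewrite x0 scale0r (oddr0 ou Dx x0).
by rewrite scalerA mulfV// scale1r.
Qed.

(** At r = 0 the value of [qdiv u] is the r-derivative of r w, which is w there; so the value chosen
    on r = 0 is the only one compatible with a C^1 quotient. *)
Lemma qdiv_unique V (u w : 'rV[R]_(p.+1 + 1) -> V) x : Cn 1 D w ->
  (forall y, D y -> u y = rcoord y *: w y) -> D x -> qdiv u x = w x.
Proof.
move=> cw uw Dx; rewrite /qdiv; case: eqP => [x0|/eqP x0]; last first.
  by rewrite uw// scalerA mulVf// scale1r.
rewrite (pd_ext rr oD uw Dx) (pd_scale rr (Cn_coord 1 rr oD) cw Dx) pd_coord eqxx scale1r.
by rewrite [_ 0 _]x0 scale0r add0r.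
Qed.

Lemma evenr_qdiv V (u : 'rV[R]_(p.+1 + 1) -> V) : smooth u -> oddr u -> evenr (qdiv u).
Proof.
move=> su ou x Dx; have [x0|x0] := eqVneq (rcoord x) 0; first by rewrite (reflr_fixed x0).
have rx : rcoord (reflr x) = - rcoord x by rewrite {1}[x]mkpt_eta reflr_mkpt rcoord_mkpt.
rewrite /qdiv rx oppr_eq0 (negbTE x0) ou// invrN scaleNr scalerN opprK.
by [].
Qed.

(** Away from r = 0 this is division by a coordinate. Near r = 0 it is Hadamard's formula: u (x_p,
    r) / r is the mean over t in [0, 1] of (d_r u) (x_p, t r), because the odd function u vanishes
    at r = 0. *)
Lemma smooth_qdiv_scalar (u : 'rV[R]_(p.+1 + 1) -> R) : smooth u -> oddr u -> smooth (qdiv u).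
Proof.
move=> su ou N; apply: Cn_cover => x Dx.
have [x0|x0] := eqVneq (rcoord x) 0; last first.
  pose W := D `&` [set y : 'rV[R]_(p.+1 + 1) | y 0 rr != 0].
  have oW : open W.
    apply: openI => //; apply: (@open_comp _ _ (fun y : 'rV[R]_(p.+1 + 1) => y 0 rr) [set r | r != 0]).
      by move=> ? _; exact: coord_continuous.
    exact: open_neq.
  exists W => //; apply: (@Cn_ext _ _ _ _ _ (fun y => (y 0 rr)^-1 *: u y)) => //.
    by move=> y [_ y0]; rewrite /qdiv [rcoord y]/(y 0 rr) (negbTE y0).
  apply: (Cn_scale oW); first by apply: Cn_coordV => // y [].
  by apply: Cn_sub (su N) => y [].
have [d d0 Hd] := open_rVP oD Dx.
pose W := cube x d; have oW : open W := @open_cube R _ x d.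
have WD : W `<=` D by move=> y /Hd.
(* With this a, the vector [axis rr] as b and c = 0, the path multiplies r by t and fixes x_p; a
   cube centred on r = 0 is stable under it. *)
pose a : 'rV[R]_(p.+1 + 1) := \row_i (i != rr)%:R.
have xr : x 0 rr = 0 by [].
have pathE t y i : apath a (axis rr) 0 t y 0 i = if i == rr then t * y 0 rr else y 0 i.
  rewrite apathE !mxE eqxx /=; case: (altP (i =P rr)) => [->|_] /=; ring.
have pathW (t : R) y : 0 <= t <= 1 -> W y -> W (apath a (axis rr) 0 t y).
  move=> /andP[t0 t1]; apply: le_lt_trans; apply: norm_rV_le => // i.
  rewrite mxE pathE mxE; case: eqP => [->|_]; last first.
    by have := coord_le_norm (y - x) i; rewrite !mxE.
  rewrite xr subr0 normrM ger0_norm//; have := coord_le_norm (y - x) rr.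
  by rewrite !mxE xr subr0; apply: le_trans; rewrite ler_piMl.
have su' : Cn N W (pd rr u) by apply: Cn_sub WD _; apply: Cn_pd; exact: su.
exists W; first by rewrite /W /cube /= subrr normr0.
have w1 : weight (fun=> 1 : R).
  by split; [move=> ?; exact: cst_continuous|exists 1 => // t _; rewrite normr1].
apply: (@Cn_ext _ _ _ _ _ (average a (axis rr) 0 (fun=> 1) (pd rr u))) => //; last first.
  by apply: Cn_average su' => // t y; exact: pathW.
move=> y Wy; rewrite /average /qdiv.
have [y0|y0] := eqVneq (rcoord y) 0.
  rewrite -[RHS]mean01_cst; apply: eq_mean01 => t _; rewrite mul1r; congr pd.
  apply/rowP => i; rewrite pathE; case: eqP => // ->.
  by rewrite [y 0 rr]y0 mulr0.
pose yp := mkpt (lsubmx y) 0.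
have lineE (t : R) : (t * rcoord y) *: axis rr + yp = apath a (axis rr) 0 t y.
  apply/rowP => i; rewrite pathE mxE [in X in X + _]mxE axisE; case: (idx_split i) => [->|[k ->]].
    by rewrite eqxx mulr1 -[yp 0 rr]/(rcoord yp) rcoord_mkpt addr0.
  by rewrite xidx_neq mulr0 add0r row_mxEl mxE.
have dF (t : R) : 0 <= t <= 1 -> is_derive t (1 : R)
    (fun t => (rcoord y)^-1 * u ((t * rcoord y) *: axis rr + yp)) (1 * pd rr u (apath a (axis rr) 0 t y)).
  move=> t01; rewrite mul1r -lineE -[pd rr u _](mulKf y0).
  apply: is_deriveZ; apply: is_derive_line; apply: (Cn_is_derive rr (su 1%N)).
  by rewrite lineE; apply/WD; exact: pathW.
have su0 : Cn 0 W (pd rr u) by apply: Cn_sub WD _; apply: Cn_pd; exact: su.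
have cF : cont01 (fun t => 1 * pd rr u (apath a (axis rr) 0 t y)).
  by apply: (cont01_path w1 su0) => t t01; exact: pathW.
rewrite (mean01_derive cF dF) !lineE.
have -> : apath a (axis rr) 0 1 y = y.
  by apply/rowP => i; rewrite pathE mul1r; case: eqP => [->|].
have z01 : 0 <= (0 : R) <= 1 by rewrite lexx ler01.
rewrite (oddr0 ou (WD _ (pathW 0 y z01 Wy))) ?mulr0 ?subr0//.
by rewrite /rcoord pathE eqxx mul0r.
Qed.

Lemma smooth_qdiv d (u : 'rV[R]_(p.+1 + 1) -> 'rV[R]_d) : smooth u -> oddr u -> smooth (qdiv u).
Proof.
move=> su ou N; apply/(Cn_mxP N _ oD) => j.
have suj : smooth (fun y => u y 0 j) by move=> M; have /(Cn_mxP M u oD) := su M.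
have ouj : oddr (fun y => u y 0 j) by move=> x Dx; rewrite ou// mxE.
apply: Cn_ext (smooth_qdiv_scalar suj ouj N) => // x Dx.
rewrite /qdiv; case: eqP => _; last by rewrite mxE.
by rewrite (pd_mx rr j (su 1%N) Dx).
Qed.

Context {d : nat}.
Implicit Types h w : 'rV[R]_(p.+1 + 1) -> 'rV[R]_d.

Definition evsmooth h := smooth h /\ evenr h.
(** The operator T, that is (1/r) d_r, completed at r = 0 by the value of the second
    r-derivative. *)
Definition rder h := qdiv (pd rr h).

Lemma smooth_pd V (u : 'rV[R]_(p.+1 + 1) -> V) s : smooth u -> smooth (pd s u).
Proof. by move=> su N; apply: Cn_pd; exact: su. Qed.

Lemma evsmooth_pd h i : evsmooth h -> evsmooth (pd (xidx i) h).
Proof. by move=> [sh eh]; split; [exact: smooth_pd|exact: evenr_pd_xidx]. Qed.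

Lemma evsmooth_rder h : evsmooth h -> evsmooth (rder h).
Proof.
move=> [sh eh]; have sp := smooth_pd rr sh; have op := oddr_pd_rr sh eh.
by split; [exact: smooth_qdiv|exact: evenr_qdiv].
Qed.

Lemma pd_rr h x : evsmooth h -> D x -> pd rr h x = rcoord x *: rder h x.
Proof. by move=> [sh eh] Dx; apply: qdivK => //; exact: oddr_pd_rr. Qed.

(** The way [rder] is computed from here on: a smooth w with d_r h = r w settles the points with r =
    0 as well. *)
Lemma rder_unique h w x : smooth w -> (forall y, D y -> pd rr h y = rcoord y *: w y) ->
  D x -> rder h x = w x.
Proof. by move=> sw hw; exact: qdiv_unique (sw 1%N) hw. Qed.

Lemma rder_ext h w x : (forall y, D y -> h y = w y) -> D x -> rder h x = rder w x.
Proof.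
move=> hw Dx; rewrite /rder /qdiv; case: eqP => _; last by rewrite (pd_ext rr oD hw Dx).
by apply: (pd_ext rr oD _ Dx) => y Dy; exact: (pd_ext rr oD hw Dy).
Qed.

Lemma rder_lin (L : 'rV[R]_d -> 'rV[R]_d) h x : (forall (k : R) a b, L (k *: a + b) = k *: L a + L b) ->
  evsmooth h -> D x -> rder (fun y => L (h y)) x = L (rder h x).
Proof.
move=> linL eh; have [st et] := evsmooth_rder eh.
apply: (@rder_unique _ (fun y => L (rder h y))).
  by move=> N; apply: Cn_lin.
by move=> y Dy; rewrite (pd_lin linL rr (eh.1 1%N) Dy) (pd_rr eh Dy) linZ.
Qed.

Lemma evsmooth_lin (L : 'rV[R]_d -> 'rV[R]_d) h : (forall (k : R) a b, L (k *: a + b) = k *: L a + L b) ->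
  evsmooth h -> evsmooth (fun y => L (h y)).
Proof. by move=> linL [sh eh]; split; [move=> N; exact: Cn_lin|move=> x Dx; rewrite eh]. Qed.

End DivisionByRadius.

(** * Composition with (x_p, |x_q|) *)

Section RadialComposition.
Context {R : realType} {p q : nat}.
Implicit Types (V : normedModType R) (y : 'rV[R]_(p.+1 + q)).
Local Notation rr := (ridx p).
Local Notation lix i := (lshift q i : 'I_(p.+1 + q)).
Local Notation rix j := (rshift p.+1 j : 'I_(p.+1 + q)).

Definition sqnorm_q y : R := \sum_j y 0 (rix j) ^+ 2.
(** The Euclidean length is written out because the norm of row vectors is the sup norm. It is not
    differentiable at x_q = 0; compositions with [rho] owe their smoothness to evenness in r. *)
Definition rho y : 'rV[R]_(p.+1 + 1) := mkpt (lsubmx y) (Num.sqrt (sqnorm_q y)).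

Lemma sqnorm_q_ge0 y : 0 <= sqnorm_q y.
Proof. by apply: sumr_ge0 => j _; exact: sqr_ge0. Qed.

Lemma rho_xidx y i : rho y 0 (xidx i) = y 0 (lix i).
Proof. by rewrite row_mxEl mxE. Qed.

Lemma rho_rr y : rho y 0 rr = Num.sqrt (sqnorm_q y).
Proof. by rewrite row_mxEr mxE. Qed.

Lemma rcoord_rho y : rcoord (rho y) = Num.sqrt (sqnorm_q y).
Proof. exact: rcoord_mkpt. Qed.

Lemma rcoord_rho_sqr y : rcoord (rho y) ^+ 2 = sqnorm_q y.
Proof. by rewrite rcoord_rho sqr_sqrtr// sqnorm_q_ge0. Qed.

Lemma rho_row_mx (xp : 'rV[R]_p.+1) (r : R) (w : 'rV[R]_q) : unit_row w -> 0 <= r ->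
  rho (row_mx xp (r *: w)) = mkpt xp r.
Proof.
move=> w1 r0; rewrite /rho row_mxKl; congr mkpt.
have -> : sqnorm_q (row_mx xp (r *: w)) = r ^+ 2.
  rewrite -[RHS]mulr1 -[in RHS]w1 mulr_sumr; apply: eq_bigr => j _.
  by rewrite row_mxEr mxE exprMn.
by rewrite sqrtr_sqr ger0_norm.
Qed.

Lemma lshift_rshift_neq i j : (lix i == rix j) = false.
Proof. by apply/negbTE; rewrite -val_eqE /= ltn_eqF// ltn_addr. Qed.

Lemma rshift_lshift_neq i j : (rix j == lix i) = false.
Proof. by rewrite eq_sym lshift_rshift_neq. Qed.

Lemma rho_lshift (h : R) i y : rho (h *: axis (lix i) + y) = h *: axis (xidx i) + rho y.
Proof.
apply/rowP => s; rewrite [in RHS]mxE [in X in _ = X + _]mxE axisE.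
case: (idx_split s) => [->|[k ->]].
  rewrite eq_sym xidx_neq mulr0 add0r !rho_rr; congr Num.sqrt; apply: eq_bigr => j _.
  by rewrite mxE [in X in X + _]mxE axisE rshift_lshift_neq mulr0 add0r.
by rewrite !rho_xidx mxE [in X in X + _]mxE axisE !(inj_eq (@lshift_inj _ _)).
Qed.

Lemma sqnorm_q_rshift (h : R) j y :
  sqnorm_q (h *: axis (rix j) + y) = sqnorm_q y + 2 * h * y 0 (rix j) + h ^+ 2.
Proof.
rewrite /sqnorm_q (bigD1 j)//= [in RHS](bigD1 j)//=.
rewrite (eq_bigr (fun k => y 0 (rix k) ^+ 2)) => [|k kj].
  by rewrite !mxE !eqxx /=; ring.
by rewrite mxE [in X in X + _]mxE axisE (inj_eq (@rshift_inj _ _)) (negbTE kj) mulr0 add0r.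
Qed.

(** A step along one axis moves [rho] along a single axis of its target, so the derivatives of h o
    rho involve only partial derivatives of h. *)
Lemma rho_rshift (h : R) j y : rho (h *: axis (rix j) + y) =
  (Num.sqrt (sqnorm_q y + 2 * h * y 0 (rix j) + h ^+ 2) - Num.sqrt (sqnorm_q y)) *: axis rr + rho y.
Proof.
apply/rowP => s; rewrite [in RHS]mxE [in X in _ = X + _]mxE axisE.
case: (idx_split s) => [->|[k ->]].
  by rewrite eqxx mulr1 !rho_rr sqnorm_q_rshift subrK.
rewrite xidx_neq mulr0 add0r !rho_xidx mxE [in X in X + _]mxE axisE.
by rewrite lshift_rshift_neq mulr0 add0r.
Qed.

Lemma continuous_rho y : {for y, continuous rho}.
Proof.
apply: continuous_rV => s; case: (idx_split s) => [->|[i ->]].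
  have -> : (fun y => rho y 0 rr) = Num.sqrt \o sqnorm_q by apply: funext => z; rewrite rho_rr.
  apply: continuous_comp; last exact: sqrt_continuous.
  have c j : Cn 0 setT (fun y : 'rV[R]_(p.+1 + q) => y 0 (rix j)) by apply: Cn_coord; exact: openT.
  have : Cn 0 setT sqnorm_q.
    apply: Cn_sum; first exact: openT.
    by move=> j _; exact: (Cn_scale openT (c j) (c j)).
  by move/Cn_continuous; apply.
have -> : (fun y => rho y 0 (xidx i)) = fun y => y 0 (lix i) by apply: funext => z; rewrite rho_xidx.
exact: coord_continuous.
Qed.

Lemma is_derive_of_line V (g : 'rV[R]_(p.+1 + q) -> V) s y l :
  is_derive (0 : R) (1 : R) (fun t => g (t *: axis s + y)) l -> is_derive y (axis s) g l.
Proof.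
move=> /is_deriveP H; apply/is_deriveP => e e0; have [d d0 Hd] := H e e0.
exists d => // h /Hd.
by rewrite -[h *: (1 : R)]/(h * 1) mulr1 addr0 scale0r add0r.
Qed.

Lemma is_derive_comp_line V (phi : R -> V) (psi : R -> R) (t k : R) l :
  is_derive (psi t) (1 : R) phi l -> is_derive t (1 : R) psi k ->
  is_derive t (1 : R) (fun t => phi (psi t)) (k *: l).
Proof.
move=> /is_deriveP H1 /is_deriveP H2; apply/is_deriveP => e e0.
have k0 : 0 < `|k| + 1 by rewrite ltr_wpDl.
have l0 : 0 < `|l| + 1 by rewrite ltr_wpDl.
have e1 : 0 < e / 2 / (`|k| + 1) by rewrite !divr_gt0.
(* The 1 bounds the increment of psi by |h| (|k| + 1); the other term controls its deviation from h
   k. *)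
have e2 : 0 < Num.min 1 (e / 2 / (`|l| + 1)) by rewrite lt_min ltr01 !divr_gt0.
have [d1 d10 Hd1] := H1 _ e1; have [d2 d20 Hd2] := H2 _ e2.
exists (Num.min d2 (d1 / (`|k| + 1))); first by rewrite lt_min d20 divr_gt0.
move=> h; rewrite lt_min ltr_pdivlMr// => /andP[hd2 hd1].
have := Hd2 _ hd2; set a := psi (h *: 1 + t) - psi t => Ha.
have Ha1 : `|a - h *: k| <= `|h|.
  by apply: le_trans Ha _; rewrite ler_piMl// ge_min lexx.
have Ha2 : `|a - h *: k| <= e / 2 / (`|l| + 1) * `|h|.
  by apply: le_trans Ha _; rewrite ler_wpM2r// ge_min lexx orbT.
have ha : `|a| <= `|h| * (`|k| + 1).
  rewrite -[a](subrK (h *: k)) mulrDr mulr1 addrC.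
  by apply: le_trans (ler_normD _ _) _; rewrite lerD// -normrM.
have := Hd1 a (le_lt_trans ha hd1).
rewrite -[a *: (1 : R)]/(a * 1) mulr1 {1}/a subrK => H.
rewrite -(subrKA (a *: l)) [e](splitr e) mulrDl.
apply: le_trans (ler_normD _ _) (lerD _ _).
  apply: le_trans H _; apply: le_trans (ler_wpM2l (ltW e1) ha) _.
  by rewrite mulrCA divfK ?gt_eqF// mulrC.
rewrite scalerA -scalerBl normrZ; apply: le_trans (ler_wpM2r (normr_ge0 _) Ha2) _.
rewrite mulrAC ler_wpM2r// -[X in _ <= X](divfK (lt0r_neq0 l0)) ler_wpM2l//.
  by rewrite !divr_ge0// ltW.
by rewrite lerDl.
Qed.

Variable D : set 'rV[R]_(p.+1 + 1).
Hypotheses (oD : open D) (symD : forall x, D x -> D (reflr x)).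
Let Om : set 'rV[R]_(p.+1 + q) := [set y | D (rho y)].

Lemma open_rho_preimage : open Om.
Proof.
apply: (@open_comp _ _ rho D) => // y _; exact: continuous_rho.
Qed.

(** Every point is x_p + r w with r = |x_q|. At x_q = 0 any unit vector w will do, and 0 < q
    provides one. As a preimage under the continuous [rho], the completion is open. *)
Lemma Omega_rho : (0 < q)%N -> @Omega R p q D = Om.
Proof.
move=> q0; apply/seteqP; split => y.
  by move=> [xp [r [w [Dr r0 w1 ->]]]]; rewrite /Om /= rho_row_mx.
rewrite /Om /= => Dy; pose r := Num.sqrt (sqnorm_q y).
have [s0|s0] := eqVneq (sqnorm_q y) 0.
  exists (lsubmx y), 0, (axis (Ordinal q0)); split.
  - by move: Dy; rewrite /rho s0 sqrtr0.
  - exact: lexx.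
  - rewrite /unit_row (bigD1 (Ordinal q0))//= big1 ?addr0 ?axisE ?eqxx ?expr1n//.
    by move=> j jq; rewrite axisE (negbTE jq) expr0n.
  - rewrite scale0r -[LHS]hsubmxK; congr row_mx; apply/rowP => j; rewrite !mxE.
    have /eqP := s0; rewrite psumr_eq0 => [|k _]; last exact: sqr_ge0.
    by move/allP => /(_ j); rewrite mem_index_enum sqrf_eq0 => /(_ isT)/eqP.
have r0 : r != 0 by rewrite sqrtr_eq0 -ltNge lt_neqAle eq_sym s0 sqnorm_q_ge0.
exists (lsubmx y), r, (r^-1 *: rsubmx y); split => //.
- exact: sqrtr_ge0.
- rewrite /unit_row; under eq_bigr do rewrite !mxE exprMn.
  by rewrite -mulr_sumr exprVn sqr_sqrtr ?sqnorm_q_ge0// mulVf.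
- by rewrite scalerA mulfV// scale1r hsubmxK.
Qed.

Context {d : nat}.
Implicit Types h : 'rV[R]_(p.+1 + 1) -> 'rV[R]_d.

Lemma is_derive_rho_lshift h i y : smooth D h -> Om y ->
  is_derive y (axis (lix i)) (h \o rho) (pd (xidx i) h (rho y)).
Proof.
move=> sh Oy; apply/is_deriveP => e e0.
have /is_deriveP /(_ e e0)[r r0 H] := Cn_is_derive (xidx i) (sh 1%N) Oy.
by exists r => // k /H; rewrite /= rho_lshift.
Qed.

(** For nonzero x_q this is the chain rule: |x_q| has derivative x_j / |x_q|, and d_r h = r (T h).
    At x_q = 0 the root is not differentiable, but along the axis the function is t |-> h (x_p,
    |t|), which evenness turns into t |-> h (x_p, t), and d_r h is 0 at r = 0. *)
Lemma is_derive_rho_rshift h j y : evsmooth D h -> Om y ->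
  is_derive y (axis (rix j)) (h \o rho) (y 0 (rix j) *: rder h (rho y)).
Proof.
move=> eh Oy; have [sh evh] := eh.
have Dh := Cn_is_derive rr (sh 1%N) Oy.
have [s0|s0] := eqVneq (sqnorm_q y) 0.
  have yj : y 0 (rix j) = 0.
    have /eqP := s0; rewrite psumr_eq0 => [|k _]; last exact: sqr_ge0.
    by move/allP => /(_ j); rewrite mem_index_enum sqrf_eq0 => /(_ isT)/eqP.
  have r0 : rcoord (rho y) = 0 by rewrite rcoord_rho s0 sqrtr0.
  rewrite yj scale0r -(scale0r (rder h (rho y))) -r0 -(pd_rr oD symD eh Oy).
  have [r3 r30 H3] := open_rVP oD Oy.
  move/is_deriveP: Dh => Dh; apply/is_deriveP => e e0; have [r4 r40 H4] := Dh e e0.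
  exists (Num.min r3 r4); first by rewrite lt_min r30.
  move=> t; rewrite lt_min => /andP[tr3 /H4].
  rewrite /= rho_rshift s0 yj mulr0 addr0 add0r sqrtr0 subr0 sqrtr_sqr.
  have [t0|t0] := leP 0 t; first by rewrite (ger0_norm t0).
  have Dt : D (t *: axis rr + rho y).
    by apply: H3; rewrite addrK; apply: le_lt_trans (norm_scale_axis _ _) _.
  suff -> : `|t| *: axis rr + rho y = reflr (t *: axis rr + rho y) by rewrite evh.
  rewrite (ltr0_norm t0); apply/rowP => k.
  have addE (a : R) z : (a *: axis rr + z) 0 k = a * (k == rr)%:R + z 0 k.
    by rewrite mxE [in X in X + _]mxE axisE.
  rewrite reflrE !addE; case: (altP (k =P rr)) => [->|_]; last by rewrite !mulr0.
  by rewrite [rho y 0 rr]r0 !mulr1 !addr0.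
have sq0 : 0 < sqnorm_q y by rewrite lt_neqAle eq_sym s0 sqnorm_q_ge0.
set s := Num.sqrt (sqnorm_q y).
have sp : 0 < s by rewrite sqrtr_gt0.
apply: is_derive_of_line.
(* The increment of |x_q| along the axis; the quadratic polynomial under the root has slope 2 x_j at
   t = 0. *)
pose psi (t : R) := Num.sqrt (sqnorm_q y + 2 * t * y 0 (rix j) + t ^+ 2) - s.
have -> : (fun t : R => (h \o rho) (t *: axis (rix j) + y)) =
    (fun t : R => h ((psi t * 1) *: axis rr + rho y)).
  by apply: funext => t; rewrite /= rho_rshift mulr1.
have psi0 : psi 0 = 0 by rewrite /psi !(mulr0, mul0r) expr0n !addr0 subrr.
have -> : y 0 (rix j) *: rder h (rho y) = (y 0 (rix j) / s) *: (1 *: pd rr h (rho y)).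
  by rewrite scale1r (pd_rr oD symD eh Oy) scalerA rcoord_rho divfK// gt_eqF.
apply: (@is_derive_comp_line _ (fun a => h ((a * 1) *: axis rr + rho y)) psi).
  rewrite psi0; apply: is_derive_line; by rewrite mul0r scale0r add0r.
have dpoly : is_derive (0 : R) (1 : R) (fun t : R => sqnorm_q y + 2 * t * y 0 (rix j) + t ^+ 2)
    (2 * y 0 (rix j)).
  apply/is_deriveP => e e0; exists e => // t te.
  have -> : sqnorm_q y + 2 * (t *: 1 + 0) * y 0 (rix j) + (t *: 1 + 0) ^+ 2 -
     (sqnorm_q y + 2 * 0 * y 0 (rix j) + 0 ^+ 2) - t *: (2 * y 0 (rix j)) = t * t.
    by rewrite -[t *: (1 : R)]/(t * 1) -[t *: (2 * _)]/(t * (2 * _)); ring.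
  by rewrite normrM ler_wpM2r// ltW.
have -> : y 0 (rix j) / s = (2 * y 0 (rix j)) *: (2 * s)^-1.
  by rewrite -[RHS]/(2 * _ * _^-1); field; rewrite gt_eqF.
rewrite -[X in is_derive _ _ _ X]subr0; apply: is_deriveB.
apply: (@is_derive_comp_line _ Num.sqrt _ (0 : R) (2 * y 0 (rix j)) (2 * s)^-1 _ dpoly).
rewrite !(mulr0, mul0r) expr0n !addr0.
exact: is_derive1_sqrt.
Qed.

(** The derivatives of h o rho are compositions of the same kind, of d_i h or, times a coordinate,
    of T h, both smooth and even; so the induction never meets a division by |x_q|. *)
Lemma Cn_rho N h : evsmooth D h -> Cn N Om (h \o rho).
Proof.
have oO := open_rho_preimage.
elim: N h => [|N IH] h eh.
  apply: Cn0 => y Oy; apply: continuous_comp; first exact: continuous_rho.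
  exact: (Cn_continuous (eh.1 0%N)).
pose dg (s : 'I_(p.+1 + q)) := match fintype.split s with
  | inl i => pd (xidx i) h \o rho
  | inr j => fun y => y 0 (rix j) *: (rder h \o rho) y
  end.
apply: (@Cn_succ _ _ _ _ _ _ dg) => // [y Oy|s y Oy|s].
- apply: continuous_comp; first exact: continuous_rho.
  exact: (Cn_continuous (eh.1 0%N)).
- rewrite /dg; case: (split_ordP s) => [i ->|j ->].
    exact: is_derive_rho_lshift eh.1 Oy.
  exact: is_derive_rho_rshift.
- rewrite /dg; case: (split_ordP s) => [i _|j _]; first by apply: IH; exact: evsmooth_pd.
  by apply: (Cn_scale oO (Cn_coord N _ oO)); apply: IH; exact: evsmooth_rder.
Qed.

Lemma pd_rho_lshift h i y : smooth D h -> Om y ->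
  pd (lix i) (h \o rho) y = pd (xidx i) h (rho y).
Proof. by move=> sh Oy; apply: is_derive_pd; exact: is_derive_rho_lshift. Qed.

Lemma pd_rho_rshift h j y : evsmooth D h -> Om y ->
  pd (rix j) (h \o rho) y = y 0 (rix j) *: rder h (rho y).
Proof. by move=> sh Oy; apply: is_derive_pd; exact: is_derive_rho_rshift. Qed.

End RadialComposition.

(** * The Cauchy-Riemann system and Laplacians *)

Section CliffordSystem.
Context {R : realType} {d p q : nat}.
Variables (mul : 'rV[R]_d -> 'rV[R]_d -> 'rV[R]_d) (one : 'rV[R]_d) (v : 'I_(p.+1 + q) -> 'rV[R]_d).
Local Notation e0 := (lshift q (ord0 : 'I_p.+1)).
Hypothesis mulr_lin : forall a (k : R) b c, mul a (k *: b + c) = k *: mul a b + mul a c.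
Hypothesis mull_lin : forall (k : R) a b c, mul (k *: a + b) c = k *: mul a c + mul b c.
Hypothesis mul1 : forall a, mul one a = a.
Hypothesis v0 : v e0 = one.
Hypothesis vsq : forall s b, s != e0 -> mul (v s) (mul (v s) b) = - b.
Hypothesis vanti : forall s t b, s != e0 -> t != e0 -> s != t ->
  mul (v s) (mul (v t) b) = - mul (v t) (mul (v s) b).

Let mullL c : forall (k : R) a b, mul (k *: a + b) c = k *: mul a c + mul b c.
Proof. by move=> k a b; exact: mull_lin. Qed.

Lemma algNl a b : mul (- a) b = - mul a b.
Proof. by rewrite -[- a]scaleN1r (linZ (mullL b)) scaleN1r. Qed.

Lemma algNr a b : mul a (- b) = - mul a b.
Proof. by rewrite -[- b]scaleN1r (linZ (mulr_lin a)) scaleN1r. Qed.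

Definition vbar s := if s == e0 then one else - v s.

(** The polarized form of x (xbar b) = |x|^2 b. *)
Lemma v_vbar s t b : mul (v s) (mul (vbar t) b) + mul (v t) (mul (vbar s) b) = (2 * (s == t)%:R) *: b.
Proof.
rewrite /vbar; have [->|s0] := eqVneq s e0; have [->|t0] := eqVneq t e0.
- by rewrite v0 !mul1 ?eqxx mulr1 scalerDl scale1r.
- by rewrite v0 !mul1 algNl addNr ?[e0 == t]eq_sym ?(negbTE t0) mulr0 scale0r.
- by rewrite v0 !mul1 algNl addrN ?(negbTE s0) mulr0 scale0r.
- rewrite !algNl !algNr; have [->|st] := eqVneq s t.
    by rewrite vsq// opprK mulr1 scalerDl scale1r.
  by rewrite vanti// opprK addrN mulr0 scale0r.
Qed.

Lemma vbar_v s t b : mul (vbar s) (mul (v t) b) + mul (vbar t) (mul (v s) b) = (2 * (s == t)%:R) *: b.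
Proof.
rewrite /vbar; have [->|s0] := eqVneq s e0; have [->|t0] := eqVneq t e0.
- by rewrite v0 !mul1 ?eqxx mulr1 scalerDl scale1r.
- by rewrite v0 !mul1 algNl addrN ?[e0 == t]eq_sym ?(negbTE t0) mulr0 scale0r.
- by rewrite v0 !mul1 algNl addNr ?(negbTE s0) mulr0 scale0r.
- rewrite !algNl; have [->|st] := eqVneq s t.
    by rewrite vsq// opprK mulr1 scalerDl scale1r.
  by rewrite vanti// opprK addrN mulr0 scale0r.
Qed.

(** Moving v_i past v_j conjugates it; this is how the operator D, applied to x_q G, becomes x_q
    Dbar G. *)
Lemma v_vq i j b : mul (v (lshift q i)) (mul (v (rshift p.+1 j)) b) =
  mul (v (rshift p.+1 j)) (mul (vbar (lshift q i)) b).
Proof.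
rewrite /vbar; case: eqP => [->|/eqP i0]; first by rewrite v0 !mul1.
by rewrite algNl algNr vanti// ?rshift_lshift_neq ?lshift_rshift_neq.
Qed.

(** Adding the sum to itself with the indices exchanged leaves only the diagonal. It serves twice:
    with second derivatives as S for D Dbar = Dbar D = [lap_p], and with S = x_l x_j (T G) for x_q
    (x_q b) = - r^2 b. *)
Lemma symmetrized_sum (I : finType) (A : I -> I -> 'rV[R]_d -> 'rV[R]_d) (S : I -> I -> 'rV[R]_d) :
  (forall i k b, A i k b + A k i b = (2 * (i == k)%:R) *: b) -> (forall i k, S i k = S k i) ->
  \sum_i \sum_k A i k (S i k) = \sum_i S i i.
Proof.
move=> AE SE; have two : (2 : R) != 0 by rewrite pnatr_eq0.
apply: (scalerI two); rewrite scalerDl scale1r {2}exchange_big -big_split scaler_sumr /=.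
apply: eq_bigr => i _; rewrite -big_split (bigD1 i)//= big1 ?addr0 => [|k ki].
  by rewrite AE eqxx mulr1.
by rewrite (SE k i) AE eq_sym (negbTE ki) mulr0 scale0r.
Qed.

Implicit Types (F G : 'rV[R]_(p.+1 + 1) -> 'rV[R]_d) (U : set 'rV[R]_(p.+1 + 1)).
Local Notation rr := (ridx p).

Definition Dop (c : 'I_p.+1 -> 'rV[R]_d) F x := \sum_i mul (c i) (pd (xidx i) F x).
Let cv i := v (lshift q i).
Let cb i := vbar (lshift q i).

Definition lap_p F x := \sum_i pd (xidx i) (pd (xidx i) F) x.

Lemma Dop_ext c F G U x : open U -> (forall y, U y -> F y = G y) -> U x -> Dop c F x = Dop c G x.
Proof. by move=> oU FG Ux; apply: eq_bigr => i _; rewrite (pd_ext _ oU FG Ux). Qed.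

Lemma Cn_Dop N c F U : open U -> Cn N.+1 U F -> Cn N U (Dop c F).
Proof. by move=> oU cF; apply: Cn_sum => // i _; apply: (Cn_lin (mulr_lin (c i)) oU); exact: Cn_pd. Qed.

Lemma pd_Dop c F U s x : open U -> Cn 2 U F -> U x -> pd s (Dop c F) x = Dop c (pd s F) x.
Proof.
move=> oU cF Ux; rewrite (@pd_sum _ _ _ 0 U)//; last first.
  by move=> i _; apply: (Cn_lin (mulr_lin (c i)) oU); exact: Cn_pd.
apply: eq_bigr => i _; rewrite (pd_lin (mulr_lin (c i)) s (Cn_pd (xidx i) cF) Ux).
by rewrite (Schwarz_rV s (xidx i) oU Ux cF).
Qed.

Lemma DopN c F U x : Cn 1 U F -> U x -> Dop c (fun y => - F y) x = - Dop c F x.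
Proof.
move=> cF Ux; rewrite /Dop -sumrN; apply: eq_bigr => i _.
by rewrite (is_derive_pd (is_deriveN (Cn_is_derive (xidx i) cF Ux))) algNr.
Qed.

Lemma DopD c F G U x : Cn 1 U F -> Cn 1 U G -> U x ->
  Dop c (fun y => F y + G y) x = Dop c F x + Dop c G x.
Proof.
move=> cF cG Ux; rewrite /Dop -big_split; apply: eq_bigr => i _.
by rewrite (pdD _ cF cG Ux) (linD (mulr_lin (c i))).
Qed.

Lemma Dop_scale c (a : 'rV[R]_(p.+1 + 1) -> R) F U x : Cn 1 U a -> Cn 1 U F -> U x ->
  (forall i, pd (xidx i) a x = 0) -> Dop c (fun y => a y *: F y) x = a x *: Dop c F x.
Proof.
move=> ca cF Ux a0; rewrite /Dop scaler_sumr; apply: eq_bigr => i _.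
by rewrite (pd_scale _ ca cF Ux) a0 scale0r addr0 (linZ (mulr_lin (c i))).
Qed.

Lemma Dop_Dbar F U x : open U -> Cn 2 U F -> U x -> Dop cv (Dop cb F) x = lap_p F x.
Proof.
move=> oU cF Ux; rewrite /lap_p.
rewrite -(@symmetrized_sum _ (fun i k b => mul (cv i) (mul (cb k) b)) (fun i k => pd (xidx i) (pd (xidx k) F) x)).
- apply: eq_bigr => i _; rewrite (pd_Dop _ _ oU cF Ux) /Dop (lin_sum (mulr_lin _)).
  by apply: eq_bigr => k _; rewrite (Schwarz_rV (xidx i) (xidx k) oU Ux cF).
- by move=> i k b; rewrite v_vbar (inj_eq (@lshift_inj _ _)).
- by move=> i k; exact: Schwarz_rV oU Ux cF.
Qed.

Lemma Dbar_Dop F U x : open U -> Cn 2 U F -> U x -> Dop cb (Dop cv F) x = lap_p F x.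
Proof.
move=> oU cF Ux; rewrite /lap_p.
rewrite -(@symmetrized_sum _ (fun i k b => mul (cb i) (mul (cv k) b)) (fun i k => pd (xidx i) (pd (xidx k) F) x)).
- apply: eq_bigr => i _; rewrite (pd_Dop _ _ oU cF Ux) /Dop (lin_sum (mulr_lin _)).
  by apply: eq_bigr => k _; rewrite (Schwarz_rV (xidx i) (xidx k) oU Ux cF).
- by move=> i k b; rewrite vbar_v (inj_eq (@lshift_inj _ _)).
- by move=> i k; exact: Schwarz_rV oU Ux cF.
Qed.

Lemma sum_idx (V : zmodType) (g : 'I_(p.+1 + 1) -> V) : \sum_s g s = \sum_i g (xidx i) + g rr.
Proof. by rewrite big_split_ord /= big_ord1. Qed.

(* With D = Dop cv and Dbar = Dop cb the system reads D F1 = d_r F2, Dbar F2 = - d_r F1, and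
   D Dbar = Dbar D = lap_p, so that lap = lap_p + d_r^2 annihilates both components. *)
Lemma slice_regular_harmonic U F1 F2 : open U -> Cn 2 U F1 -> Cn 2 U F2 ->
  (forall x, U x -> Dop cv F1 x - pd rr F2 x = 0) ->
  (forall x, U x -> Dop cb F2 x + pd rr F1 x = 0) ->
  forall x, U x -> lap F1 x = 0 /\ lap F2 x = 0.
Proof.
move=> oU c1 c2 E1 E2 x Ux.
have E1' y : U y -> Dop cv F1 y = pd rr F2 y by move/E1/eqP; rewrite subr_eq0 => /eqP.
have E2' y : U y -> Dop cb F2 y = - pd rr F1 y by move/E2/eqP; rewrite addr_eq0 => /eqP.
have E2'' y : U y -> pd rr F1 y = - Dop cb F2 y by move=> Uy; rewrite E2'// opprK.
split; rewrite /lap sum_idx -/(lap_p _ _).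
  rewrite -(Dbar_Dop oU c1 Ux) (Dop_ext cb oU E1' Ux) -(pd_Dop _ _ oU c2 Ux).
  rewrite (pd_ext rr oU E2' Ux).
  by rewrite (is_derive_pd (is_deriveN (Cn_is_derive rr (Cn_pd rr c1) Ux))) addNr.
rewrite -(Dop_Dbar oU c2 Ux) (Dop_ext cv oU E2' Ux) (DopN _ (Cn_pd rr c1) Ux).
by rewrite -(pd_Dop _ _ oU c1 Ux) (pd_ext rr oU E1' Ux) addNr.
Qed.

Variable D : set 'rV[R]_(p.+1 + 1).
Hypotheses (oD : open D) (symD : forall x, D x -> D (reflr x)).

Lemma evsmooth_Dop c F : evsmooth D F -> evsmooth D (Dop c F).
Proof.
move=> eF; split; first by move=> N; apply: Cn_Dop => //; exact: eF.1.
move=> x Dx; apply: eq_bigr => i _; congr mul.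
exact: (evsmooth_pd oD symD i eF).2.
Qed.

(** [Dop] differentiates in x_p only, so it commutes with d_r and with multiplication by r. *)
Lemma rder_Dop c F x : evsmooth D F -> D x -> rder (Dop c F) x = Dop c (rder F) x.
Proof.
move=> eF; have eT := evsmooth_rder oD symD eF; have eDT := evsmooth_Dop c eT.
apply: (rder_unique oD eDT.1) => y Dy.
rewrite (pd_Dop _ _ oD (eF.1 2%N) Dy) (Dop_ext c oD (fun z => pd_rr oD symD eF) Dy).
rewrite (Dop_scale c (Cn_coord 1 rr oD) (eT.1 1%N) Dy)// => i.
by rewrite pd_coord eq_sym xidx_neq.
Qed.

Lemma Cn_rcoord_sqr N : Cn N D (fun x => rcoord x ^+ 2).
Proof. exact: (Cn_scale oD (Cn_coord N rr oD) (Cn_coord N rr oD)). Qed.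

Lemma pd_rcoord_sqr s x : D x -> pd s (fun x : 'rV[R]_(p.+1 + 1) => rcoord x ^+ 2) x = 2 * rcoord x * (rr == s)%:R.
Proof.
move=> Dx; have c := Cn_coord 1 rr oD.
rewrite (pd_ext s oD (h := fun y => y 0 rr *: y 0 rr) _ Dx) => [|y _]; last by rewrite expr2.
rewrite (pd_scale s c c Dx) pd_coord -[_ *: _]/(_ * _) -[X in _ + X]/(_ * _) -/(rcoord x).
by ring.
Qed.

(* The relation satisfied by (T^k F1, T^k (F2/r)) for a = 2k+1, where T = rder. *)
Definition slice_pair (a : R) F G := [/\ evsmooth D F, evsmooth D G,
  forall x, D x -> Dop cv F x = a *: G x + rcoord x ^+ 2 *: rder G x &
  forall x, D x -> Dop cb G x = - rder F x].

(** The r-derivative of a G + r^2 (T G) is a r (T G) + 2 r (T G) + r^3 (T T G); division by r yields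
    the coefficient a + 2. *)
Lemma slice_pair_rder a F G : slice_pair a F G -> slice_pair (a + 2) (rder F) (rder G).
Proof.
move=> [eF eG E1 E2].
have eTF := evsmooth_rder oD symD eF; have eTG := evsmooth_rder oD symD eG.
have eTTG := evsmooth_rder oD symD eTG.
split; [exact: eTF|exact: eTG|move=> x Dx|move=> x Dx].
  rewrite -(rder_Dop _ eF Dx).
  apply: (rder_unique oD (w := fun x => (a + 2) *: rder G x + rcoord x ^+ 2 *: rder (rder G) x) _ _ Dx).
    move=> N; apply: CnD => //; first by apply: CnZ => //; exact: eTG.1.
    by apply: Cn_scale => //; [exact: Cn_rcoord_sqr|exact: eTTG.1].
  move=> y Dy; rewrite (pd_ext rr oD E1 Dy).
  have c1 : Cn 1 D (fun x => a *: G x) by apply: CnZ => //; exact: eG.1.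
  have c2 : Cn 1 D (fun x => rcoord x ^+ 2 *: rder G x).
    by apply: Cn_scale => //; [exact: Cn_rcoord_sqr|exact: eTG.1].
  rewrite (pdD rr c1 c2 Dy) (pdZ a rr (eG.1 1%N) Dy) (pd_scale rr (Cn_rcoord_sqr 1) (eTG.1 1%N) Dy).
  rewrite (pd_rr oD symD eG Dy) (pd_rr oD symD eTG Dy) (pd_rcoord_sqr _ Dy) eqxx mulr1.
  rewrite scalerDr !scalerA addrA addrAC -scalerDl; congr (_ *: _ + _ *: _); ring.
rewrite -(rder_Dop _ eG Dx) (rder_ext oD E2 Dx).
by rewrite (rder_lin oD symD (L := fun b => - b))// => k a' b; rewrite opprD scalerN.
Qed.

(** Dbar applied to the first relation and D to the second, both evaluated with the relations for
    the pair and for its image under T; the latter brings in a + 2 for G. *)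
Lemma slice_pair_lap_p a F G x : slice_pair a F G -> D x ->
  lap_p F x = - (a *: rder F x + rcoord x ^+ 2 *: rder (rder F) x) /\
  lap_p G x = - ((a + 2) *: rder G x + rcoord x ^+ 2 *: rder (rder G) x).
Proof.
move=> P Dx; have [eF eG E1 E2] := P; have [eTF eTG E1' E2'] := slice_pair_rder P.
split; last first.
  rewrite -(Dop_Dbar oD (eG.1 2%N) Dx) (Dop_ext cv oD E2 Dx).
  by rewrite (DopN _ (eTF.1 1%N) Dx) E1'.
rewrite -(Dbar_Dop oD (eF.1 2%N) Dx) (Dop_ext cb oD E1 Dx).
have c1 : Cn 1 D (fun x => a *: G x) by apply: CnZ => //; exact: eG.1.
have c2 : Cn 1 D (fun x => rcoord x ^+ 2 *: rder G x).
  by apply: Cn_scale => //; [exact: Cn_rcoord_sqr|exact: eTG.1].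
rewrite (DopD _ c1 c2 Dx) (Dop_scale (a := fun=> a) _ (Cn_cst _ _ _) (eG.1 1%N) Dx); last first.
  by move=> i; rewrite pd_cst.
rewrite (Dop_scale _ (Cn_rcoord_sqr 1) (eTG.1 1%N) Dx); last first.
  by move=> i; rewrite (pd_rcoord_sqr _ Dx) eq_sym xidx_neq mulr0.
by rewrite E2// E2'// !scalerN opprD.
Qed.


Local Notation lix i := (lshift q i : 'I_(p.+1 + q)).
Local Notation rix j := (rshift p.+1 j : 'I_(p.+1 + q)).
Implicit Types (h : 'rV[R]_(p.+1 + 1) -> 'rV[R]_d) (y : 'rV[R]_(p.+1 + q)).
Let Om : set 'rV[R]_(p.+1 + q) := [set y | D (rho y)].
Let oO : open Om := open_rho_preimage oD.
Let coord N j : Cn N Om (fun y : 'rV[R]_(p.+1 + q) => y 0 j) := Cn_coord N j oO.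

(** The j-th second derivative is T h + x_j^2 (T T h). The radial part q T + r^2 T T is d_r^2 +
    ((q-1)/r) d_r written without division. *)
Lemma lap_rho h y : evsmooth D h -> Om y -> lap (h \o rho) y =
  lap_p h (rho y) + q%:R *: rder h (rho y) + rcoord (rho y) ^+ 2 *: rder (rder h) (rho y).
Proof.
move=> eh Oy; have eT := evsmooth_rder oD symD eh.
have E1 : \sum_i pd (lix i) (pd (lix i) (h \o rho)) y = lap_p h (rho y).
  apply: eq_bigr => i _; rewrite (pd_ext (lix i) oO (fun z => pd_rho_lshift i eh.1) Oy).
  by rewrite (pd_rho_lshift i (smooth_pd (xidx i) eh.1) Oy).
have E2 j : pd (rix j) (pd (rix j) (h \o rho)) y =
    rder h (rho y) + y 0 (rix j) ^+ 2 *: rder (rder h) (rho y).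
  rewrite (pd_ext (rix j) oO (fun z => pd_rho_rshift oD symD j eh) Oy).
  rewrite (pd_scale (rix j) (coord 1 (rix j)) (Cn_rho oD symD 1 eT) Oy) pd_coord eqxx scale1r.
  by rewrite (pd_rho_rshift oD symD j eT Oy) scalerA addrC expr2.
rewrite /lap big_split_ord /= E1 (eq_bigr _ (fun j _ => E2 j)) big_split sumr_const card_ord /=.
by rewrite -scaler_suml rcoord_rho_sqr -scaler_nat addrA.
Qed.

(** The coordinate x_j is harmonic, so the only new term is twice the j-th derivative of h o rho,
    that is 2 x_j (T h); hence q + 2 in place of q. *)
Lemma lap_coord_rho h j y : evsmooth D h -> Om y -> lap (fun y => y 0 (rix j) *: (h \o rho) y) y =
  y 0 (rix j) *: (lap_p h (rho y) + (q%:R + 2) *: rder h (rho y) + rcoord (rho y) ^+ 2 *: rder (rder h) (rho y)).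
Proof.
move=> eh Oy; have eT := evsmooth_rder oD symD eh.
pose g y := y 0 (rix j) *: (h \o rho) y.
have ch : Cn 2 Om (h \o rho) := Cn_rho oD symD 2 eh.
have cT : Cn 2 Om (rder h \o rho) := Cn_rho oD symD 2 eT.
have El i z : Om z -> pd (lix i) g z = z 0 (rix j) *: (pd (xidx i) h \o rho) z.
  move=> Oz; rewrite /g (pd_scale (lix i) (coord 2 (rix j)) ch Oz) pd_coord rshift_lshift_neq.
  by rewrite scale0r addr0 (pd_rho_lshift i eh.1 Oz).
have Er l z : Om z -> pd (rix l) g z =
    z 0 (rix j) *: (z 0 (rix l) *: (rder h \o rho) z) + (j == l)%:R *: (h \o rho) z.
  move=> Oz; rewrite /g (pd_scale (rix l) (coord 2 (rix j)) ch Oz) pd_coord.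
  by rewrite (inj_eq (@rshift_inj _ _)) (pd_rho_rshift oD symD l eh Oz).
rewrite -/g /lap big_split_ord /=.
have -> : \sum_i pd (lix i) (pd (lix i) g) y = y 0 (rix j) *: lap_p h (rho y).
  rewrite /lap_p scaler_sumr; apply: eq_bigr => i _.
  rewrite (pd_ext (lix i) oO (El i) Oy).
  have cp : Cn 1 Om (pd (xidx i) h \o rho) := Cn_rho oD symD 1 (evsmooth_pd oD symD i eh).
  rewrite (pd_scale (lix i) (coord 1 (rix j)) cp Oy) pd_coord rshift_lshift_neq scale0r addr0.
  by rewrite (pd_rho_lshift i (smooth_pd (xidx i) eh.1) Oy).
rewrite !scalerDr -!addrA; congr (_ + _).
have second l : pd (rix l) (pd (rix l) g) y = y 0 (rix j) *: rder h (rho y) +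
    (y 0 (rix l) ^+ 2 *: (y 0 (rix j) *: rder (rder h) (rho y)) +
    ((j == l)%:R * 2) *: (y 0 (rix l) *: rder h (rho y))).
  rewrite (pd_ext (rix l) oO (Er l) Oy).
  have c1 : Cn 1 Om (fun z => z 0 (rix l) *: (rder h \o rho) z).
    by apply: (Cn_scale oO (coord 1 _)); exact: (CnW cT).
  have c2 : Cn 1 Om (fun z => z 0 (rix j) *: (z 0 (rix l) *: (rder h \o rho) z)).
    exact: (Cn_scale oO (coord 1 _) c1).
  have c3 : Cn 1 Om (fun z => (j == l)%:R *: (h \o rho) z).
    exact: (CnZ _ oO (CnW ch)).
  rewrite (pdD (rix l) c2 c3 Oy) (pd_scale (rix l) (coord 1 (rix j)) c1 Oy).
  rewrite (pd_scale (rix l) (coord 1 (rix l)) (CnW cT) Oy) (pdZ _ (rix l) (CnW ch) Oy).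
  rewrite !pd_coord eqxx (inj_eq (@rshift_inj _ _)) scale1r.
  rewrite (pd_rho_rshift oD symD l eT Oy) (pd_rho_rshift oD symD l eh Oy) /=.
  move: (rder (rder h) _) (rder h _) (y 0 _) (y 0 _) (j == l)%:R => B A a b c; clear.
  by apply/rowP => k; rewrite !mxE; ring.
have delta (B : 'rV[R]_d) : \sum_l ((j == l)%:R * 2) *: (y 0 (rix l) *: B) = 2 *: (y 0 (rix j) *: B).
  rewrite (bigD1 j)//= big1 ?addr0 => [|l lj]; first by rewrite eqxx mul1r.
  by rewrite eq_sym (negbTE lj) mul0r scale0r.
have sumE (A B : 'rV[R]_d) : \sum_l (y 0 (rix j) *: A + (y 0 (rix l) ^+ 2 *: (y 0 (rix j) *: B) +
      ((j == l)%:R * 2) *: (y 0 (rix l) *: A))) =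
    y 0 (rix j) *: ((q%:R + 2) *: A) + y 0 (rix j) *: (sqnorm_q y *: B).
  rewrite !big_split sumr_const card_ord /= delta -scaler_suml -/(sqnorm_q y) -scaler_nat.
  move: (y 0 _) (sqnorm_q y) => a b; clear.
  by apply/rowP => k; rewrite !mxE; ring.
by rewrite (eq_bigr _ (fun l _ => second l)) sumE rcoord_rho_sqr.
Qed.

Let vq j := v (rix j).
(** F o rho + x_q (G o rho): with F2 = r G the product of the unit vector and F2 becomes x_q G,
    which makes sense at x_q = 0 without a choice of direction. *)
Definition slice F G y := F (rho y) + \sum_j y 0 (rix j) *: mul (vq j) (G (rho y)).

Let evG G j : evsmooth D G -> evsmooth D (fun x => mul (vq j) (G x)).
Proof. exact: evsmooth_lin. Qed.

Let Cn_term N G j : evsmooth D G -> Cn N Om (fun y => y 0 (rix j) *: ((fun x => mul (vq j) (G x)) \o rho) y).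
Proof.
move=> eG; apply: (Cn_scale oO (coord N _)).
exact: (@Cn_rho R p q D oD symD d N (fun x => mul (vq j) (G x)) (evG j eG)).
Qed.

Lemma Cn_slice N F G : evsmooth D F -> evsmooth D G -> Cn N Om (slice F G).
Proof.
move=> eF eG; apply: CnD => //; first exact: Cn_rho.
by apply: Cn_sum => // j _; exact: Cn_term.
Qed.

(** Both parts get the same factor: q - a for F, and (q + 2) - (a + 2) for the part with G; the
    terms r^2 (T T) cancel against those of [lap_p]. *)
Lemma lap_slice a F G y : slice_pair a F G -> Om y ->
  lap (slice F G) y = (q%:R - a) *: slice (rder F) (rder G) y.
Proof.
move=> P Oy; have [eF eG E1 E2] := P.
have [lF lG] := slice_pair_lap_p P Oy.
rewrite (lapD oO (Cn_rho oD symD 2 eF) (Cn_sum _ oO (fun j _ => Cn_term 2 j eG)) Oy).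
rewrite (lap_sum _ oO (fun j => Cn_term 2 j eG) Oy) (lap_rho eF Oy) lF /slice scalerDr; congr (_ + _).
  move: (rder (rder F) _) (rder F _) (rcoord _) => A B r; clear.
  by apply/rowP => k; rewrite !mxE; ring.
rewrite scaler_sumr; apply: eq_bigr => j _; rewrite (lap_coord_rho j (evG j eG) Oy).
have linj := mulr_lin (vq j).
have eT := evsmooth_rder oD symD eG.
have T1 x : D x -> rder (fun x => mul (vq j) (G x)) x = mul (vq j) (rder G x).
  by move=> Dx; rewrite (rder_lin oD symD linj eG Dx).
rewrite (rder_ext oD T1 Oy) (rder_lin oD symD linj eT Oy) (T1 _ Oy).
have -> : lap_p (fun x => mul (vq j) (G x)) (rho y) = mul (vq j) (lap_p G (rho y)).
  rewrite /lap_p (lin_sum linj); apply: eq_bigr => i _.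
  rewrite -(pd_lin linj (xidx i) (smooth_pd (xidx i) eG.1 1%N) Oy).
  by apply: (pd_ext (xidx i) oD _ Oy) => x Dx; exact: (pd_lin linj (xidx i) (eG.1 1%N) Dx).
rewrite lG -[- _]scaleN1r (linZ linj) (linD linj) !(linZ linj).
move: (mul _ _) (mul _ _) (rcoord _) (y 0 _) => A B r b; clear.
by apply/rowP => k; rewrite !mxE; ring.
Qed.

(** The x_p part of the operator yields D F + x_q (Dbar G), the x_q part x_q (T F) - r^2 (T G) - q
    G. The two relations of the pair cancel this exactly when a = q. *)
Lemma dirac_slice F G y : slice_pair q%:R F G -> Om y -> Defs.dirac mul v (slice F G) y = 0.
Proof.
move=> [eF eG E1 E2] Oy.
have eTG := evsmooth_rder oD symD eG.
have cF : Cn 1 Om (F \o rho) := Cn_rho oD symD 1 eF.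
have cS : Cn 1 Om (fun y => \sum_j y 0 (rix j) *: ((fun x => mul (vq j) (G x)) \o rho) y).
  by apply: (Cn_sum _ oO) => j _; exact: Cn_term.
have split_pd s : pd s (slice F G) y = pd s (F \o rho) y +
    \sum_j (y 0 (rix j) *: mul (vq j) (pd s (G \o rho) y) + (rix j == s)%:R *: mul (vq j) (G (rho y))).
  rewrite (pdD s cF cS Oy); congr (_ + _).
  rewrite (pd_sum _ s oO (fun j _ => Cn_term 1 j eG) Oy); apply: eq_bigr => j _.
  rewrite (pd_scale s (coord 1 (rix j)) (Cn_rho oD symD 1 (evG j eG)) Oy) pd_coord.
  by rewrite (pd_lin (mulr_lin (vq j)) s (Cn_rho oD symD 1 eG) Oy).
have lin s := mulr_lin (v s).
rewrite /Defs.dirac big_split_ord /=.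
have -> : \sum_i mul (v (lix i)) (pd (lix i) (slice F G) y) =
    Dop cv F (rho y) + \sum_j y 0 (rix j) *: mul (vq j) (Dop cb G (rho y)).
  rewrite (eq_bigr (fun i => mul (cv i) (pd (xidx i) F (rho y)) +
      \sum_j y 0 (rix j) *: mul (vq j) (mul (cb i) (pd (xidx i) G (rho y))))) => [|i _].
    rewrite big_split; congr (_ + _); rewrite exchange_big; apply: eq_bigr => j _.
    by rewrite -scaler_sumr -(lin_sum (lin _)).
  rewrite split_pd (linD (lin _)) (pd_rho_lshift i eF.1 Oy); congr (_ + _).
  rewrite (lin_sum (lin _)); apply: eq_bigr => j _.
  by rewrite rshift_lshift_neq scale0r addr0 (linZ (lin _)) (pd_rho_lshift i eG.1 Oy) v_vq.
(* Two nested multiplications by x_q amount to - r^2; on these indices [vbar] is - v, so the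
   polarized identity applies. *)
have sphere : \sum_l \sum_j mul (vq l) (mul (vq j) ((y 0 (rix l) * y 0 (rix j)) *: rder G (rho y))) =
    - (rcoord (rho y) ^+ 2 *: rder G (rho y)).
  apply: (canRL opprK); rewrite -sumrN.
  rewrite (eq_bigr (fun l => \sum_j mul (vq l) (mul (vbar (rix j)) ((y 0 (rix l) * y 0 (rix j)) *: rder G (rho y))))) => [|l _].
    rewrite (@symmetrized_sum _ (fun l j b => mul (vq l) (mul (vbar (rix j)) b))
      (fun l j => (y 0 (rix l) * y 0 (rix j)) *: rder G (rho y))).
    - by rewrite -scaler_suml rcoord_rho_sqr.
    - by move=> l j b; rewrite v_vbar (inj_eq (@rshift_inj _ _)).
    - by move=> l j; rewrite mulrC.
  by rewrite -sumrN; apply: eq_bigr => j _; rewrite /vbar rshift_lshift_neq algNl algNr.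
have -> : \sum_l mul (v (rix l)) (pd (rix l) (slice F G) y) =
    \sum_l y 0 (rix l) *: mul (vq l) (rder F (rho y)) - rcoord (rho y) ^+ 2 *: rder G (rho y)
    - q%:R *: G (rho y).
  rewrite (eq_bigr (fun l => y 0 (rix l) *: mul (vq l) (rder F (rho y)) +
      \sum_j mul (vq l) (mul (vq j) ((y 0 (rix l) * y 0 (rix j)) *: rder G (rho y))) - G (rho y))) => [|l _].
    by rewrite !big_split sumr_const card_ord /= sphere mulNrn -scaler_nat.
  rewrite split_pd (linD (lin _)) (pd_rho_rshift oD symD l eF Oy) (linZ (lin _)) -addrA; congr (_ + _).
  rewrite big_split (linD (lin _)) !(lin_sum (lin _)); congr (_ + _).
    apply: eq_bigr => j _; rewrite (pd_rho_rshift oD symD l eG Oy) mulrC -scalerA.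
    by rewrite !(linZ (lin _)).
  rewrite (bigD1 l)//= big1 ?addr0 => [|j jl].
    by rewrite eqxx scale1r vsq// rshift_lshift_neq.
  by rewrite (inj_eq (@rshift_inj _ _)) (negbTE jl) scale0r (lin0 (lin _)).
rewrite (E1 _ Oy) (E2 _ Oy).
under eq_bigr => j _ do rewrite algNr scalerN.
rewrite sumrN; move: (G _) (rder G _) (\sum_j _) (rcoord _ ^+ 2) => A B S r; clear.
by apply/rowP => k; rewrite !mxE; ring.
Qed.

Lemma slice_pair_iter F G j : slice_pair 1 F G ->
  slice_pair (1 + 2 * j%:R) (iter j (@rder R p d) F) (iter j (@rder R p d) G).
Proof.
move=> P; elim: j => [|j IH]; first by rewrite mulr0 addr0.
have -> : 1 + 2 * j.+1%:R = 1 + 2 * j%:R + 2 :> R by rewrite -natr1; ring.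
exact: slice_pair_rder.
Qed.

(** Step i contributes the factor q - (1 + 2 i). Agreement of f with the slice function on an open
    set suffices to carry it through the Laplacians. *)
Lemma iter_lap_slice F G f j y : slice_pair 1 F G -> (forall z, Om z -> f z = slice F G z) -> Om y ->
  iter j (@lap R (p.+1 + q) _) f y = (\prod_(i < j) (q%:R - (1 + 2 * i%:R))) *:
    slice (iter j (@rder R p d) F) (iter j (@rder R p d) G) y.
Proof.
move=> P fE; elim: j y => [|j IH] y Oy; first by rewrite big_ord0 scale1r /= fE.
have Pj := slice_pair_iter j P; have [eF eG _ _] := Pj.
rewrite iterS (lap_ext oO IH Oy) (lapZ _ oO (Cn_slice 2 eF eG) Oy) (lap_slice Pj Oy).
by rewrite scalerA big_ord_recr.
Qed.

End CliffordSystem.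

(** * The system in real components, and smoothness of its C^1 solutions *)

Section SliceRegularity.
Context {R : realType} {d p q : nat}.
Variables (mul : 'rV[R]_d -> 'rV[R]_d -> 'rV[R]_d) (one : 'rV[R]_d) (v : 'I_(p.+1 + q) -> 'rV[R]_d).
Local Notation e0 := (lshift q (ord0 : 'I_p.+1)).
Hypothesis mulr_lin : forall a (k : R) b c, mul a (k *: b + c) = k *: mul a b + mul a c.
Hypothesis mull_lin : forall (k : R) a b c, mul (k *: a + b) c = k *: mul a c + mul b c.
Hypothesis mul1 : forall a, mul one a = a.
Hypothesis v0 : v e0 = one.
Hypothesis vsq : forall s b, s != e0 -> mul (v s) (mul (v s) b) = - b.
Hypothesis vanti : forall s t b, s != e0 -> t != e0 -> s != t ->
  mul (v s) (mul (v t) b) = - mul (v t) (mul (v s) b).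
Local Notation rr := (ridx p).
Let cv i := v (lshift q i).
Let cb i := vbar one v (lshift q i).
Implicit Types (F : 'rV[R]_(p.+1 + 1) -> 'rV[R]_d) (U : set 'rV[R]_(p.+1 + 1)).

Definition pair_component F1 F2 (i : 'I_d + 'I_d) : 'rV[R]_(p.+1 + 1) -> R :=
  match i with inl a => fun x => F1 x 0 a | inr a => fun x => F2 x 0 a end.

Definition idx_case (A : Type) (f : 'I_p.+1 -> A) (a : A) (s : 'I_(p.+1 + 1)) : A :=
  match fintype.split s with inl i => f i | inr _ => a end.

(** The real coefficients of the system: left [inl c] is component c of the equation D F1 - d_r F2 =
    0, left [inr c] that of Dbar F2 + d_r F1 = 0; left multiplications enter through their
    matrices. *)
Definition slice_coef (j i : 'I_d + 'I_d) (s : 'I_(p.+1 + 1)) : R :=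
  match j, i with
  | inl c, inl a => idx_case (fun k => mul (cv k) (axis a) 0 c) 0 s
  | inl c, inr a => idx_case (fun=> 0) (- (a == c)%:R) s
  | inr c, inl a => idx_case (fun=> 0) (a == c)%:R s
  | inr c, inr a => idx_case (fun k => mul (cb k) (axis a) 0 c) 0 s
  end.

Lemma idx_case_xidx (A : Type) (f : 'I_p.+1 -> A) a i : idx_case f a (xidx i) = f i.
Proof. by rewrite /idx_case (unsplitK (inl i : 'I_p.+1 + 'I_1)). Qed.

Lemma idx_case_rr (A : Type) (f : 'I_p.+1 -> A) a : idx_case f a rr = a.
Proof. by rewrite /idx_case (unsplitK (inr ord0 : 'I_p.+1 + 'I_1)). Qed.

Lemma Dop_component c F x k :
  Dop mul c F x 0 k = \sum_a \sum_i mul (c i) (axis a) 0 k * pd (xidx i) F x 0 a.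
Proof.
rewrite /Dop summxE exchange_big; apply: eq_bigr => i _.
rewrite [pd _ F x in LHS]row_sum_delta (lin_sum (mulr_lin _)) summxE; apply: eq_bigr => a _.
by rewrite (linZ (mulr_lin _)) mxE mulrC.
Qed.

Lemma delta_sum (w : 'rV[R]_d) (k : 'I_d) : \sum_a (a == k)%:R * w 0 a = w 0 k.
Proof.
rewrite (bigD1 k)//= eqxx mul1r big1 ?addr0// => a /negbTE ->.
by rewrite mul0r.
Qed.

Lemma slice_coef_sum U F1 F2 j x : Cn 1 U F1 -> Cn 1 U F2 -> U x ->
  \sum_i \sum_s slice_coef j i s * pd s (pair_component F1 F2 i) x =
  match j with
  | inl c => (Dop mul cv F1 x - pd rr F2 x) 0 c
  | inr c => (Dop mul cb F2 x + pd rr F1 x) 0 c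
  end.
Proof.
move=> c1 c2 Ux.
have pd1 a s : pd s (fun x => F1 x 0 a) x = pd s F1 x 0 a by rewrite (pd_mx s a c1 Ux).
have pd2 a s : pd s (fun x => F2 x 0 a) x = pd s F2 x 0 a by rewrite (pd_mx s a c2 Ux).
rewrite big_sumType /=; case: j => c /=.
  rewrite !mxE Dop_component -[pd rr F2 x 0 c]delta_sum -sumrN; congr (_ + _); apply: eq_bigr => a _.
    rewrite sum_idx idx_case_rr mul0r addr0; apply: eq_bigr => i _.
    by rewrite idx_case_xidx pd1.
  by rewrite sum_idx idx_case_rr pd2 mulNr big1 ?add0r// => i _; rewrite idx_case_xidx mul0r.
rewrite !mxE Dop_component -[pd rr F1 x 0 c]delta_sum addrC; congr (_ + _); apply: eq_bigr => a _.
  rewrite sum_idx idx_case_rr mul0r addr0; apply: eq_bigr => i _.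
  by rewrite idx_case_xidx pd2.
by rewrite sum_idx idx_case_rr pd1 big1 ?add0r// => i _; rewrite idx_case_xidx mul0r.
Qed.

(** Elliptic regularity asks for harmonicity of every C^2 solution of the real system; such a
    solution is reassembled into algebra-valued functions G1 and G2, for which D Dbar = Dbar D =
    [lap_p] gives it. *)
Lemma slice_regular_smooth U F1 F2 : open U -> Cn 1 U F1 -> Cn 1 U F2 ->
  (forall x, U x -> Dop mul cv F1 x - pd rr F2 x = 0) ->
  (forall x, U x -> Dop mul cb F2 x + pd rr F1 x = 0) ->
  forall N, Cn N U F1 /\ Cn N U F2.
Proof.
move=> oU c1 c2 E1 E2 N.
suff H i : Cn N U (pair_component F1 F2 i).
  by split; apply/(Cn_mxP N _ oU) => a; [exact: (H (inl a))|exact: (H (inr a))].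
apply: (elliptic_regularity (coef := slice_coef)) => // [U' u oU' cu su i' x Ux|i'|j x Ux].
- pose G1 x := \row_a u (inl a) x; pose G2 x := \row_a u (inr a) x.
  have uE : pair_component G1 G2 = u.
    by apply: funext => -[] a; apply: funext => z; rewrite /= mxE.
  have cG1 : Cn 2 U' G1.
    by apply/(Cn_mxP 2 _ oU') => a; rewrite (_ : (fun y => _) = u (inl a))// -uE.
  have cG2 : Cn 2 U' G2.
    by apply/(Cn_mxP 2 _ oU') => a; rewrite (_ : (fun y => _) = u (inr a))// -uE.
  have EG1 y : U' y -> Dop mul cv G1 y - pd rr G2 y = 0.
    move=> Uy; apply/rowP => a; rewrite -(slice_coef_sum (inl a) (CnW cG1) (CnW cG2) Uy) uE mxE.
    exact: su.
  have EG2 y : U' y -> Dop mul cb G2 y + pd rr G1 y = 0.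
    move=> Uy; apply/rowP => a; rewrite -(slice_coef_sum (inr a) (CnW cG1) (CnW cG2) Uy) uE mxE.
    exact: su.
  have [l1 l2] := slice_regular_harmonic mulr_lin mull_lin mul1 v0 vsq vanti oU' cG1 cG2 EG1 EG2 Ux.
  have comp (G : 'rV[R]_(p.+1 + 1) -> 'rV[R]_d) a : Cn 2 U' G -> lap (fun y => G y 0 a) x = lap G x 0 a.
    move=> cG; rewrite /lap summxE; apply: eq_bigr => s _.
    rewrite -(pd_mx s a (Cn_pd s cG) Ux).
    by apply: (pd_ext s oU' _ Ux) => y Uy; rewrite (pd_mx s a cG Uy).
  by rewrite -uE; case: i' => a /=; rewrite comp// ?l1 ?l2 mxE.
- by case: i' => a /=; [exact: ((Cn_mxP 1 F1 oU).1 c1 a)|exact: ((Cn_mxP 1 F2 oU).1 c2 a)].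
- by rewrite (slice_coef_sum j c1 c2 Ux); case: j => a; rewrite ?E1 ?E2// mxE.
Qed.

End SliceRegularity.

(** * The operators A and B *)

Section RadialOperators.
Context {R : realType} {p d : nat}.
Variable D : set 'rV[R]_(p.+1 + 1).
Hypotheses (oD : open D) (symD : forall x, D x -> D (reflr x)).
Implicit Types (F : 'rV[R]_(p.+1 + 1) -> 'rV[R]_d) (x : 'rV[R]_(p.+1 + 1)).
(** The inverse of 0 is 0, so for k > 0 the function [Aop k F] takes the value 0 on r = 0 whatever F
    is. The literal operators are compared with iterates of [rder] on this open set only, where
    derivatives do not see r = 0. *)
Let W := D `&` [set x | rcoord x != 0].

Let oW : open W.
Proof.
apply: openI => //; apply: (@open_comp _ _ (fun y : 'rV[R]_(p.+1 + 1) => y 0 (ridx p)) [set r | r != 0]).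
  by move=> ? _; exact: coord_continuous.
exact: open_neq.
Qed.

Lemma evsmooth_iter k F : evsmooth D F -> evsmooth D (iter k (@rder R p d) F).
Proof. by move=> eF; elim: k => // k IH; exact: evsmooth_rder. Qed.

Lemma Aop_rder k F x : evsmooth D F -> D x -> rcoord x != 0 ->
  Aop k F x = iter k (@rder R p d) F x.
Proof.
move=> eF Dx x0; have Wx : W x by [].
elim: k x {Dx x0} Wx => [|k IH] x Wx //=; have [Dx x0] := Wx.
by rewrite (pd_ext (ridx p) oW IH Wx) /rder /qdiv (negbTE x0).
Qed.

(** Multiplication by r intertwines the two operators: d_r ((1/r) (r h)) = d_r h = r (T h). *)
Lemma Bop_rder k F x : smooth D F -> oddr D F -> D x -> rcoord x != 0 ->
  Bop k F x = rcoord x *: iter k (@rder R p d) (qdiv F) x.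
Proof.
move=> sF oF Dx x0; have Wx : W x by [].
have eG : evsmooth D (qdiv F) by split; [exact: smooth_qdiv|exact: evenr_qdiv].
elim: k x {Dx x0} Wx => [|k IH] x Wx; have [Dx x0] := Wx; first exact: (qdivK (D := D)).
have E y : W y -> (rcoord y)^-1 *: Bop k F y = iter k (@rder R p d) (qdiv F) y.
  by move=> Wy; have [_ y0] := Wy; rewrite (IH _ Wy) scalerA mulVf// scale1r.
by rewrite [LHS](pd_ext (ridx p) oW E Wx) (pd_rr oD symD (evsmooth_iter k eG) Dx).
Qed.

Lemma cvg_radial (xp : 'rV[R]_p.+1) F : smooth D F -> D (mkpt xp 0) ->
  F (mkpt xp r) @[r --> (0 : R)^'] --> F (mkpt xp 0).
Proof.
move=> sF Dx; apply/cvgrPdist_le => e e0.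
have /near_rVP[r r0 H] := (continuous_atP _ _).1 (Cn_continuous (sF 0%N) Dx) _ e0.
exists r => // t /=; rewrite sub0r normrN => tr _; apply: H.
have -> : mkpt xp t = t *: axis (ridx p) + mkpt xp 0.
  apply/rowP => s; rewrite [RHS]mxE [in X in _ = X + _]mxE axisE; case: (idx_split s) => [->|[i ->]].
    by rewrite eqxx mulr1 -[mkpt xp t 0 _]/(rcoord _) -[mkpt xp 0 0 _]/(rcoord _) !rcoord_mkpt addr0.
  by rewrite xidx_neq mulr0 add0r !row_mxEl.
by rewrite addrK; apply: le_lt_trans (norm_scale_axis _ _) _.
Qed.

Lemma near_radial (xp : 'rV[R]_p.+1) : D (mkpt xp 0) ->
  \forall r \near (0 : R)^', D (mkpt xp r) /\ rcoord (mkpt xp r) != 0.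
Proof.
move=> Dx; have [r r0 H] := open_rVP oD Dx.
exists r => // t /=; rewrite sub0r normrN rcoord_mkpt => tr t0; split => //; apply: H.
apply: le_lt_trans tr; apply: norm_rV_le => // i; rewrite !mxE.
case: (fintype.split i) => j; first by rewrite subrr normr0.
by rewrite !mxE subr0.
Qed.

End RadialOperators.

(** * From the iterated Laplacian to the stated formula *)

Lemma prod_odd_dfact (R : realType) k :
  \prod_(i < k) ((k.*2.+1)%:R - (1 + 2 * i%:R)) = (dfact k.*2)%:R :> R.
Proof.
elim: k => [|k IH]; first by rewrite big_ord0.
rewrite doubleS big_ord_recl /= natrM -IH mulr0 addr0; congr (_ * _).
  by rewrite -[X in X - _]natr1 addrK.
apply: eq_bigr => i _; rewrite /bump /= natrD -[(k.*2.+3)]addn2 natrD.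
by ring.
Qed.

Lemma slice_row_mx (R : realType) (d p q : nat) (mul : 'rV[R]_d -> 'rV[R]_d -> 'rV[R]_d)
  (v : 'I_(p.+1 + q) -> 'rV[R]_d) F G (xp : 'rV[R]_p.+1) (r : R) (w : 'rV[R]_q) :
  (forall (k : R) a b c, mul (k *: a + b) c = k *: mul a c + mul b c) -> unit_row w -> 0 <= r ->
  slice mul v F G (row_mx xp (r *: w)) =
  F (mkpt xp r) + r *: mul (vec_q v w) (G (mkpt xp r)).
Proof.
move=> mull_lin w1 r0; rewrite /slice rho_row_mx//; congr (_ + _).
have linl c : forall (k : R) a b, mul (k *: a + b) c = k *: mul a c + mul b c by move=> *; exact: mull_lin.
rewrite /vec_q (lin_sum (linl _)) scaler_sumr; apply: eq_bigr => j _.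
by rewrite row_mxEr mxE (linZ (linl _)) scalerA.
Qed.

Unset Implicit Arguments.

(** The C^q clause makes the iterated Laplacian a classical one: with q = 2k + 1, it takes 2k
    derivatives and the Dirac operator one more. The points with r = 0 form a separate clause, where
    A and B stand for their limits. *)
Theorem theorem4p9 (R : realType) (d : nat)
  (mul : 'rV[R]_d -> 'rV[R]_d -> 'rV[R]_d) (one : 'rV[R]_d)
  (cj : 'rV[R]_d -> 'rV[R]_d)
  (p q : nat) (v : 'I_(p.+1 + q) -> 'rV[R]_d)
  (D : set 'rV[R]_(p.+1 + 1))
  (F1 F2 : 'rV[R]_(p.+1 + 1) -> 'rV[R]_d)
  (f : 'rV[R]_(p.+1 + q) -> 'rV[R]_d) :
  (* standing assumptions on the algebra *)
  alt_algebra mul one cj ->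
  (exists x, in_S_A mul one cj x) ->
  (* the basis (v_0, ..., v_m) of M, m = p + q, q >= 1 *)
  (0 < q)%N ->
  v (lshift q (ord0 : 'I_p.+1)) = one ->
  (forall s, s != lshift q (ord0 : 'I_p.+1) -> in_S_A mul one cj (v s)) ->
  (forall s t, s != lshift q (ord0 : 'I_p.+1) -> t != lshift q (ord0 : 'I_p.+1) ->
     s != t -> mul (v s) (v t) = - mul (v t) (v s)) ->
  (forall c : 'rV[R]_(p.+1 + q), \sum_s c 0 s *: v s = 0 -> c = 0) ->
  (forall c : 'rV[R]_(p.+1 + q), in_Q_A mul one cj (\sum_s c 0 s *: v s)) ->
  (* D open and invariant under (x_p, r) |-> (x_p, -r) *)
  open D ->
  (forall xp r, D (mkpt xp r) -> D (mkpt xp (- r))) ->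
  (* (F1, F2) is a stem function *)
  (forall xp r, D (mkpt xp r) -> F1 (mkpt xp (- r)) = F1 (mkpt xp r)) ->
  (forall xp r, D (mkpt xp r) -> F2 (mkpt xp (- r)) = - F2 (mkpt xp r)) ->
  (* f is the generalized partial-slice function induced by F *)
  (forall xp r w, D (mkpt xp r) -> 0 <= r -> unit_row w ->
     f (row_mx xp (r *: w)) = F1 (mkpt xp r) + mul (vec_q v w) (F2 (mkpt xp r))) ->
  (* f is generalized partial-slice regular *)
  Ck 1 D F1 -> Ck 1 D F2 ->
  (forall x', D x' ->
     \sum_(i < p.+1) mul (v (lshift q i)) (pd (xidx i) F1 x') - pd (ridx p) F2 x' = 0) ->
  (forall x', D x' ->
     pd (xidx ord0) F2 x'
     - \sum_(i < p.+1 | i != ord0) mul (v (lshift q i)) (pd (xidx i) F2 x')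
     + pd (ridx p) F1 x' = 0) ->
  (* q odd *)
  odd q ->
  let k := (q.-1)./2 in
  let g := iter k (@lap R (p.+1 + q) _) f in
  [/\ Ck q (@Omega R p q D) f,
      monogenic mul v (@Omega R p q D) g,
      (forall xp r w, D (mkpt xp r) -> 0 < r -> unit_row w ->
         g (row_mx xp (r *: w)) =
         (dfact q.-1)%:R *: (Aop k F1 (mkpt xp r) + mul (vec_q v w) (Bop k F2 (mkpt xp r)))) &
      (forall xp, D (mkpt xp 0) ->
         exists LA LB : 'rV[R]_d,
           [/\ (fun rho : R => Aop k F1 (mkpt xp rho)) @ 0^' --> LA,
               (fun rho : R => Bop k F2 (mkpt xp rho)) @ 0^' --> LB &
               forall w, unit_row w ->
                 g (row_mx xp (0 *: w)) = (dfact q.-1)%:R *: (LA + mul (vec_q v w) LB)])].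
Proof.
move=> [_ [mullin mulrin mul1 alt] _ [_ _ _]] _ q0 v0 vS vA _ _ oD symD' F1e F2o fE cF1 cF2 E1 E2 oq k g.
have mulr_lin a (c : R) b b' : mul a (c *: b + b') = c *: mul a b + mul a b' by exact: mulrin.
have mull_lin (c : R) a a' b : mul (c *: a + a') b = c *: mul a b + mul a' b by exact: mullin.
have linl b : forall (c : R) a a', mul (c *: a + a') b = c *: mul a b + mul a' b by move=> *.
have mul1l a : mul one a = a by have [] := mul1 a.
have altl a b : mul (mul a a) b = mul a (mul a b).
  by have [/eqP + _ _] := alt a b; rewrite subr_eq0 => /eqP.
(* Trace 0 gives v_s^c = - v_s, norm 1 then gives v_s v_s = - 1, and left alternativity puts the
   square into nested form. *)
have vsq s b : s != lshift q (ord0 : 'I_p.+1) -> mul (v s) (mul (v s) b) = - b.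
  move=> /vS [/eqP]; rewrite /trace_A addrC addr_eq0 => /eqP vc.
  rewrite /norm_A vc (algNr mulr_lin) -altl => /(congr1 (fun a => mul (- a) b)).
  by rewrite opprK (algNl mull_lin) mul1l.
(* Linearization of (a a) b = a (a b) at a = v_s + v_t; anticommutation cancels the cross terms on
   the left. *)
have vanti s t b : s != lshift q (ord0 : 'I_p.+1) -> t != lshift q (ord0 : 'I_p.+1) -> s != t ->
    mul (v s) (mul (v t) b) = - mul (v t) (mul (v s) b).
  move=> s0 t0 st; apply/eqP; rewrite -addr_eq0; apply/eqP.
  have sq : mul (v s + v t) (v s + v t) = mul (v s) (v s) + mul (v t) (v t).
    by rewrite (linD (linl _)) !(linD (mulr_lin _)) (vA s t s0 t0 st) addrA subrK.
  have := altl (v s + v t) b.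
  rewrite sq (linD (linl b)) !altl [in X in _ = mul _ X](linD (linl b)) (linD (linl _)).
  rewrite !(linD (mulr_lin _)) -addrA => /addrI; rewrite addrA => /esym/eqP.
  by rewrite -subr_eq0 addrK => /eqP.
have symD x : D x -> D (reflr x) by rewrite {1 2}(mkpt_eta x) reflr_mkpt; exact: symD'.
have F1even : evenr D F1 by move=> x; rewrite {1 2 3}(mkpt_eta x) reflr_mkpt; exact: F1e.
have F2odd : oddr D F2 by move=> x; rewrite {1 2 3}(mkpt_eta x) reflr_mkpt; exact: F2o.
have {}E2 x : D x -> Dop mul (fun i => vbar one v (lshift q i)) F2 x + pd (ridx p) F1 x = 0.
  move=> Dx; rewrite -[RHS](E2 x Dx); congr (_ + _); rewrite /Dop (bigD1 ord0)//= -sumrN.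
  rewrite {1}/vbar eqxx mul1l; congr (_ + _); apply: eq_bigr => i i0.
  by rewrite /vbar (inj_eq (@lshift_inj _ _)) (negbTE i0) (algNl mull_lin).
have sF := slice_regular_smooth mulr_lin mull_lin mul1l v0 vsq vanti oD (Cn_intro cF1) (Cn_intro cF2) E1 E2.
have eF : evsmooth D F1 by split => // N; have [] := sF N.
have sF2 : smooth D F2 by move=> N; have [] := sF N.
pose G := qdiv F2.
have eG : evsmooth D G by split; [exact: smooth_qdiv|exact: evenr_qdiv].
have F2E x : D x -> F2 x = rcoord x *: G x by move=> Dx; exact: (qdivK F2odd Dx).
have cr := Cn_coord 1 (ridx p) oD.
(* The parameter is 1 because d_r F2 = d_r (r G) = G + r^2 (T G). The second relation is r (Dbar G)
   = Dbar F2 = - d_r F1 divided by r, by uniqueness of [rder]. *)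
have P : slice_pair mul one v D 1 F1 G.
  split => // x Dx.
    have -> : Dop mul (fun i => v (lshift q i)) F1 x = pd (ridx p) F2 x.
      by apply/eqP; rewrite -subr_eq0; apply/eqP; exact: E1.
    rewrite (pd_ext (ridx p) oD F2E Dx) (pd_scale (ridx p) cr (eG.1 1%N) Dx) pd_coord eqxx.
    by rewrite (pd_rr oD symD eG Dx) scalerA addrC expr2.
  apply/eqP; rewrite eq_sym eqr_oppLR; apply/eqP.
  have eN : evsmooth D (fun y => - Dop mul (fun i => vbar one v (lshift q i)) G y).
    apply: (evsmooth_lin oD (L := fun b => - b)); last exact: evsmooth_Dop.
    by move=> c a b; rewrite opprD scalerN.
  apply: (rder_unique oD eN.1 _ Dx) => y Dy.
  have /eqP := E2 y Dy; rewrite addrC addr_eq0 => /eqP ->.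
  rewrite (Dop_ext _ _ oD F2E Dy) scalerN (Dop_scale mulr_lin _ cr (eG.1 1%N) Dy)// => i.
  by rewrite pd_coord eq_sym xidx_neq.
have OmE := Omega_rho D q0.
have oO := open_rho_preimage (q := q) oD.
have f_slice z : [set y | D (rho y)] z -> f z = slice mul v F1 G z.
  rewrite -OmE => -[xp [r [w [Dr r0 w1 ->]]]].
  by rewrite slice_row_mx// fE// F2E// rcoord_mkpt (linZ (mulr_lin _)).
have qE : q = k.*2.+1 by rewrite /k -[q in LHS](odd_double_half) oq add1n; case: (q) oq => //= q' /negbTE oq'; rewrite uphalf_half oq'.
have kE : k.*2 = q.-1 by rewrite [in RHS]qE.
have prodE : \prod_(i < k) (q%:R - (1 + 2 * i%:R)) = (dfact q.-1)%:R :> R.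
  by rewrite -kE -prod_odd_dfact -qE.
have gE y : [set y | D (rho y)] y -> g y = (dfact q.-1)%:R *:
    slice mul v (iter k (@rder R p d) F1) (iter k (@rder R p d) G) y.
  move=> Oy; rewrite /g (iter_lap_slice mulr_lin mull_lin mul1l v0 vsq vanti oD symD k P f_slice Oy).
  by rewrite prodE.
have Pk := slice_pair_iter mulr_lin oD symD k P.
have [eFk eGk _ _] := Pk.
have cS N := Cn_slice v mulr_lin oD symD N eFk eGk.
split.
- rewrite OmE; apply: Cn_Ck; apply: (Cn_ext oO (g := slice mul v F1 G)).
    by move=> y Oy; rewrite f_slice.
  exact: Cn_slice.
- rewrite OmE; split.
    apply: Cn_Ck; apply: (Cn_ext oO _ (CnZ (dfact q.-1)%:R oO (cS 1%N))) => y Oy.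
    by rewrite gE.
  move=> y Oy.
  (* After k steps the parameter has reached q, the value at which the Dirac operator annihilates
     the slice function. *)
  have aE : 1 + 2 * k%:R = q%:R :> R.
    have -> : q%:R = k.*2%:R + 1 :> R by rewrite natr1 -qE.
    by rewrite -[k.*2]mul2n natrM addrC.
  rewrite aE in Pk.
  have dS := dirac_slice mulr_lin mull_lin mul1l v0 vsq vanti oD symD Pk Oy.
  transitivity ((dfact q.-1)%:R *: Defs.dirac mul v (slice mul v (iter k (@rder R p d) F1)
      (iter k (@rder R p d) G)) y); last by rewrite dS scaler0.
  rewrite /Defs.dirac scaler_sumr; apply: eq_bigr => s _.
  by rewrite (pd_ext s oO gE Oy) (pdZ _ s (cS 1%N) Oy) (linZ (mulr_lin _)).
- move=> xp r w Dr r0 w1.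
  have Oy : [set y | D (rho y)] (row_mx xp (r *: w)) by rewrite /= rho_row_mx// ltW.
  rewrite (gE _ Oy) slice_row_mx// ?ltW//; congr (_ *: (_ + _)).
    by rewrite (Aop_rder oD) ?rcoord_mkpt ?gt_eqF.
  by rewrite (Bop_rder oD symD) ?rcoord_mkpt ?gt_eqF// (linZ (mulr_lin _)).
(* B is r times a function continuous at r = 0, so its limit is 0, as it must be for the formula to
   hold with every direction w at x_q = 0. *)
- move=> xp Dx; exists (iter k (@rder R p d) F1 (mkpt xp 0)), 0.
  have nr := near_radial oD Dx.
  split.
  + apply: cvg_trans (cvg_radial eFk.1 Dx); apply: near_eq_cvg.
    by apply: filterS nr => r [Dr r0]; rewrite (Aop_rder oD).
  + have lim : (fun r : R => r *: iter k (@rder R p d) G (mkpt xp r)) @ (0 : R)^' --> (0 : 'rV[R]_d).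
      rewrite -[X in _ --> X](scale0r (iter k (@rder R p d) G (mkpt xp 0))).
      apply: cvgZ; last exact: (cvg_radial eGk.1 Dx).
      exact: cvg_within.
    apply: cvg_trans lim; apply: near_eq_cvg.
    by apply: filterS nr => r [Dr r0]; rewrite (Bop_rder oD symD)// rcoord_mkpt.
  + move=> w w1.
    have Oy : [set y | D (rho y)] (row_mx xp (0 *: w)) by rewrite /= rho_row_mx.
    by rewrite (gE _ Oy) slice_row_mx// scale0r (lin0 (mulr_lin _)).
Qed.
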